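(* Let $\mathcal{N}:A\to B$ be a quantum channel between finite-dimensional systems. The classical capacity $C_C(\mathcal{N})$ and the entanglement transmission capacity (the quantum capacity) $C_Q(\mathcal{N})$ are special cases of the generalized capacity for the transmission of a fully classical state and a pure entangled state, respectively, as follows: $$C_C(\mathcal{N})=C_G(\rho^{A'R},\mathcal{N}),\qquad C_Q(\mathcal{N})=C_G(|\psi\rangle^{A'R},\mathcal{N}),$$ where systems $A'$ and $R$ of the state $\rho^{A'R}=\sum_x p(x)|x\rangle\langle x|^{A'}\otimes|x\rangle\langle x|^R$ are classical ($p$ a probability distribution, $\{|x\rangle\}$ orthonormal bases), and $|\psi\rangle^{A'R}$ is a pure entangled state.
   Context: All systems are finite-dimensional; $\log$ is binary; $S$ is the von Neumann entropy; fidelity is $F(\rho,\xi)=\|\sqrt\rho\sqrt\xi\|_1$ (not squared). $C_C(\mathcal{N})$ is the standard (unassisted, asymptotic) capacity of $\mathcal{N}$ for transmitting classical messages, and $C_Q(\mathcal{N})$ the standard capacity of $\mathcal{N}$ for transmitting entanglement. Koashi-Imoto (KI) decomposition. Associated to a state $\rho^{A'R}$ there are Hilbert spaces $C,N,Q$ and an isometry $U_{KI}:A'\hookrightarrow CNQ$, unique up to trivial change of bases of $C,N,Q$, such that: (i) $(U_{KI}\otimes 1_R)\rho^{A'R}(U_{KI}^\dagger\otimes 1_R)=\sum_c p_c|c\rangle\langle c|^C\otimes\mu_c^N\otimes\omega_c^{QR}=:\omega^{CNQR}$, where $\{|c\rangle\}$ is an orthonormal basis of $C$, $p_c$ is a probability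 distribution, and $\mu_c^N$, $\omega_c^{QR}$ are states on $N$ and $Q\otimes R$; and (ii) for every CPTP map $\Lambda$ on $A'$ with $(\Lambda\otimes\mathrm{id}_R)\rho^{A'R}=\rho^{A'R}$, every isometric extension $U:A'\hookrightarrow A'E$ of $\Lambda$ has the form $U=(U_{KI}\otimes 1_E)^\dagger\big(\sum_c|c\rangle\langle c|^C\otimes U_c^N\otimes 1_c^Q\big)U_{KI}$ with isometries $U_c:N\hookrightarrow NE$ satisfying $\mathrm{Tr}_E[U_c\mu_cU_c^\dagger]=\mu_c$ for all $c$. Generalized capacity. For $\epsilon>0$, $n\ge1$, $C_G(\rho^{A'R},n,\epsilon,\mathcal{N})$ is the maximum of $mS(CQ)_\omega/n$ over all $m$ for which there exist CPTP maps $\mathcal{E}_n:A'^m\to A^n$ and $\mathcal{D}_n:B^n\to A'^m$ with $F\big((\rho^{A'R})^{\otimes m},(\mathcal{D}_n\circ\mathcal{N}^{\otimes n}\circ\mathcal{E}_n\otimes\mathrm{id}_{R^m})(\rho^{A'R})^{\otimes m}\big)\ge1-\epsilon$, where $S(CQ)_\omega$ is the entropy of the reduced state on $CQ$ of the KI decomposition of $\rho^{A'R}$. Then $C_G(\rho^{A'R},\mathcal{N}):=\inf_{\epsilon>0}\liminf_{n\to\infty}C_G(\rho^{A'R},n,\epsilon,\mathcal{N})$. For a pure state, $C_G(|\psi\rangle^{A'R},\mathcal{N}):=C_G(|\psi\rangle\langle\psi|^{A'R},\mathcal{N})$.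
   Formalization: The distribution p is assumed non-deterministic (for a point mass S(CQ)=0, so C_G=0 although C_C may be positive); A is nonzero; condition (ii) of the KI decomposition is required only on the support of the reduced state on A', since off it (ii) can fail. *)

(* Defs.v *)
From HB Require Import structures.
From mathcomp Require Import all_boot all_order all_algebra.
From mathcomp Require Import complex.
From mathcomp Require Import all_classical all_reals all_analysis.

Set Implicit Arguments.
Unset Strict Implicit.
Unset Printing Implicit Defensive.

Import Order.TTheory GRing.Theory Num.Theory.
Local Open Scope ring_scope.
Local Open Scope classical_set_scope.
Local Open Scope sesquilinear_scope.
Local Open Scope complex_scope.

(** A finite-dimensional system is given by a finite type [T] labelling an
    orthonormal basis; its Hilbert space is C^T.  Composite systems are product
    types, and the [n]-th tensor power of [T] is [{ffun 'I_n -> T}].  Operators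
    are MathComp matrices, with rows and columns numbered by [enum_rank]. *)
Notation LinMx R S T := 'M[R[i]]_(#|{: T}|, #|{: S}|).
Notation OpMx R T := (LinMx R T T).
Notation KetMx R T := 'cV[R[i]]_#|{: T}|.

Definition entry (R : realType) (S T : finType) (M : LinMx R S T)
    (t : T) (s : S) : R[i] :=
  M (enum_rank t) (enum_rank s).

Definition mkhom (R : realType) (S T : finType) (f : T -> S -> R[i]) :
    LinMx R S T :=
  \matrix_(i, j) f (enum_val i) (enum_val j).

Definition tens (R : realType) (S T S' T' : finType)
    (M : LinMx R S T) (M' : LinMx R S' T') : LinMx R (S * S') (T * T') :=
  mkhom (fun t s => entry M t.1 s.1 * entry M' t.2 s.2).

(** Partial trace over the second factor. *)
Definition ptrace2 (R : realType) (S T : finType) (X : OpMx R (S * T)) : OpMx R S :=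
  mkhom (fun s s' => \sum_(t : T) entry X (s, t) (s', t)).

Definition isometric (R : realType) (S T : finType) (U : LinMx R S T) : Prop :=
  U ^t* *m U = 1%:M.

(** On [R[i]], [0 <= z] says that [z] is real and nonnegative, so Hermitian
    symmetry is implied. *)
Definition psd (R : realType) (n : nat) (X : 'M[R[i]]_n) : Prop :=
  forall v : 'cV[R[i]]_n, 0 <= (v ^t* *m X *m v) 0 0.

Definition is_state (R : realType) (n : nat) (X : 'M[R[i]]_n) : Prop :=
  psd X /\ \tr X = 1.

Definition is_distr (R : realType) (X : finType) (p : X -> R) : Prop :=
  (forall x, 0 <= p x) /\ \sum_x p x = 1.

(** [(Phi (x) id_E) X], computed on the blocks of [X] indexed by the basis
    of [E]. *)
Definition ext_id (R : realType) (S T E : finType) (Phi : OpMx R S -> OpMx R T)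
    (X : OpMx R (S * E)) : OpMx R (T * E) :=
  mkhom (fun t t' =>
    entry (Phi (mkhom (fun s s' => entry X (s, t.2) (s', t'.2)))) t.1 t'.1).

Definition is_channel (R : realType) (S T : finType)
    (Phi : {linear OpMx R S -> OpMx R T}) : Prop :=
  (forall (E : finType) (X : OpMx R (S * E)), psd X -> psd (ext_id Phi X)) /\
  (forall X : OpMx R S, \tr (Phi X) = \tr X).

(** [Phi^{(x) n}], by linear extension of
    [|a><a'| |-> (x)_i Phi (|a_i><a'_i|)]. *)
Definition channel_pow (R : realType) (S T : finType) (Phi : OpMx R S -> OpMx R T)
    (n : nat) (X : OpMx R {ffun 'I_n -> S}) : OpMx R {ffun 'I_n -> T} :=
  \sum_(a : {ffun 'I_n -> S}) \sum_(a' : {ffun 'I_n -> S})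
    entry X a a' *:
      mkhom (fun b b' : {ffun 'I_n -> T} =>
        \prod_(i < n)
          entry (Phi (delta_mx (enum_rank (a i)) (enum_rank (a' i))))
                (b i) (b' i)).

(** [rho^{(x) m}] for a state of [S * T], regrouped as a state of
    [S^m * T^m]. *)
Definition state_pow (R : realType) (S T : finType) (rho : OpMx R (S * T))
    (m : nat) : OpMx R ({ffun 'I_m -> S} * {ffun 'I_m -> T}) :=
  mkhom (fun x y : {ffun 'I_m -> S} * {ffun 'I_m -> T} =>
    \prod_(i < m) entry rho (x.1 i, x.2 i) (y.1 i, y.2 i)).

Definition log2 (R : realType) (x : R) : R := ln x / ln 2.

(** The convention [0 * log 0 = 0] holds because [ln 0 = 0]. *)
Definition entropy (R : realType) (n : nat) (rho : 'M[R[i]]_n) : R :=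
  - \sum_(i < n) complex.Re (spectral_diag rho 0 i) *
                 log2 (complex.Re (spectral_diag rho 0 i)).

(** Functional calculus: the positive square root, for positive semidefinite
    arguments. *)
Definition sqrtmx (R : realType) (n : nat) (A : 'M[R[i]]_n) : 'M[R[i]]_n :=
  invmx (spectralmx A) *m diag_mx (map_mx sqrtC (spectral_diag A))
    *m spectralmx A.

Definition trace_norm (R : realType) (n : nat) (X : 'M[R[i]]_n) : R :=
  complex.Re (\tr (sqrtmx (X ^t* *m X))).

Definition fidelity (R : realType) (n : nat) (rho xi : 'M[R[i]]_n) : R :=
  trace_norm (sqrtmx rho *m sqrtmx xi).

(** [sum_c p_c |c><c|^C (x) mu_c^N (x) omega_c^{QR}]. *)
Definition KI_state (R : realType) (C N Q Rf : finType) (p : C -> R)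
    (mu : C -> OpMx R N) (om : C -> OpMx R (Q * Rf)) : OpMx R (C * N * Q * Rf) :=
  mkhom (fun x y : C * N * Q * Rf =>
    let: (c, k, q, r) := x in let: (c', k', q', r') := y in
    (c == c')%:R * (p c)%:C * entry (mu c) k k' * entry (om c) (q, r) (q', r')).

(** [sum_c |c><c|^C (x) U_c (x) 1^Q], with output factors reordered as
    [C * N * Q * E]. *)
Definition KI_block (R : realType) (C N Q E : finType)
    (U : C -> LinMx R N (N * E)) : LinMx R (C * N * Q) (C * N * Q * E) :=
  mkhom (fun (y : C * N * Q * E) (x : C * N * Q) =>
    let: (c', k', q', e) := y in let: (c, k, q) := x in
    (c' == c)%:R * entry (U c) (k', e) k * (q' == q)%:R).

(** Koashi-Imoto decomposition of [rho].  The form of the isometric extensions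
    [U] is required on the support of the reduced state of [rho], whence the
    factor [ptrace2 rho]; this factor can be cancelled when the reduced state
    has full rank.  Outside of that support a channel fixing [rho] is
    unconstrained. *)
Definition is_KI (R : realType) (A' Rf C N Q : finType) (rho : OpMx R (A' * Rf))
    (UKI : LinMx R A' (C * N * Q)) (p : C -> R) (mu : C -> OpMx R N)
    (om : C -> OpMx R (Q * Rf)) : Prop :=
  [/\ isometric UKI,
      [/\ is_distr p, (forall c, is_state (mu c)) & (forall c, is_state (om c))],
      tens UKI (1%:M : OpMx R Rf) *m rho *m (tens UKI (1%:M : OpMx R Rf)) ^t* =
        KI_state p mu om
    & forall L : {linear OpMx R A' -> OpMx R A'},
        is_channel L -> ext_id L rho = rho ->
        forall (E : finType) (U : LinMx R A' (A' * E)),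
          isometric U ->
          (forall X : OpMx R A', L X = ptrace2 (U *m X *m U ^t*)) ->
          exists Uc : C -> LinMx R N (N * E),
            (forall c, isometric (Uc c) /\
                       ptrace2 (Uc c *m mu c *m (Uc c) ^t*) = mu c) /\
            U *m ptrace2 rho =
              (tens UKI (1%:M : OpMx R E)) ^t* *m KI_block Q Uc *m UKI
                *m ptrace2 rho].

Definition marginal_CQ (R : realType) (C N Q Rf : finType)
    (om : OpMx R (C * N * Q * Rf)) : OpMx R (C * Q) :=
  mkhom (fun x y : C * Q =>
    \sum_(k : N) \sum_(r : Rf) entry om (x.1, k, x.2, r) (y.1, k, y.2, r)).

(** [S(CQ)_omega]: the value does not depend on the decomposition, which is
    picked by choice (default [0]). *)
Definition entropy_CQ (R : realType) (A' Rf : finType) (rho : OpMx R (A' * Rf)) :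
    R :=
  xget 0 [set s : R | exists (C N Q : finType) (UKI : LinMx R A' (C * N * Q))
      (p : C -> R) (mu : C -> OpMx R N) (om : C -> OpMx R (Q * Rf)),
    is_KI rho UKI p mu om /\ s = entropy (marginal_CQ (KI_state p mu om))].

Definition transmits (R : realType) (A B A' Rf : finType)
    (N : {linear OpMx R A -> OpMx R B}) (rho : OpMx R (A' * Rf)) (n : nat) (eps : R)
    (m : nat) : Prop :=
  exists (Enc : {linear OpMx R {ffun 'I_m -> A'} -> OpMx R {ffun 'I_n -> A}})
         (Dec : {linear OpMx R {ffun 'I_n -> B} -> OpMx R {ffun 'I_m -> A'}}),
    [/\ is_channel Enc, is_channel Dec
      & 1 - eps <= fidelity (state_pow rho m)
                     (ext_id (Dec \o @channel_pow R A B N n \o Enc)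
                             (state_pow rho m))].

(** The maximum over [m] is a supremum in the extended reals: it is [+oo] when
    the admissible [m] are unbounded (for instance if [1 <= eps]), and [m = 0]
    is admissible. *)
Definition CG_n (R : realType) (A B A' Rf : finType)
    (rho : OpMx R (A' * Rf)) (n : nat) (eps : R) (N : {linear OpMx R A -> OpMx R B}) :
    \bar R :=
  ereal_sup [set (m%:R * entropy_CQ rho / n%:R)%:E
            | m in [set m : nat | transmits N rho n eps m]].

Definition CG (R : realType) (A B A' Rf : finType)
    (rho : OpMx R (A' * Rf)) (N : {linear OpMx R A -> OpMx R B}) : \bar R :=
  ereal_inf [set limn_einf (fun n => CG_n rho n eps N)
            | eps in [set eps : R | 0 < eps]].

(** An [(n, M)] code: one input state per message and a POVM on the outputs;
    every message is decoded correctly with probability at least [1 - eps]. *)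
Definition classical_code (R : realType) (A B : finType)
    (N : {linear OpMx R A -> OpMx R B}) (n : nat) (eps : R) (M : nat) : Prop :=
  exists (enc : 'I_M -> OpMx R {ffun 'I_n -> A})
         (dec : 'I_M -> OpMx R {ffun 'I_n -> B}),
    [/\ (forall w, is_state (enc w)),
        (forall w, psd (dec w)), \sum_w dec w = 1%:M
      & forall w, 1 - eps <=
          complex.Re (\tr (dec w *m channel_pow N (enc w)))].

Definition max_entangled (R : realType) (K : nat) : OpMx R ('I_K * 'I_K) :=
  mkhom (fun x y : 'I_K * 'I_K =>
    (x.1 == x.2)%:R * (y.1 == y.2)%:R / K%:R).

(** One half of the maximally entangled state of Schmidt rank [K] is
    transmitted with fidelity at least [1 - eps]. *)
Definition entanglement_code (R : realType) (A B : finType)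
    (N : {linear OpMx R A -> OpMx R B}) (n : nat) (eps : R) (K : nat) : Prop :=
  exists (Enc : {linear OpMx R 'I_K -> OpMx R {ffun 'I_n -> A}})
         (Dec : {linear OpMx R {ffun 'I_n -> B} -> OpMx R 'I_K}),
    [/\ is_channel Enc, is_channel Dec
      & 1 - eps <= fidelity (max_entangled R K)
                     (ext_id (Dec \o @channel_pow R A B N n \o Enc)
                             (max_entangled R K))].

(** [code n eps M]: some code with [n] channel uses, error [eps] and size [M]
    exists.  The capacity is the supremum of the achievable rates. *)
Definition achievable (R : realType) (code : nat -> R -> nat -> Prop) (r : R) :
    Prop :=
  forall eps : R, 0 < eps -> exists n0 : nat, forall n : nat, (n0 <= n)%N ->
    exists M : nat,
      [/\ (0 < M)%N, n%:R * r <= log2 (M%:R : R) & code n eps M].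

Definition capacity (R : realType) (code : nat -> R -> nat -> Prop) : \bar R :=
  ereal_sup [set r%:E | r in [set r : R | achievable code r]].

Definition CC (R : realType) (A B : finType) (N : {linear OpMx R A -> OpMx R B}) :
    \bar R :=
  capacity (classical_code N).

Definition CQ (R : realType) (A B : finType) (N : {linear OpMx R A -> OpMx R B}) :
    \bar R :=
  capacity (entanglement_code N).

Definition orthonormal_basis (R : realType) (X T : finType) (e : X -> KetMx R T) :
    Prop :=
  (forall x y, (e x) ^t* *m e y = ((x == y)%:R)%:M) /\
  \sum_x e x *m (e x) ^t* = 1%:M.

(** The product vector [a (x) b]. *)
Definition tens_ket (R : realType) (S T : finType) (a : KetMx R S) (b : KetMx R T) :
    KetMx R (S * T) :=
  \col_i (a (enum_rank (enum_val i).1) 0 * b (enum_rank (enum_val i).2) 0).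

Definition ket_proj (R : realType) (n : nat) (v : 'cV[R[i]]_n) : 'M[R[i]]_n :=
  v *m v ^t*.

(** [sum_x p(x) |x><x| (x) |x><x|]. *)
Definition classical_state (R : realType) (X A' Rf : finType) (p : X -> R)
    (e : X -> KetMx R A') (f : X -> KetMx R Rf) : OpMx R (A' * Rf) :=
  \sum_x (p x)%:C *: tens (ket_proj (e x)) (ket_proj (f x)).

Definition entangled (R : realType) (S T : finType) (psi : KetMx R (S * T)) :
    Prop :=
  ~ exists (a : KetMx R S) (b : KetMx R T), psi = tens_ket a b.

(* Main.v *)
(** Both halves compare the capacity of ordinary block codes with the rate at
    which [rho^m] can be sent.

    KI decompositions: a slice of [rho] along a basis of the reference has rank
    one in both cases, which forces the states [mu_c] to be pure, so that
    [S(CQ)] is the entropy [H] of the reduced state, i.e. the Shannon entropy of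
    its spectrum [p].  Chebyshev's inequality gives about [2^(mH)] typical
    sequences for [p^m], of probability about [2^(-mH)] each.

    Classical case: the fidelity is [sum_x p(x) sqrt q(x)], with [q(x)] the
    probability of decoding [x] correctly.  A code for the typical sequences thus
    transmits the state; conversely, by Markov's inequality most typical
    sequences are decoded with small error and form a code.

    Quantum case: in terms of Kraus operators [K_k] of the overall channel and of
    [c_k(x) = <w_x|K_k|w_x>], where [w_x] are the eigenvectors of the reduced
    state, the squared fidelity is the positive quadratic form
    [sum_k |sum_x p(x) c_k(x)|^2] of the spectrum.  From the uniform spectrum
    (the maximally entangled state) to [p^m] one averages the form over the
    permutations of the basis.  From [p^m] to a uniform spectrum one uses
    convexity: the uniform distributions on [K]-sets are the vertices of the
    polytope of distributions bounded by [1/K]. *)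
Require Import Defs.
From HB Require Import structures.
From mathcomp Require Import all_boot all_order all_algebra.
From mathcomp Require Import fingroup perm complex.
From mathcomp Require Import all_classical all_reals all_analysis.
From mathcomp Require Import ring lra.
Set Implicit Arguments.
Unset Strict Implicit.
Unset Printing Implicit Defensive.
Import Order.TTheory GRing.Theory Num.Theory.
Local Open Scope ring_scope.
Local Open Scope sesquilinear_scope.
Local Open Scope complex_scope.

(** * Complex linear algebra *)

(** [S(CQ)] is picked by choice with default 0, so a Koashi-Imoto decomposition must be exhibited
    for both states. It can be written down because pure states are extreme: the Kraus operators of
    a channel fixing a pure state act on its vector as scalars. The conditions [p x < 1] and
    [entangled psi] make [H] positive. With [H = 0] every generalized rate [m * H / n] would be 0,
    whatever the channel. Both capacities then come from one reduction, [capacity_from_cores]. Its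
    inputs are one-shot bounds for a set [T] of labels, in which only the mass of [T], its size and
    the largest probability in it occur. The obstacle on the quantum side is coherence. The form
    giving the squared fidelity may have negative off-diagonal entries, so its value at one spectrum
    does not bound its restriction to a few eigenvectors, and good eigenvectors cannot be selected
    one by one as good messages can. *)

Section Complex.
Variable R : realType.
Implicit Types (z : R[i]) (x : R).

Lemma ReD (z w : R[i]) : complex.Re (z + w) = complex.Re z + complex.Re w.
Proof. by case: z w => a b []. Qed.

Lemma Re_sum (I : Type) (r : seq I) (P : pred I) (F : I -> R[i]) :
  complex.Re (\sum_(i <- r | P i) F i) = \sum_(i <- r | P i) complex.Re (F i).
Proof. exact: (big_morph _ ReD). Qed.

Lemma ReZ x z : complex.Re (x%:C * z) = x * complex.Re z.
Proof. by case: z => a b /=; rewrite mul0r subr0. Qed.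

Lemma real_complex_sum (I : Type) (r : seq I) (P : pred I) (F : I -> R) :
  (\sum_(i <- r | P i) F i)%:C = \sum_(i <- r | P i) (F i)%:C.
Proof. exact: (raddf_sum (real_complex R)). Qed.

Lemma ge0_RRe z : 0 <= z -> (complex.Re z)%:C = z.
Proof. by move=> /ger0_real /RRe_real. Qed.

Lemma Re_ge0 z : 0 <= z -> 0 <= complex.Re z.
Proof. by move=> z0; rewrite -ler0c ge0_RRe. Qed.

Lemma conj_real x : Num.conj (x%:C) = x%:C.
Proof. by apply/CrealP; rewrite complex_real. Qed.

Lemma sqrtC_complex x : 0 <= x -> sqrtC (x%:C) = (Num.sqrt x)%:C.
Proof.
move=> x0; rewrite -{1}(sqr_sqrtr x0) rmorphXn /=.
by rewrite sqrCK // ler0c sqrtr_ge0.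
Qed.

End Complex.

Section Adjoint.
Variable C : numClosedFieldType.

Lemma adjM m n p (A : 'M[C]_(m, n)) (B : 'M[C]_(n, p)) :
  (A *m B)^t* = B^t* *m A^t*.
Proof. by rewrite trmx_mul map_mxM. Qed.

Lemma adjZ m n a (A : 'M[C]_(m, n)) : (a *: A)^t* = Num.conj a *: A^t*.
Proof. by apply/matrixP=> i j; rewrite !mxE rmorphM. Qed.

Lemma adjD m n (A B : 'M[C]_(m, n)) : (A + B)^t* = A^t* + B^t*.
Proof. by apply/matrixP=> i j; rewrite !mxE rmorphD. Qed.

Lemma adj_sum m n (I : Type) (r : seq I) (P : pred I) (F : I -> 'M[C]_(m, n)) :
  (\sum_(i <- r | P i) F i)^t* = \sum_(i <- r | P i) (F i)^t*.
Proof.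
apply: (big_morph (fun A => A^t*)); first exact: adjD.
by apply/matrixP=> i j; rewrite !mxE rmorph0.
Qed.

Lemma adj1 n : (1%:M : 'M[C]_n)^t* = 1%:M.
Proof. by apply/matrixP=> i j; rewrite !mxE eq_sym; case: eqP; rewrite ?rmorph1 ?rmorph0. Qed.

Lemma mx11E (A : 'M[C]_1) : A = (A 0 0)%:M.
Proof. exact: mx11_scalar. Qed.

Definition dotp n (u v : 'cV[C]_n) : C := (u^t* *m v) 0 0.

Lemma dotpE n (u v : 'cV[C]_n) : u^t* *m v = (dotp u v)%:M.
Proof. exact: mx11E. Qed.

Lemma dotp_conj n (u v : 'cV[C]_n) : dotp u v = Num.conj (dotp v u).
Proof.
by rewrite /dotp -{1}(trmxCK v) -adjM 2!mxE.
Qed.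

Lemma dotpp n (u : 'cV[C]_n) : dotp u u = \sum_i `|u i 0| ^+ 2.
Proof. by rewrite /dotp mxE; apply: eq_bigr => i _; rewrite !mxE normCKC. Qed.

Lemma dotpp_ge0 n (u : 'cV[C]_n) : 0 <= dotp u u.
Proof. by rewrite dotpp; apply: sumr_ge0 => i _; rewrite exprn_ge0. Qed.

Lemma dotpp_eq0 n (u : 'cV[C]_n) : dotp u u = 0 -> u = 0.
Proof.
rewrite dotpp => /eqP; rewrite psumr_eq0 => [/allP h|i _]; last by rewrite exprn_ge0.
apply/colP=> i; rewrite mxE; apply/eqP.
by have := h i (mem_index_enum _); rewrite expf_eq0 /= normr_eq0.
Qed.

Lemma dotpDr n (u v w : 'cV[C]_n) : dotp u (v + w) = dotp u v + dotp u w.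
Proof. by rewrite /dotp mulmxDr mxE. Qed.

Lemma dotpDl n (u v w : 'cV[C]_n) : dotp (u + v) w = dotp u w + dotp v w.
Proof. by rewrite /dotp adjD mulmxDl mxE. Qed.

Lemma dotpZr n (u v : 'cV[C]_n) a : dotp u (a *: v) = a * dotp u v.
Proof. by rewrite /dotp -scalemxAr mxE. Qed.

Lemma dotpZl n (u v : 'cV[C]_n) a : dotp (a *: u) v = Num.conj a * dotp u v.
Proof. by rewrite /dotp adjZ -scalemxAl mxE. Qed.

Lemma dotp0r n (u : 'cV[C]_n) : dotp u 0 = 0.
Proof. by rewrite /dotp mulmx0 mxE. Qed.

Lemma dotp_sumr n (u : 'cV[C]_n) (I : Type) (r : seq I) (P : pred I) F :
  dotp u (\sum_(i <- r | P i) F i) = \sum_(i <- r | P i) dotp u (F i).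
Proof. by rewrite /dotp mulmx_sumr summxE. Qed.

Lemma dotp_mulr m n (u : 'cV[C]_m) (A : 'M[C]_(m, n)) (v : 'cV[C]_n) :
  dotp u (A *m v) = dotp (A^t* *m u) v.
Proof. by rewrite /dotp adjM trmxCK mulmxA. Qed.

Lemma outer_mul m n (u : 'cV[C]_m) (v w : 'cV[C]_n) :
  u *m v^t* *m w = dotp v w *: u.
Proof. by rewrite -mulmxA dotpE mul_mx_scalar. Qed.

Lemma mxtrace_outer n (u v : 'cV[C]_n) : \tr (u *m v^t*) = dotp v u.
Proof. by rewrite mxtrace_mulC dotpE mxtrace_scalar mulr1n. Qed.

Lemma dotp_delta n (X : 'M[C]_n) i j :
  dotp (delta_mx i 0) (X *m delta_mx j 0) = X i j.
Proof.
rewrite /dotp -colE.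
rewrite mxE (bigD1 i) //= big1 ?addr0 => [|k ki]; rewrite !mxE.
  by rewrite !eqxx rmorph1 mul1r.
by rewrite (negbTE ki) rmorph0 mul0r.
Qed.

(** Polarization: the form is real at [e_i + e_j] and at [e_i + i e_j], which gives two linear
    relations between [X i j], [X j i] and their conjugates; their sum is the claim. *)
Lemma pos_form_herm n (X : 'M[C]_n) :
  (forall v, 0 <= dotp v (X *m v)) -> X^t* = X.
Proof.
move=> h; apply/matrixP=> i j; rewrite !mxE.
pose e k : 'cV[C]_n := delta_mx k 0.
have E (c : C) : dotp (e i + c *: e j) (X *m (e i + c *: e j)) =
    X i i + c * X i j + Num.conj c * X j i + Num.conj c * c * X j j.
  rewrite mulmxDr -!scalemxAr dotpDl !dotpDr !dotpZl !dotpZr !dotp_delta; ring.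
have real v : Num.conj (dotp v (X *m v)) = dotp v (X *m v).
  by apply/CrealP/ger0_real/h.
have diag k : Num.conj (X k k) = X k k by have := real (e k); rewrite dotp_delta.
have := real (e i + 1 *: e j); have := real (e i + 'i *: e j).
rewrite !E !rmorphD !rmorphM /= !conjCi rmorphN /= !conjCi !rmorph1 !diag.
set a := X i j; set b := X j i; set a' := Num.conj a; set b' := Num.conj b.
move=> h1 h2.
have e1 : 'i * (b' - a') = 'i * (a - b).
  by apply/eqP; rewrite -subr_eq0; move/eqP: h1; rewrite -subr_eq0; congr (_ == 0); ring.
move/(mulfI (neq0Ci C)): e1 => e1.
have e2 : a' + b' = a + b.
  by apply/eqP; rewrite -subr_eq0; move/eqP: h2; rewrite -subr_eq0; congr (_ == 0); ring.
have /mulfI : 2%:R != 0 :> C by rewrite pnatr_eq0.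
apply; transitivity ((a' + b') + (b' - a')); first by ring.
by rewrite e1 e2; ring.
Qed.

End Adjoint.

Section Psd.
Variable R : realType.
Local Notation C := R[i].

Lemma psdE n (X : 'M[C]_n) : psd X <-> forall v, 0 <= dotp v (X *m v).
Proof. by split=> h v; have := h v; rewrite /dotp mulmxA. Qed.

Lemma psd_sum n (I : Type) (r : seq I) (P : pred I) (F : I -> 'M[C]_n) :
  (forall i, P i -> psd (F i)) -> psd (\sum_(i <- r | P i) F i).
Proof.
move=> h; apply/psdE => v; rewrite mulmx_suml dotp_sumr.
by apply: sumr_ge0 => i Pi; move/psdE: (h i Pi).
Qed.

Lemma psdZ n a (X : 'M[C]_n) : 0 <= a -> psd X -> psd (a *: X).
Proof. by move=> a0 /psdE h; apply/psdE=> v; rewrite -scalemxAl dotpZr mulr_ge0. Qed.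

Lemma psd_conj m n (A : 'M[C]_(m, n)) X : psd X -> psd (A *m X *m A^t*).
Proof.
by move=> /psdE h; apply/psdE=> v; rewrite -!mulmxA dotp_mulr; exact: h.
Qed.

Lemma psd_outer n (u : 'cV[C]_n) : psd (u *m u^t*).
Proof.
apply/psdE=> v; rewrite outer_mul dotpZr (dotp_conj v) mulrC -normCKC.
by rewrite exprn_ge0.
Qed.

Lemma psd1 n : psd (1%:M : 'M[C]_n).
Proof. by apply/psdE=> v; rewrite mul1mx dotpp_ge0. Qed.

Lemma psd_herm n (X : 'M[C]_n) : psd X -> X^t* = X.
Proof. by move=> /psdE /pos_form_herm. Qed.

End Psd.

(** * Spectral decompositions and positive square roots *)

Section Spectral.
Variable C : numClosedFieldType.

Definition orthonormal (X : eqType) n (v : X -> 'cV[C]_n) :=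
  forall x y, dotp (v x) (v y) = (x == y)%:R.

Lemma adj_sum_outer (X : finType) n (d : X -> C) (v : X -> 'cV[C]_n) :
  (\sum_x d x *: (v x *m (v x)^t*))^t* = \sum_x Num.conj (d x) *: (v x *m (v x)^t*).
Proof. by rewrite adj_sum; apply: eq_bigr => x _; rewrite adjZ adjM trmxCK. Qed.

Lemma sum_outer_mul (X : finType) n (d : X -> C) (v : X -> 'cV[C]_n) w :
  (\sum_x d x *: (v x *m (v x)^t*)) *m w = \sum_x (d x * dotp (v x) w) *: v x.
Proof.
rewrite mulmx_suml; apply: eq_bigr => x _.
by rewrite -scalemxAl outer_mul scalerA.
Qed.

Lemma sum_outer_eigen (X : finType) n (d : X -> C) (v : X -> 'cV[C]_n) y :
  orthonormal v -> (\sum_x d x *: (v x *m (v x)^t*)) *m v y = d y *: v y.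
Proof.
move=> ov; rewrite sum_outer_mul (bigD1 y) //= big1 ?addr0 ?ov ?eqxx ?mulr1 //.
by move=> x xy; rewrite ov (negbTE xy) mulr0 scale0r.
Qed.

Lemma sum_outerM (X : finType) n (c d : X -> C) (v : X -> 'cV[C]_n) :
  orthonormal v -> (\sum_x c x *: (v x *m (v x)^t*)) *m (\sum_x d x *: (v x *m (v x)^t*))
   = \sum_x (c x * d x) *: (v x *m (v x)^t*).
Proof.
move=> ov; rewrite mulmx_sumr; apply: eq_bigr => x _.
by rewrite -scalemxAr mulmxA sum_outer_eigen // -scalemxAl scalerA mulrC.
Qed.

(** A normal [A] equals [P^-1 D P] with [P = spectralmx A] unitary, so its eigenvectors are the
    columns of the adjoint of [P]. *)
Definition spectral_vec n (A : 'M[C]_n) (i : 'I_n) : 'cV[C]_n :=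
  col i ((spectralmx A)^t*).

Lemma mul_diag_outer n (P : 'M[C]_n) (d : 'rV[C]_n) :
  P^t* *m diag_mx d *m P = \sum_i d 0 i *: (col i (P^t*) *m (col i (P^t*))^t*).
Proof.
apply/matrixP=> i j; rewrite !mxE summxE; apply: eq_bigr => k _.
rewrite mul_mx_diag !mxE big_ord1 !mxE conjCK mulrA; congr (_ * _); exact: mulrC.
Qed.

Lemma spectral_vec_on n (A : 'M[C]_n) : orthonormal (spectral_vec A).
Proof.
move=> i j; have /unitarymxP /matrixP /(_ i j) := spectral_unitarymx A.
rewrite !mxE => <-; rewrite /dotp mxE; apply: eq_bigr => k _.
by rewrite !mxE conjCK.
Qed.

Lemma spectral_vec_complete n (A : 'M[C]_n) :
  \sum_i spectral_vec A i *m (spectral_vec A i)^t* = 1%:M.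
Proof.
have := spectral_unitarymx A; rewrite -trmxC_unitary => /unitarymxP.
rewrite trmxCK => <-.
have := mul_diag_outer (spectralmx A) (const_mx 1).
rewrite diag_const_mx mulmx1 => ->; apply: eq_bigr => i _.
by rewrite mxE scale1r.
Qed.

Lemma spectral_dec n (A : 'M[C]_n) : A^t* = A ->
  A = \sum_i spectral_diag A 0 i *: (spectral_vec A i *m (spectral_vec A i)^t*).
Proof.
move=> hA; have /orthomx_spectralP {1}-> : A \is normalmx.
  by apply/normalmxP; rewrite hA.
by rewrite (invmx_unitary (spectral_unitarymx _)) mul_diag_outer.
Qed.

(* The weights [|<u_i, v_x>|^2] vanish unless the eigenvalues agree. *)
Lemma spectral_sum (X : finType) n (d : X -> C) (v : X -> 'cV[C]_n) (A : 'M[C]_n)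
    (g : C -> C) :
  orthonormal v -> A^t* = A -> A = \sum_x d x *: (v x *m (v x)^t*) -> g 0 = 0 ->
  \sum_i g (spectral_diag A 0 i) = \sum_x g (d x).
Proof.
move=> ov hA Av g0; pose u := spectral_vec A; pose s := spectral_diag A 0.
have Au i : A *m u i = s i *: u i.
  by rewrite {1}(spectral_dec hA) sum_outer_eigen //; exact: spectral_vec_on.
have Avx x : A *m v x = d x *: v x by rewrite Av sum_outer_eigen.
have sreal i : Num.conj (s i) = s i.
  have : dotp (A *m u i) (u i) = dotp (u i) (A *m u i) by rewrite dotp_mulr hA.
  by rewrite Au dotpZl dotpZr spectral_vec_on eqxx !mulr1.
pose w i x := `|dotp (u i) (v x)| ^+ 2.
have wE i x : s i * w i x = d x * w i x.
  have : dotp (A *m u i) (v x) = dotp (u i) (A *m v x) by rewrite dotp_mulr hA.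
  by rewrite Au Avx dotpZl dotpZr sreal /w normCK !mulrA => ->.
have wx x : \sum_i w i x = 1.
  transitivity (dotp (v x) (1%:M *m v x)); last by rewrite mul1mx ov eqxx.
  rewrite -(spectral_vec_complete A) mulmx_suml dotp_sumr; apply: eq_bigr => i _.
  by rewrite outer_mul dotpZr (dotp_conj (v x)) -normCK.
(* The family [v] may be incomplete, but an eigenvector [u i] with [s i != 0] lies in the range of
   [A], hence in the span of [v]. The remaining [i] contribute [g 0 = 0]. *)
have wi i : s i != 0 -> \sum_x w i x = 1.
  move=> si; apply: (mulfI si); rewrite mulr1 mulr_sumr.
  transitivity (dotp (u i) (A *m u i)); last first.
    by rewrite Au dotpZr spectral_vec_on eqxx mulr1.
  rewrite Av sum_outer_mul dotp_sumr; apply: eq_bigr => x _.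
  by rewrite wE dotpZr (dotp_conj (v x)) -mulrA -normCKC.
have gw i x : g (s i) * w i x = g (d x) * w i x.
  case: (eqVneq (w i x) 0) => [->|w0]; first by rewrite !mulr0.
  by rewrite (mulIf w0 (wE i x)).
transitivity (\sum_i \sum_x g (s i) * w i x).
  apply: eq_bigr => i _; rewrite -mulr_sumr.
  rewrite -/(s i); case: (eqVneq (s i) 0) => [->|/wi ->]; last by rewrite mulr1.
  by rewrite g0 mul0r.
rewrite exchange_big; apply: eq_bigr => x _.
under eq_bigr do rewrite gw.
by rewrite -mulr_sumr wx mulr1.
Qed.

End Spectral.

Section Sqrt.
Variable R : realType.
Local Notation C := R[i].

Lemma spectral_diag_ge0 n (A : 'M[C]_n) i : psd A -> 0 <= spectral_diag A 0 i.
Proof.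
move=> pA; have /psdE /(_ (spectral_vec A i)) := pA.
rewrite {2}(spectral_dec (psd_herm pA)) sum_outer_eigen; last exact: spectral_vec_on.
by rewrite dotpZr spectral_vec_on eqxx mulr1.
Qed.

Lemma sqrtmxE n (A : 'M[C]_n) : sqrtmx A =
  \sum_i sqrtC (spectral_diag A 0 i) *: (spectral_vec A i *m (spectral_vec A i)^t*).
Proof.
rewrite /sqrtmx (invmx_unitary (spectral_unitarymx _)) mul_diag_outer.
by apply: eq_bigr => i _; rewrite mxE.
Qed.

Lemma sqrtmx_psd n (A : 'M[C]_n) : psd A -> psd (sqrtmx A).
Proof.
move=> pA; rewrite sqrtmxE; apply: psd_sum => i _; apply: psdZ; last exact: psd_outer.
by rewrite sqrtC_ge0 spectral_diag_ge0.
Qed.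

Lemma sqrtmx_sqr n (A : 'M[C]_n) : psd A -> sqrtmx A *m sqrtmx A = A.
Proof.
move=> pA; rewrite sqrtmxE sum_outerM; last exact: spectral_vec_on.
rewrite [RHS](spectral_dec (psd_herm pA)); apply: eq_bigr => i _.
by rewrite -expr2 sqrtCK.
Qed.

(** If [B^2 u = r^2 u] with [r >= 0], then [y = B u - r u] satisfies [B y = - r y], and positivity
    of [B] forces [y = 0]. So [B] and [sqrtmx A] agree on an eigenbasis of [A]. The case [r = 0] is
    separate: there [y = B u] and [|y|^2 = <u, B y> = 0]. *)
Lemma sqrtmx_unique n (A B : 'M[C]_n) : psd B -> B *m B = A -> sqrtmx A = B.
Proof.
move=> pB BA; have hB := psd_herm pB.
have pA : psd A by have := psd_conj B (@psd1 R n); rewrite mulmx1 hB BA.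
pose u := spectral_vec A; pose s := spectral_diag A 0; pose r i := sqrtC (s i).
have Bu i : B *m u i = r i *: u i.
  have Au : A *m u i = (r i * r i) *: u i.
    rewrite {1}(spectral_dec (psd_herm pA)) sum_outer_eigen; last exact: spectral_vec_on.
    by rewrite -expr2 sqrtCK.
  have r0 : 0 <= r i by rewrite sqrtC_ge0 spectral_diag_ge0.
  apply/eqP; rewrite -subr_eq0; apply/eqP; set y := _ - _.
  have h : B *m y + r i *: y = 0.
    rewrite /y mulmxBr mulmxA BA Au scalerBr -scalemxAr scalerA addrA.
    by rewrite subrK subrr.
  move: r0; rewrite le_eqVlt => /orP[/eqP ri0|ri0].
    apply: dotpp_eq0; rewrite {2}/y -ri0 scale0r subr0 dotp_mulr hB.
    by move: h; rewrite -ri0 scale0r addr0 => ->; rewrite dotp_conj dotp0r rmorph0.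
  apply: dotpp_eq0; have := congr1 (dotp y) h.
  rewrite dotpDr dotpZr => /eqP.
  rewrite dotp0r paddr_eq0 ?mulr_ge0 ?dotpp_ge0 ?(ltW ri0) //; last by move/psdE: pB.
  by case/andP=> _; rewrite mulf_eq0 (gt_eqF ri0) => /eqP.
rewrite sqrtmxE -[RHS]mulmx1 -(spectral_vec_complete A) mulmx_sumr.
by apply: eq_bigr => i _; rewrite mulmxA Bu -scalemxAl.
Qed.

Lemma trace_norm_unique n (X B : 'M[C]_n) :
  psd B -> B *m B = X^t* *m X -> trace_norm X = complex.Re (\tr B).
Proof. by move=> pB h; rewrite /trace_norm (sqrtmx_unique pB h). Qed.

End Sqrt.

Opaque sqrtmx.

(** * Matrices indexed by finite types, and tensor products *)

Section Entries.
Variable R : realType.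
Local Notation C := R[i].

Lemma entry_mkhom (S T : finType) (f : T -> S -> C) t s : entry (mkhom f) t s = f t s.
Proof. by rewrite /entry mxE !enum_rankK. Qed.

Lemma entryP (S T : finType) (A B : LinMx R S T) :
  (forall t s, entry A t s = entry B t s) -> A = B.
Proof.
move=> h; apply/matrixP=> i j.
by have := h (enum_val i) (enum_val j); rewrite /entry !enum_valK.
Qed.

Lemma entry0 (S T : finType) (t : T) (s : S) : entry (0 : LinMx R S T) t s = 0.
Proof. by rewrite /entry mxE. Qed.

Lemma entryZ (S T : finType) a (A : LinMx R S T) t s :
  entry (a *: A) t s = a * entry A t s.
Proof. by rewrite /entry mxE. Qed.

Lemma entry_sum (S T : finType) (I : Type) (r : seq I) (P : pred I) (F : I -> LinMx R S T) t s :
  entry (\sum_(i <- r | P i) F i) t s = \sum_(i <- r | P i) entry (F i) t s.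
Proof. by rewrite /entry summxE. Qed.

Lemma entry1 (S : finType) (t s : S) : entry (1%:M : OpMx R S) t s = (t == s)%:R.
Proof. by rewrite /entry mxE (inj_eq enum_rank_inj). Qed.

Lemma entry_adj (S T : finType) (A : LinMx R S T) t s :
  entry (A^t* : LinMx R T S) s t = Num.conj (entry A t s).
Proof. by rewrite /entry !mxE. Qed.

Lemma sum_ord_rank (S : finType) (V : nmodType) (F : 'I_#|{: S}| -> V) :
  \sum_i F i = \sum_s F (enum_rank s).
Proof. by rewrite (reindex enum_rank) //; exact: onW_bij (enum_rank_bij S). Qed.

Lemma entry_mul (S T U : finType) (A : LinMx R T U) (B : LinMx R S T) u s :
  entry (A *m B) u s = \sum_t entry A u t * entry B t s.
Proof. by rewrite /entry mxE sum_ord_rank. Qed.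

Lemma mxtrace_entry (S : finType) (A : OpMx R S) : \tr A = \sum_s entry A s s.
Proof. by rewrite /mxtrace sum_ord_rank. Qed.

Lemma entry_delta (S T : finType) (t t' : T) (s s' : S) :
  entry (delta_mx (enum_rank t') (enum_rank s') : LinMx R S T) t s = ((t == t') && (s == s'))%:R.
Proof. by rewrite /entry mxE !(inj_eq enum_rank_inj). Qed.

Lemma sum_delta (S T : finType) (A : LinMx R S T) :
  A = \sum_t \sum_s entry A t s *: delta_mx (enum_rank t) (enum_rank s).
Proof.
apply: entryP => t s; rewrite entry_sum (bigD1 t) //= entry_sum (bigD1 s) //=.
rewrite entryZ entry_delta !eqxx mulr1 !big1 ?addr0 // => [i it|i is_].
  rewrite entry_sum big1 // => j _; rewrite entryZ entry_delta eq_sym (negbTE it) mulr0 //.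
by rewrite entryZ entry_delta [s == i]eq_sym (negbTE is_) andbF mulr0.
Qed.

Definition kent (T : finType) (v : KetMx R T) (t : T) : C := v (enum_rank t) 0.

Lemma ketP (T : finType) (u v : KetMx R T) : (forall t, kent u t = kent v t) -> u = v.
Proof.
by move=> h; apply/colP=> i; have := h (enum_val i); rewrite /kent enum_valK.
Qed.

Lemma kent_mul (S T : finType) (A : LinMx R S T) (v : KetMx R S) t :
  kent (A *m v) t = \sum_s entry A t s * kent v s.
Proof. by rewrite /kent mxE sum_ord_rank. Qed.

Lemma dotp_kent (T : finType) (u v : KetMx R T) :
  dotp u v = \sum_t Num.conj (kent u t) * kent v t.
Proof. by rewrite /dotp mxE sum_ord_rank; apply: eq_bigr => t _; rewrite !mxE. Qed.

Lemma entry_outer (S T : finType) (u : KetMx R T) (v : KetMx R S) t s :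
  entry (u *m v^t* : LinMx R S T) t s = kent u t * Num.conj (kent v s).
Proof. by rewrite /entry mxE big_ord1 !mxE. Qed.

Definition mkket (T : finType) (f : T -> C) : KetMx R T := \col_i f (enum_val i).

Lemma kent_mkket (T : finType) (f : T -> C) t : kent (mkket f) t = f t.
Proof. by rewrite /kent mxE enum_rankK. Qed.

End Entries.

Section StdBasis.
Variable R : realType.

Definition std_ket (T : finType) (t : T) : KetMx R T := delta_mx (enum_rank t) 0.

Lemma kent_std (T : finType) (t s : T) : kent (std_ket t) s = (s == t)%:R.
Proof. by rewrite /kent mxE eqxx andbT (inj_eq enum_rank_inj). Qed.

Lemma std_ket_on (T : finType) : orthonormal (@std_ket T).
Proof.
move=> s t; rewrite dotp_kent (bigD1 s) //= !kent_std eqxx conjC_nat mul1r.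
by rewrite big1 ?addr0 // => i /negbTE is_; rewrite kent_std is_ conjC_nat mul0r.
Qed.

Lemma std_ket_complete (T : finType) : \sum_t std_ket t *m (std_ket t)^t* = 1%:M :> OpMx R T.
Proof.
apply: entryP => a b; rewrite entry_sum entry1 (bigD1 a) //= entry_outer !kent_std.
rewrite eqxx mul1r conjC_nat eq_sym big1 ?addr0 // => i /negbTE ia.
by rewrite entry_outer !kent_std eq_sym ia mul0r.
Qed.

End StdBasis.

Section Tens.
Variable R : realType.
Local Notation C := R[i].

Lemma entry_tens (S T S' T' : finType) (A : LinMx R S T) (B : LinMx R S' T') x y :
  entry (tens A B) x y = entry A x.1 y.1 * entry B x.2 y.2.
Proof. by rewrite entry_mkhom. Qed.

Lemma sum_pair (S T : finType) (V : nmodType) (F : S * T -> V) :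
  \sum_x F x = \sum_s \sum_t F (s, t).
Proof. by rewrite pair_bigA; apply: eq_bigr => -[]. Qed.

Lemma tensM (S T U S' T' U' : finType) (A : LinMx R T U) (B : LinMx R S T)
    (A' : LinMx R T' U') (B' : LinMx R S' T') :
  tens A A' *m tens B B' = tens (A *m B) (A' *m B').
Proof.
apply: entryP => x y; rewrite entry_tens !entry_mul sum_pair big_distrl /=.
apply: eq_bigr => t _; rewrite big_distrr /=; apply: eq_bigr => t' _.
by rewrite !entry_tens /= mulrACA.
Qed.

Lemma tens_adj (S T S' T' : finType) (A : LinMx R S T) (B : LinMx R S' T') :
  (tens A B)^t* = tens (A^t* : LinMx R T S) (B^t* : LinMx R T' S').
Proof. by apply: entryP => x y; rewrite entry_adj !entry_tens rmorphM !entry_adj. Qed.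

Lemma tens11 (S T : finType) : tens (1%:M : OpMx R S) (1%:M : OpMx R T) = 1%:M.
Proof.
by apply: entryP => -[a b] [c d]; rewrite entry_tens !entry1 -natrM mulnb.
Qed.

Lemma tens_suml (S T S' T' : finType) (I : Type) (r : seq I) (P : pred I)
    (F : I -> LinMx R S T) (B : LinMx R S' T') :
  tens (\sum_(i <- r | P i) F i) B = \sum_(i <- r | P i) tens (F i) B.
Proof.
apply: entryP => x y; rewrite entry_tens !entry_sum big_distrl /=.
by apply: eq_bigr => i _; rewrite entry_tens.
Qed.

Lemma tensZl (S T S' T' : finType) a (A : LinMx R S T) (B : LinMx R S' T') :
  tens (a *: A) B = a *: tens A B.
Proof. by apply: entryP => x y; rewrite entryZ !entry_tens entryZ mulrA. Qed.

Lemma kent_tens_ket (S T : finType) (u : KetMx R S) (v : KetMx R T) x :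
  kent (tens_ket u v) x = kent u x.1 * kent v x.2.
Proof. by rewrite /kent mxE enum_rankK. Qed.

Lemma tens_outer (S T S' T' : finType) (u : KetMx R T) (v : KetMx R S)
    (u' : KetMx R T') (v' : KetMx R S') :
  tens (u *m v^t* : LinMx R S T) (u' *m v'^t* : LinMx R S' T') =
  tens_ket u u' *m (tens_ket v v')^t*.
Proof.
apply: entryP => x y; rewrite entry_tens !entry_outer !kent_tens_ket rmorphM.
by rewrite mulrACA.
Qed.

Lemma tens_mul_ket (S T S' T' : finType) (A : LinMx R S T) (B : LinMx R S' T') u v :
  tens A B *m tens_ket u v = tens_ket (A *m u) (B *m v).
Proof.
apply: ketP => x; rewrite kent_mul kent_tens_ket !kent_mul sum_pair big_distrl /=.
apply: eq_bigr => t _; rewrite big_distrr /=; apply: eq_bigr => t' _.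
by rewrite entry_tens kent_tens_ket /= mulrACA.
Qed.

End Tens.

(** * Kraus operators *)

Section Kraus.
Variable R : realType.
Local Notation C := R[i].

Definition kraus (I : finType) m n (K : I -> 'M[C]_(m, n)) (X : 'M[C]_n) : 'M[C]_m :=
  \sum_i K i *m X *m (K i)^t*.

Definition kraus_tp (I : finType) m n (K : I -> 'M[C]_(m, n)) :=
  \sum_i (K i)^t* *m K i = 1%:M.

Lemma kraus_linear (I : finType) m n (K : I -> 'M[C]_(m, n)) : linear (kraus K).
Proof.
move=> a X Y; rewrite /kraus scaler_sumr -big_split; apply: eq_bigr => i _ /=.
by rewrite mulmxDr mulmxDl -scalemxAr -scalemxAl.
Qed.

HB.instance Definition _ (I : finType) m n (K : I -> 'M[C]_(m, n)) :=
  GRing.isLinear.Build C 'M[C]_n 'M[C]_m *:%R (kraus K) (@kraus_linear I m n K).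

Lemma kraus_psd (I : finType) m n (K : I -> 'M[C]_(m, n)) X : psd X -> psd (kraus K X).
Proof. by move=> pX; apply: psd_sum => i _; exact: psd_conj. Qed.

Lemma kraus_trace (I : finType) m n (K : I -> 'M[C]_(m, n)) X :
  \tr (kraus K X) = \tr ((\sum_i (K i)^t* *m K i) *m X).
Proof.
rewrite mulmx_suml !raddf_sum; apply: eq_bigr => i _ /=.
by rewrite mxtrace_mulC mulmxA.
Qed.

Lemma kraus_comp (I J : finType) m n p (K : I -> 'M[C]_(m, n)) (L : J -> 'M[C]_(n, p)) X :
  kraus K (kraus L X) = kraus (fun ij => K ij.1 *m L ij.2) X.
Proof.
rewrite /kraus sum_pair; apply: eq_bigr => i _ /=.
rewrite mulmx_sumr mulmx_suml; apply: eq_bigr => j _.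
by rewrite adjM !mulmxA.
Qed.

Lemma kraus_tp_comp (I J : finType) m n p (K : I -> 'M[C]_(m, n)) (L : J -> 'M[C]_(n, p)) :
  kraus_tp K -> kraus_tp L -> kraus_tp (fun ij => K ij.1 *m L ij.2).
Proof.
rewrite /kraus_tp => hK hL; rewrite sum_pair exchange_big /= -hL.
apply: eq_bigr => j _; rewrite -[X in _ = _ *m X]mul1mx -hK mulmx_suml mulmx_sumr.
by apply: eq_bigr => i _; rewrite adjM !mulmxA.
Qed.

Lemma entry_tens1_mul (S T E : finType) (Y : finType) (A : LinMx R S T) (X : LinMx R Y (S * E)) t e y :
  entry (tens A (1%:M : OpMx R E) *m X) (t, e) y = \sum_s entry A t s * entry X (s, e) y.
Proof.
rewrite entry_mul sum_pair; apply: eq_bigr => s _.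
rewrite (bigD1 e) //= entry_tens entry1 eqxx mulr1 big1 ?addr0 // => f fe.
by rewrite entry_tens entry1 /= eq_sym (negbTE fe) mulr0 mul0r.
Qed.

Lemma entry_mul_tens1 (S T E : finType) (Y : finType) (A : LinMx R S T) (X : LinMx R (S * E) Y) t e y :
  entry (X *m (tens A (1%:M : OpMx R E))^t*) y (t, e) =
  \sum_s entry X y (s, e) * Num.conj (entry A t s).
Proof.
have -> : X *m (tens A (1%:M : OpMx R E))^t* =
  (tens A (1%:M : OpMx R E) *m (X^t* : LinMx R Y (S * E)))^t*.
  by rewrite adjM trmxCK.
rewrite entry_adj entry_tens1_mul rmorph_sum; apply: eq_bigr => s _.
by rewrite rmorphM /= entry_adj conjCK mulrC.
Qed.

Lemma ext_id_kraus (S T E I : finType) (Phi : OpMx R S -> OpMx R T) (K : I -> LinMx R S T)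
    (X : OpMx R (S * E)) :
  Phi =1 kraus K -> ext_id Phi X = kraus (fun i => tens (K i) (1%:M : OpMx R E)) X.
Proof.
move=> PK; apply: entryP => -[t e] [t' e'].
rewrite entry_mkhom PK !entry_sum /=; apply: eq_bigr => i _.
rewrite entry_mul_tens1 entry_mul; apply: eq_bigr => s' _.
rewrite entry_tens1_mul entry_mul entry_adj; congr (_ * _).
by apply: eq_bigr => s _; rewrite entry_mkhom.
Qed.

Lemma kraus_is_channel (S T I : finType) (Phi : {linear OpMx R S -> OpMx R T})
    (K : I -> LinMx R S T) :
  Phi =1 kraus K -> kraus_tp K -> is_channel Phi.
Proof.
move=> PK tK; split=> [E X pX|X].
  by rewrite (ext_id_kraus _ PK); exact: kraus_psd.
by rewrite PK kraus_trace tK mul1mx.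
Qed.

Lemma mxtrace_delta_mul (S : finType) (A : OpMx R S) s t :
  \tr (A *m delta_mx (enum_rank s) (enum_rank t)) = entry A t s.
Proof.
rewrite mxtrace_entry (bigD1 t) //= entry_mul (bigD1 s) //= entry_delta !eqxx mulr1.
rewrite !big1 ?addr0 // => [u ut|u us].
  by rewrite entry_mul big1 // => v _; rewrite entry_delta (negbTE ut) andbF mulr0.
by rewrite entry_delta (negbTE us) mulr0.
Qed.

(* Choi: the Kraus operators are the eigenvectors of the image of the
   unnormalized maximally entangled projector. *)
Lemma channel_kraus (S T : finType) (Phi : {linear OpMx R S -> OpMx R T}) :
  is_channel Phi ->
  exists (I : finType) (K : I -> LinMx R S T), Phi =1 kraus K /\ kraus_tp K.
Proof.
move=> [cp tp]; pose om : KetMx R (S * S) := mkket (fun x => (x.1 == x.2)%:R).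
pose J := ext_id Phi (om *m om^t*).
have pJ : psd J by apply/cp/psd_outer.
pose u := spectral_vec J; pose d i := sqrtC (spectral_diag J 0 i).
pose K i : LinMx R S T := mkhom (fun t s => d i * kent (u i) (t, s)).
have JE t t' s s' : entry J (t, s) (t', s') =
    entry (Phi (delta_mx (enum_rank s) (enum_rank s'))) t t'.
  rewrite entry_mkhom /=; congr (entry (Phi _) _ _); apply: entryP => a b.
  by rewrite entry_mkhom entry_outer !kent_mkket entry_delta /= conjC_nat -natrM mulnb.
have PK : Phi =1 kraus K.
  move=> X; apply: entryP => t t'; rewrite {1}(sum_delta X) raddf_sum !entry_sum.
  transitivity (\sum_s \sum_s' \sum_i entry (K i) t s * entry X s s' * Num.conj (entry (K i) t' s')).
    apply: eq_bigr => s _; rewrite raddf_sum entry_sum; apply: eq_bigr => s' _ /=.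
    rewrite linearZ entryZ -JE (spectral_dec (psd_herm pJ)) entry_sum mulr_sumr.
    apply: eq_bigr => i _; rewrite entryZ entry_outer !entry_mkhom rmorphM /=.
    have -> : Num.conj (d i) = d i.
      by apply/CrealP/ger0_real; rewrite sqrtC_ge0 spectral_diag_ge0.
    rewrite -[spectral_diag J 0 i]sqrtCK -/(d i) -/(u i) expr2; ring.
  rewrite exchange_big /=.
  under eq_bigr do rewrite exchange_big /=.
  rewrite exchange_big /=; apply: eq_bigr => i _.
  rewrite entry_mul; apply: eq_bigr => s' _.
  by rewrite entry_mul mulr_suml entry_adj.
exists 'I_#|{: T * S}|, K; split=> //; apply: entryP => s t.
(* Trace preservation, tested on the matrix units, reads off every entry of the sum of the
   [K^t* *m K]. *)
by rewrite -mxtrace_delta_mul -kraus_trace -PK tp -[delta_mx _ _]mul1mx mxtrace_delta_mul.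
Qed.

End Kraus.

(** * Tensor powers of operators and channels *)

Section Powers.
Variable R : realType.
Local Notation C := R[i].
Variable n : nat.

Definition bigtens (S T : finType) (A : 'I_n -> LinMx R S T) :
    LinMx R {ffun 'I_n -> S} {ffun 'I_n -> T} :=
  mkhom (fun (b : {ffun 'I_n -> T}) (a : {ffun 'I_n -> S}) => \prod_i entry (A i) (b i) (a i)).

Lemma bigtensM (S T U : finType) (A : 'I_n -> LinMx R T U) (B : 'I_n -> LinMx R S T) :
  bigtens A *m bigtens B = bigtens (fun i => A i *m B i).
Proof.
apply: entryP => x y; rewrite entry_mul entry_mkhom.
under [RHS]eq_bigr do rewrite entry_mul.
rewrite bigA_distr_bigA /=; apply: eq_bigr => f _.
by rewrite !entry_mkhom -big_split.
Qed.

Lemma bigtens_adj (S T : finType) (A : 'I_n -> LinMx R S T) :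
  (bigtens A)^t* = bigtens (fun i => (A i)^t* : LinMx R T S).
Proof.
apply: entryP => x y; rewrite entry_adj !entry_mkhom rmorph_prod.
by apply: eq_bigr => i _; rewrite entry_adj.
Qed.

Lemma bigtens1 (S : finType) : bigtens (fun _ => 1%:M : OpMx R S) = 1%:M.
Proof.
apply: entryP => x y; rewrite entry_mkhom entry1.
case: (eqVneq x y) => [->|xy]; first by rewrite big1 // => i _; rewrite entry1 eqxx.
have [i xyi] : exists i, x i != y i.
  apply/existsP; apply: contraR xy; rewrite negb_exists => /forallP h.
  by apply/eqP/ffunP=> i; apply/eqP; have := h i; rewrite negbK.
by rewrite (bigD1 i) //= entry1 (negbTE xyi) mul0r.
Qed.

Lemma bigtens_sum (S T J : finType) (A : 'I_n -> J -> LinMx R S T) :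
  \sum_(k : {ffun 'I_n -> J}) bigtens (fun i => A i (k i)) =
  bigtens (fun i => \sum_j A i j).
Proof.
apply: entryP => x y; rewrite entry_sum entry_mkhom.
under [RHS]eq_bigr do rewrite entry_sum.
by rewrite bigA_distr_bigA /=; apply: eq_bigr => f _; rewrite entry_mkhom.
Qed.

Lemma bigtensZ (S T : finType) (a : 'I_n -> C) (A : 'I_n -> LinMx R S T) :
  bigtens (fun i => a i *: A i) = (\prod_i a i) *: bigtens A.
Proof.
apply: entryP => x y; rewrite entryZ !entry_mkhom -big_split /=.
by apply: eq_bigr => i _; rewrite entryZ.
Qed.

Definition bigket (T : finType) (v : 'I_n -> KetMx R T) : KetMx R {ffun 'I_n -> T} :=
  mkket (fun x : {ffun 'I_n -> T} => \prod_i kent (v i) (x i)).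

Lemma bigket_outer (S T : finType) (u : 'I_n -> KetMx R T) (v : 'I_n -> KetMx R S) :
  bigket u *m (bigket v)^t* = bigtens (fun i => u i *m (v i)^t* : LinMx R S T).
Proof.
apply: entryP => x y; rewrite entry_outer !kent_mkket entry_mkhom rmorph_prod -big_split.
by apply: eq_bigr => i _; rewrite entry_outer.
Qed.

Lemma bigket_dotp (T : finType) (u v : 'I_n -> KetMx R T) :
  dotp (bigket u) (bigket v) = \prod_i dotp (u i) (v i).
Proof.
rewrite dotp_kent; under [RHS]eq_bigr do rewrite dotp_kent.
rewrite bigA_distr_bigA /=; apply: eq_bigr => f _.
by rewrite !kent_mkket rmorph_prod -big_split.
Qed.

Lemma channel_pow_kraus (S T I : finType) (Phi : OpMx R S -> OpMx R T) (K : I -> LinMx R S T) :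
  Phi =1 kraus K ->
  @channel_pow R S T Phi n =1 kraus (fun k : {ffun 'I_n -> I} => bigtens (fun i => K (k i))).
Proof.
move=> PK X; apply: entryP => b b'; rewrite !entry_sum.
transitivity (\sum_a \sum_a' \sum_(k : {ffun 'I_n -> I})
   entry (bigtens (fun i => K (k i))) b a * entry X a a' *
   Num.conj (entry (bigtens (fun i => K (k i))) b' a')).
  apply: eq_bigr => a _; rewrite entry_sum; apply: eq_bigr => a' _.
  rewrite entryZ entry_mkhom.
  under eq_bigr => i _ do rewrite PK entry_sum.
  rewrite bigA_distr_bigA /= mulr_sumr; apply: eq_bigr => k _.
  rewrite !entry_mkhom rmorph_prod mulrAC mulrC -big_split /=; congr (_ * _).
  apply: eq_bigr => i _; rewrite entry_mul (bigD1 (a' i)) //= big1 ?addr0.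
    rewrite entry_adj entry_mul (bigD1 (a i)) //= big1 ?addr0.
      by rewrite entry_delta !eqxx mulr1.
    by move=> j /negbTE ja; rewrite entry_delta ja mulr0.
  move=> j /negbTE ja; rewrite entry_mul big1 ?mul0r // => l _.
  by rewrite entry_delta ja andbF mulr0.
rewrite exchange_big /=.
under eq_bigr do rewrite exchange_big /=.
rewrite exchange_big /=; apply: eq_bigr => i _.
rewrite entry_mul; apply: eq_bigr => s' _.
by rewrite entry_mul mulr_suml entry_adj.
Qed.

Lemma bigtens_tp (S T I : finType) (K : I -> LinMx R S T) :
  kraus_tp K -> kraus_tp (fun k : {ffun 'I_n -> I} => bigtens (fun i => K (k i))).
Proof.
move=> tK; rewrite /kraus_tp.
under eq_bigr do rewrite bigtens_adj bigtensM.
rewrite (bigtens_sum (fun _ j => (K j)^t* *m K j)).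
by rewrite -[RHS]bigtens1; congr bigtens; apply: funext => i; exact: tK.
Qed.

End Powers.

(** * Fidelity *)

Section Fidelity.
Variable R : realType.
Local Notation C := R[i].

Lemma psd_mulmx_adj m n (A : 'M[C]_(m, n)) : psd (A *m A^t*).
Proof. by have := psd_conj A (@psd1 R n); rewrite mulmx1. Qed.

Lemma sqrtmx_herm n (A : 'M[C]_n) : psd A -> (sqrtmx A)^t* = sqrtmx A.
Proof. by move=> pA; apply/psd_herm/sqrtmx_psd. Qed.

Lemma sqrtmxZ n (a : C) (A : 'M[C]_n) : 0 <= a -> psd A ->
  sqrtmx (a *: A) = sqrtC a *: sqrtmx A.
Proof.
move=> a0 pA; apply: sqrtmx_unique.
  by apply: psdZ (sqrtmx_psd pA); rewrite sqrtC_ge0.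
by rewrite -scalemxAl -scalemxAr scalerA sqrtmx_sqr // -expr2 sqrtCK.
Qed.

Lemma psd_adj_mulmx m n (A : 'M[C]_(m, n)) : psd (A^t* *m A).
Proof. by have := psd_mulmx_adj (A^t*); rewrite trmxCK. Qed.

Lemma trace_normZ n (a : R) (X : 'M[C]_n) : 0 <= a ->
  trace_norm (a%:C *: X) = a * trace_norm X.
Proof.
move=> a0; rewrite /trace_norm adjZ -scalemxAl -scalemxAr scalerA conj_real.
have a0C : 0 <= a%:C by rewrite ler0c.
rewrite sqrtmxZ ?mulr_ge0 //; last exact: psd_adj_mulmx.
by rewrite -expr2 sqrCK // mxtraceZ ReZ.
Qed.

(** The absolute value of [u v^*] is [v v^* / |v|]; for [v = 0] the convention [0^-1 = 0] yields the
    zero operator, as it should. *)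
Lemma trace_norm_outer n (u v : 'cV[C]_n) : dotp u u = 1 ->
  trace_norm (u *m v^t*) = Num.sqrt (complex.Re (dotp v v)).
Proof.
move=> u1; set r := sqrtC (dotp v v).
have r0 : 0 <= r by rewrite sqrtC_ge0 dotpp_ge0.
have rr : r * r = dotp v v by rewrite -expr2 sqrtCK.
have hv : (u *m v^t*)^t* *m (u *m v^t*) = v *m v^t*.
  by rewrite adjM trmxCK mulmxA outer_mul u1 scale1r.
rewrite (@trace_norm_unique _ _ _ (r^-1 *: (v *m v^t*))).
- rewrite mxtraceZ mxtrace_outer -rr.
  have -> : r^-1 * (r * r) = r.
    by case: (eqVneq r 0) => [->|nz]; rewrite ?mulr0 // mulKf.
  by rewrite rr /r -{1}(ge0_RRe (dotpp_ge0 v)) sqrtC_complex ?Re_ge0 ?dotpp_ge0.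
- by apply: psdZ; rewrite ?invr_ge0 //; exact: psd_outer.
- rewrite hv -scalemxAl -scalemxAr scalerA mulmxA outer_mul -scalemxAl scalerA.
  rewrite -rr; case: (eqVneq r 0) => [r00|nz].
    have -> : v = 0 by apply: dotpp_eq0; rewrite -rr r00 mulr0.
    by rewrite mul0mx scaler0.
  by rewrite -invfM mulVf ?mulf_neq0 // scale1r.
Qed.

Lemma sqrtmx_ket_proj n (u : 'cV[C]_n) : dotp u u = 1 -> sqrtmx (ket_proj u) = ket_proj u.
Proof.
move=> u1; apply: sqrtmx_unique; first exact: psd_outer.
by rewrite /ket_proj mulmxA outer_mul u1 scale1r.
Qed.

(** The projector is its own square root, and its product with [s = sqrtmx X] has rank one, namely
    [u (s u)^*]. *)
Lemma fidelity_pure n (u : 'cV[C]_n) (X : 'M[C]_n) : dotp u u = 1 -> psd X ->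
  fidelity (ket_proj u) X = Num.sqrt (complex.Re (dotp u (X *m u))).
Proof.
move=> u1 pX; rewrite /fidelity (sqrtmx_ket_proj u1) /ket_proj -mulmxA.
have := sqrtmx_sqr pX; have := sqrtmx_herm pX.
move: (sqrtmx X) => s hs <-.
rewrite -[X in u^t* *m X]hs -adjM (trace_norm_outer _ u1).
by rewrite -{1}hs -dotp_mulr mulmxA.
Qed.

Lemma fidelityZ n (a : R) (X Y : 'M[C]_n) : 0 <= a -> psd X -> psd Y ->
  fidelity (a%:C *: X) (a%:C *: Y) = a * fidelity X Y.
Proof.
move=> a0 pX pY; have a0C : 0 <= a%:C by rewrite ler0c.
rewrite /fidelity !sqrtmxZ // -scalemxAl -scalemxAr scalerA -expr2 sqrtCK.
by rewrite trace_normZ.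
Qed.

Lemma mxtrace_tens1_mul (S E : finType) (K : OpMx R S) (X : OpMx R (S * E)) :
  \tr (tens K (1%:M : OpMx R E) *m X) = \tr (K *m ptrace2 X).
Proof.
rewrite !mxtrace_entry sum_pair; apply: eq_bigr => s _.
rewrite entry_mul; under eq_bigr do rewrite entry_tens1_mul.
rewrite exchange_big /=; apply: eq_bigr => t _.
by rewrite entry_mkhom mulr_sumr.
Qed.

Lemma mxtrace_ptrace2 (S E : finType) (X : OpMx R (S * E)) : \tr (ptrace2 X) = \tr X.
Proof. by have := mxtrace_tens1_mul 1%:M X; rewrite tens11 !mul1mx. Qed.

(** The entanglement fidelity formula: the operator [K i] contributes the squared modulus of its
    amplitude at [u], and this amplitude sees only the reduced state. The reference system
    disappears from here on. *)
Lemma fidelity_pure_kraus (S E I : finType) (u : KetMx R (S * E))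
    (Phi : OpMx R S -> OpMx R S) (K : I -> OpMx R S) :
  dotp u u = 1 -> Phi =1 kraus K ->
  fidelity (ket_proj u) (ext_id Phi (ket_proj u)) =
  Num.sqrt (complex.Re (\sum_i `|\tr (K i *m ptrace2 (ket_proj u))| ^+ 2)).
Proof.
move=> u1 PK; rewrite (ext_id_kraus _ PK) fidelity_pure //; last first.
  by apply: kraus_psd; exact: psd_outer.
congr (Num.sqrt (complex.Re _)); rewrite mulmx_suml dotp_sumr.
apply: eq_bigr => i _; rewrite -mxtrace_tens1_mul /ket_proj mulmxA mxtrace_outer.
set w := tens _ _ *m u.
have -> : tens (K i) 1%:M *m u *m u^t* *m (tens (K i) 1%:M)^t* *m u = w *m w^t* *m u.
  by rewrite /w adjM !mulmxA.
by rewrite outer_mul dotpZr (dotp_conj w) -normCKC.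
Qed.

End Fidelity.

(** * Block-diagonal operators and the fidelity of classical states *)

Section Blocks.
Variable R : realType.
Local Notation C := R[i].
Variables (X S E : finType) (f : X -> KetMx R E).

(** Operators block-diagonal along the family [f] of the reference. For orthonormal [f], products,
    adjoints, square roots and traces are computed blockwise, and therefore so is the fidelity. *)
Definition blocks (A : X -> OpMx R S) : OpMx R (S * E) :=
  \sum_x tens (A x) (f x *m (f x)^t* : OpMx R E).

Hypothesis onf : orthonormal f.

Lemma blocksM A B : blocks A *m blocks B = blocks (fun x => A x *m B x).
Proof.
rewrite mulmx_suml; apply: eq_bigr => x _; rewrite mulmx_sumr (bigD1 x) //= big1 ?addr0.
  by rewrite tensM mulmxA outer_mul onf eqxx scale1r.
move=> y yx; rewrite tensM mulmxA outer_mul onf eq_sym (negbTE yx) scale0r mul0mx.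
by apply: entryP => a b; rewrite entry_tens [X in _ * X]entry0 mulr0 entry0.
Qed.

Lemma blocks_adj A : (blocks A)^t* = blocks (fun x => (A x)^t*).
Proof. by rewrite adj_sum; apply: eq_bigr => x _; rewrite tens_adj adjM trmxCK. Qed.

Lemma blocks_psd A : (forall x, psd (A x)) -> psd (blocks A).
Proof.
move=> pA; have -> : blocks A = blocks (fun x => sqrtmx (A x)) *m (blocks (fun x => sqrtmx (A x)))^t*.
  rewrite blocks_adj blocksM; congr blocks; apply: funext => x.
  by rewrite sqrtmx_herm // sqrtmx_sqr.
exact: psd_mulmx_adj.
Qed.

Lemma blocks_sqrtmx A : (forall x, psd (A x)) ->
  sqrtmx (blocks A) = blocks (fun x => sqrtmx (A x)).
Proof.
move=> pA; apply: sqrtmx_unique.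
  by apply: blocks_psd => x; exact: sqrtmx_psd.
by rewrite blocksM; congr blocks; apply: funext => x; rewrite sqrtmx_sqr.
Qed.

Lemma mxtrace_tens (S' T' : finType) (A : OpMx R S') (B : OpMx R T') :
  \tr (tens A B) = \tr A * \tr B.
Proof.
rewrite !mxtrace_entry sum_pair big_distrl; apply: eq_bigr => s _ /=.
by rewrite big_distrr; apply: eq_bigr => t _ /=; rewrite entry_tens.
Qed.

Lemma blocks_trace A : \tr (blocks A) = \sum_x \tr (A x).
Proof.
rewrite raddf_sum; apply: eq_bigr => x _ /=.
by rewrite mxtrace_tens mxtrace_outer onf eqxx mulr1.
Qed.

Lemma blocks_trace_norm A : trace_norm (blocks A) = \sum_x trace_norm (A x).
Proof.
rewrite /trace_norm blocks_adj blocksM blocks_sqrtmx => [|x]; last exact: psd_adj_mulmx.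
by rewrite blocks_trace Re_sum.
Qed.

Lemma blocks_fidelity A B : (forall x, psd (A x)) -> (forall x, psd (B x)) ->
  fidelity (blocks A) (blocks B) = \sum_x fidelity (A x) (B x).
Proof. by move=> pA pB; rewrite /fidelity !blocks_sqrtmx // blocksM blocks_trace_norm. Qed.

End Blocks.

Section ClassicalFidelity.
Variable R : realType.
Local Notation C := R[i].

Lemma kraus_blocks (X S E I : finType) (f : X -> KetMx R E) (K : I -> OpMx R S) A :
  kraus (fun i => tens (K i) (1%:M : OpMx R E)) (blocks f A) =
  blocks f (fun x => kraus K (A x)).
Proof.
rewrite /kraus /blocks.
under [RHS]eq_bigr do rewrite tens_suml.
rewrite exchange_big /=; apply: eq_bigr => i _.
rewrite mulmx_sumr mulmx_suml; apply: eq_bigr => x _.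
by rewrite tens_adj !tensM adj1 mulmx1 mul1mx.
Qed.

Lemma classical_stateE (X S E : finType) (p : X -> R) (e : X -> KetMx R S) (f : X -> KetMx R E) :
  classical_state p e f = blocks f (fun x => (p x)%:C *: ket_proj (e x)).
Proof. by apply: eq_bigr => x _; rewrite tensZl. Qed.

Lemma fidelity_classical_kraus (X S E I : finType) (p : X -> R) (e : X -> KetMx R S)
    (f : X -> KetMx R E) (Phi : OpMx R S -> OpMx R S) (K : I -> OpMx R S) :
  (forall x, 0 <= p x) -> orthonormal e -> orthonormal f -> Phi =1 kraus K ->
  fidelity (classical_state p e f) (ext_id Phi (classical_state p e f)) =
  \sum_x p x * Num.sqrt (complex.Re (dotp (e x) (Phi (ket_proj (e x)) *m e x))).
Proof.
move=> p0 oe onf PK; rewrite (ext_id_kraus _ PK) classical_stateE kraus_blocks.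
have pp x : psd (ket_proj (e x)) by exact: psd_outer.
rewrite (blocks_fidelity onf).
- apply: eq_bigr => x _; rewrite linearZ /= fidelityZ //; last exact: kraus_psd.
  by rewrite fidelity_pure ?oe ?eqxx ?PK //; exact: kraus_psd.
- by move=> x; apply: psdZ; rewrite // ler0c.
- by move=> x; apply: kraus_psd; apply: psdZ; rewrite // ler0c.
Qed.

End ClassicalFidelity.

(** * Tensor powers of states *)

Section StatePow.
Variable R : realType.
Local Notation C := R[i].
Variable m : nat.

Lemma mxtrace_bigtens (S : finType) (A : 'I_m -> OpMx R S) :
  \tr (bigtens A) = \prod_i \tr (A i).
Proof.
rewrite mxtrace_entry; under [RHS]eq_bigr do rewrite mxtrace_entry.
by rewrite bigA_distr_bigA /=; apply: eq_bigr => x _; rewrite entry_mkhom.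
Qed.

Lemma ptrace2_state_pow (S T : finType) (rho : OpMx R (S * T)) :
  ptrace2 (state_pow rho m) = bigtens (fun _ => ptrace2 rho).
Proof.
apply: entryP => x y; rewrite !entry_mkhom.
under [RHS]eq_bigr do rewrite entry_mkhom.
by rewrite bigA_distr_bigA /=; apply: eq_bigr => t _; rewrite entry_mkhom.
Qed.

Definition ket_pow (S T : finType) (u : KetMx R (S * T)) :
    KetMx R ({ffun 'I_m -> S} * {ffun 'I_m -> T}) :=
  mkket (fun x : {ffun 'I_m -> S} * {ffun 'I_m -> T} => \prod_i kent u (x.1 i, x.2 i)).

Lemma state_pow_ket_proj (S T : finType) (u : KetMx R (S * T)) :
  state_pow (ket_proj u) m = ket_proj (ket_pow u).
Proof.
apply: entryP => x y; rewrite entry_outer !kent_mkket entry_mkhom rmorph_prod -big_split.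
by apply: eq_bigr => i _; rewrite entry_outer.
Qed.

Lemma ket_pow_unit (S T : finType) (u : KetMx R (S * T)) :
  dotp u u = 1 -> dotp (ket_pow u) (ket_pow u) = 1.
Proof.
move=> u1; rewrite -mxtrace_outer -/(ket_proj _) -state_pow_ket_proj -mxtrace_ptrace2.
rewrite ptrace2_state_pow mxtrace_bigtens big1 // => i _.
by rewrite mxtrace_ptrace2 mxtrace_outer.
Qed.

Definition prod_distr (X : finType) (p : X -> R) (x : {ffun 'I_m -> X}) : R := \prod_i p (x i).

Lemma state_pow_classical (X S T : finType) (p : X -> R) (e : X -> KetMx R S) (f : X -> KetMx R T) :
  state_pow (classical_state p e f) m =
  classical_state (prod_distr p) (fun x : {ffun 'I_m -> X} => bigket (fun i => e (x i)))
    (fun x => bigket (fun i => f (x i))).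
Proof.
apply: entryP => x y; rewrite entry_mkhom entry_sum.
under eq_bigr do rewrite entry_sum.
rewrite bigA_distr_bigA /=; apply: eq_bigr => z _.
rewrite entryZ entry_tens !entry_outer !kent_mkket /= !rmorph_prod -!big_split /=.
by apply: eq_bigr => i _; rewrite entryZ entry_tens !entry_outer.
Qed.

Lemma bigket_orthonormal (X : finType) (S : finType) (e : X -> KetMx R S) :
  orthonormal e -> orthonormal (fun x : {ffun 'I_m -> X} => bigket (fun i => e (x i))).
Proof.
move=> oe x y; rewrite bigket_dotp.
case: (eqVneq x y) => [->|xy]; first by rewrite big1 // => i _; rewrite oe eqxx.
have [i xyi] : exists i, x i != y i.
  apply/existsP; apply: contraR xy; rewrite negb_exists => /forallP h.
  by apply/eqP/ffunP=> i; apply/eqP; have := h i; rewrite negbK.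
by rewrite (bigD1 i) //= oe (negbTE xyi) mul0r.
Qed.

Lemma bigket_complete (X : finType) (S : finType) (e : X -> KetMx R S) :
  \sum_x e x *m (e x)^t* = 1%:M ->
  \sum_(x : {ffun 'I_m -> X}) bigket (fun i => e (x i)) *m (bigket (fun i => e (x i)))^t* = 1%:M.
Proof.
move=> ce; under eq_bigr do rewrite bigket_outer.
by rewrite (bigtens_sum (fun _ x => e x *m (e x)^t*)) ce bigtens1.
Qed.

Lemma bigtens_sum_outer (X : finType) (S : finType) (e : X -> KetMx R S) (p : X -> R) :
  bigtens (fun _ : 'I_m => \sum_x (p x)%:C *: (e x *m (e x)^t*) : OpMx R S) =
  \sum_(x : {ffun 'I_m -> X}) (prod_distr p x)%:C *:
    (bigket (fun i => e (x i)) *m (bigket (fun i => e (x i)))^t*).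
Proof.
rewrite -(bigtens_sum (fun _ x => (p x)%:C *: (e x *m (e x)^t*) : OpMx R S)).
by apply: eq_bigr => x _; rewrite bigtensZ bigket_outer rmorph_prod.
Qed.

Lemma prod_distr_is_distr (X : finType) (p : X -> R) : is_distr p -> is_distr (prod_distr p).
Proof.
case=> p0 p1; split=> [x|]; first exact: prodr_ge0.
by rewrite -(bigA_distr_bigA (fun _ : 'I_m => p)) big1 // => i _; exact: p1.
Qed.

End StatePow.

(** * Koashi-Imoto decompositions *)

Section Entropy.
Variable R : realType.
Local Notation C := R[i].

Lemma entropy_sum_outer (X : finType) n (d : X -> R) (v : X -> 'cV[C]_n) :
  orthonormal v ->
  entropy (\sum_x (d x)%:C *: (v x *m (v x)^t*)) = - \sum_x d x * log2 (d x).
Proof.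
move=> ov; pose g (z : C) := (complex.Re z * log2 (complex.Re z))%:C.
set A := \sum_x _.
have hA : A^t* = A by rewrite adj_sum_outer; apply: eq_bigr => x _; rewrite conj_real.
have := spectral_sum (g := g) ov hA (erefl A); rewrite /g mul0r => /(_ erefl).
move/(congr1 (@complex.Re R)); rewrite !Re_sum => h.
by rewrite /entropy h.
Qed.

Lemma isometry_orthonormal (X : eqType) m n (V : 'M[C]_(m, n)) (v : X -> 'cV[C]_n) :
  V^t* *m V = 1%:M -> orthonormal v -> orthonormal (fun x => V *m v x).
Proof. by move=> VV ov x y; rewrite dotp_mulr mulmxA VV mul1mx. Qed.

Lemma conj_sum_outer (X : finType) m n (V : 'M[C]_(m, n)) (d : X -> C) (v : X -> 'cV[C]_n) :
  V *m (\sum_x d x *: (v x *m (v x)^t*)) *m V^t* =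
  \sum_x d x *: ((V *m v x) *m (V *m v x)^t*).
Proof.
rewrite mulmx_sumr mulmx_suml; apply: eq_bigr => x _.
by rewrite -scalemxAr -scalemxAl adjM !mulmxA.
Qed.

(** [V] carries an eigenbasis of [A] to an orthonormal family diagonalizing the image. The
    additional eigenvalues are 0 and contribute nothing, since [0 * log 0 = 0]. *)
Lemma entropy_isometry m n (V : 'M[C]_(m, n)) (A : 'M[C]_n) :
  V^t* *m V = 1%:M -> A^t* = A -> entropy (V *m A *m V^t*) = entropy A.
Proof.
move=> VV hA; pose g (z : C) := (complex.Re z * log2 (complex.Re z))%:C.
set B := V *m A *m V^t*.
have hB : B^t* = B by rewrite /B !adjM trmxCK hA mulmxA.
have BE : B = \sum_i spectral_diag A 0 i *:
    ((V *m spectral_vec A i) *m (V *m spectral_vec A i)^t*).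
  by rewrite -conj_sum_outer -spectral_dec.
have ov := isometry_orthonormal VV (spectral_vec_on A).
have := spectral_sum (g := g) ov hB BE; rewrite /g mul0r => /(_ erefl).
by move/(congr1 (@complex.Re R)); rewrite !Re_sum /entropy => ->.
Qed.

End Entropy.

Section Slices.
Variable R : realType.
Local Notation C := R[i].

(* [(1 (x) <g|) M (1 (x) |g>)] *)
Definition slice (S E : finType) (g : KetMx R E) (M : OpMx R (S * E)) : OpMx R S :=
  mkhom (fun s s' => \sum_r \sum_r' Num.conj (kent g r) * entry M (s, r) (s', r') * kent g r').

Lemma slice_complete (X S E : finType) (f : X -> KetMx R E) (M : OpMx R (S * E)) :
  \sum_x f x *m (f x)^t* = 1%:M -> \sum_x slice (f x) M = ptrace2 M.
Proof.
move=> cf; apply: entryP => s s'; rewrite entry_sum entry_mkhom.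
under eq_bigr do rewrite entry_mkhom.
rewrite exchange_big; apply: eq_bigr => r _ /=; rewrite exchange_big /=.
transitivity (\sum_r' entry M (s, r) (s', r') * (r' == r)%:R).
  apply: eq_bigr => r' _; rewrite -entry1 -cf entry_sum mulr_sumr.
  by apply: eq_bigr => x _; rewrite entry_outer; ring.
rewrite (bigD1 r) //= eqxx mulr1 big1 ?addr0 // => r' /negbTE ->; exact: mulr0.
Qed.

Lemma slice_tens (S E : finType) (g : KetMx R E) (A : OpMx R S) (h : KetMx R E) :
  slice g (tens A (h *m h^t* : OpMx R E)) = (dotp g h * dotp h g) *: A.
Proof.
apply: entryP => s s'; rewrite entryZ entry_mkhom !dotp_kent.
rewrite [X in X * _]mulr_suml mulr_suml; apply: eq_bigr => r _.
rewrite mulr_sumr mulr_suml; apply: eq_bigr => r' _.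
by rewrite entry_tens entry_outer /=; ring.
Qed.

Lemma slice_sum (I : finType) (S E : finType) (g : KetMx R E) (M : I -> OpMx R (S * E)) :
  slice g (\sum_i M i) = \sum_i slice g (M i).
Proof.
apply: entryP => s s'; rewrite entry_sum entry_mkhom.
under [RHS]eq_bigr do rewrite entry_mkhom.
rewrite [RHS]exchange_big; apply: eq_bigr => r _ /=; rewrite [RHS]exchange_big.
by apply: eq_bigr => r' _ /=; rewrite entry_sum mulr_sumr mulr_suml.
Qed.

Lemma slice_blocks (X S E : finType) (f : X -> KetMx R E) (A : X -> OpMx R S) x :
  orthonormal f -> slice (f x) (blocks f A) = A x.
Proof.
move=> onf; rewrite slice_sum (bigD1 x) //= slice_tens onf eqxx mulr1 scale1r.
rewrite big1 ?addr0 // => y yx.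
by rewrite slice_tens onf eq_sym (negbTE yx) mul0r scale0r.
Qed.

Lemma slice_std (S E : finType) (r : E) (M : OpMx R (S * E)) s s' :
  entry (slice (std_ket R r) M) s s' = entry M (s, r) (s', r).
Proof.
rewrite entry_mkhom (bigD1 r) //= (bigD1 r) //= !kent_std eqxx conjC_nat mulr1 mul1r.
rewrite !big1 ?addr0 // => [t /negbTE tr|t /negbTE tr].
  by rewrite big1 // => t' _; rewrite kent_std tr conjC_nat !mul0r.
by rewrite kent_std tr mulr0.
Qed.

Lemma slice_conj (S T E : finType) (g : KetMx R E) (U : LinMx R S T) (M : OpMx R (S * E)) :
  slice g (tens U (1%:M : OpMx R E) *m M *m (tens U (1%:M : OpMx R E))^t*) =
  U *m slice g M *m U^t*.
Proof.
apply: entryP => t t'; rewrite entry_mkhom.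
under eq_bigr => r _ do under eq_bigr => r' _ do rewrite entry_mul_tens1 mulr_sumr mulr_suml.
rewrite entry_mul.
under eq_bigr do rewrite exchange_big /=.
rewrite exchange_big /=; apply: eq_bigr => s' _.
rewrite entry_mul entry_adj.
under eq_bigr => r _ do under eq_bigr => r' _ do rewrite entry_tens1_mul !(mulr_suml, mulr_sumr).
under eq_bigr do rewrite exchange_big /=.
rewrite exchange_big mulr_suml /=; apply: eq_bigr => s _.
rewrite entry_mkhom mulr_sumr mulr_suml; apply: eq_bigr => r _.
rewrite mulr_sumr mulr_suml; apply: eq_bigr => r' _; ring.
Qed.

Lemma ptrace2_conj (S T E : finType) (U : LinMx R S T) (M : OpMx R (S * E)) :
  ptrace2 (tens U (1%:M : OpMx R E) *m M *m (tens U (1%:M : OpMx R E))^t*) =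
  U *m ptrace2 M *m U^t*.
Proof.
have cE := std_ket_complete R E.
rewrite -!(slice_complete _ cE) mulmx_sumr mulmx_suml.
by apply: eq_bigr => r _; rewrite slice_conj.
Qed.

Lemma ptrace2_adj (S E : finType) (M : OpMx R (S * E)) : (ptrace2 M)^t* = ptrace2 (M^t*).
Proof.
apply: entryP => s s'; rewrite entry_adj !entry_mkhom rmorph_sum.
by apply: eq_bigr => r _; rewrite entry_adj.
Qed.

Lemma ptrace2_tens (S E : finType) (A : OpMx R S) (B : OpMx R E) :
  ptrace2 (tens A B) = \tr B *: A.
Proof.
apply: entryP => s s'; rewrite entryZ entry_mkhom mxtrace_entry mulr_suml.
by apply: eq_bigr => r _; rewrite entry_tens mulrC.
Qed.

Lemma ptrace2_sum (I : finType) (S E : finType) (M : I -> OpMx R (S * E)) :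
  ptrace2 (\sum_i M i) = \sum_i ptrace2 (M i).
Proof.
apply: entryP => s s'; rewrite entry_sum entry_mkhom.
under [RHS]eq_bigr do rewrite entry_mkhom.
by rewrite [RHS]exchange_big; apply: eq_bigr => r _ /=; rewrite entry_sum.
Qed.

Lemma ptrace2_blocks (X S E : finType) (f : X -> KetMx R E) (A : X -> OpMx R S) :
  orthonormal f -> ptrace2 (blocks f A) = \sum_x A x.
Proof.
move=> onf; rewrite ptrace2_sum; apply: eq_bigr => x _.
by rewrite ptrace2_tens mxtrace_outer onf eqxx scale1r.
Qed.

End Slices.

Section KIEntropy.
Variable R : realType.
Local Notation C := R[i].

Lemma sum_triple (X Y Z : finType) (V : nmodType) (F : X * Y * Z -> V) :
  \sum_w F w = \sum_x \sum_y \sum_z F (x, y, z).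
Proof. by rewrite sum_pair sum_pair. Qed.

(* A nonzero diagonal entry of a slice of [om c] exhibits [mu c] as a multiple of
   a block of a rank-one operator; hence [mu c] is pure and [N] carries no
   entropy. *)
Lemma KI_entropy (A' Rf Cl N Q X : finType) (rho : OpMx R (A' * Rf))
    (UKI : LinMx R A' (Cl * N * Q)) (p : Cl -> R) (mu : Cl -> OpMx R N)
    (om : Cl -> OpMx R (Q * Rf)) (f : X -> KetMx R Rf) (a : X -> KetMx R A') :
  is_KI rho UKI p mu om -> rho^t* = rho ->
  \sum_x f x *m (f x)^t* = 1%:M ->
  (forall x, slice (f x) rho = a x *m (a x)^t*) ->
  entropy (marginal_CQ (KI_state p mu om)) = entropy (ptrace2 rho).
Proof.
move=> [UU [[p0 _] smu som] KIE _] hrho cf fa.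
pose b x := UKI *m a x.
(* Slicing commutes with [UKI], so each slice of the decomposed state is the rank-one operator of
   [b x]; its entries are compared with those of the direct sum. *)
have sliceE x c k q c' k' q' : kent (b x) (c, k, q) * Num.conj (kent (b x) (c', k', q')) =
    (c == c')%:R * (p c)%:C * entry (mu c) k k' * entry (slice (f x) (om c)) q q'.
  rewrite -entry_outer /b adjM -[UKI *m a x *m _]mulmxA [a x *m _]mulmxA -fa mulmxA -slice_conj KIE.
  rewrite !entry_mkhom mulr_sumr; apply: eq_bigr => r _; rewrite mulr_sumr.
  by apply: eq_bigr => r' _; rewrite entry_mkhom; ring.
have pure c : exists n : KetMx R N, dotp n n = 1 /\ (p c != 0 -> mu c = n *m n^t*).
  (* Where [p c = 0] any unit vector serves; one exists because [mu c] has trace 1, so [N] is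
     inhabited. *)
  case: (eqVneq (p c) 0) => [pc|pc].
    have [k _|N0] := pickP (fun _ : N => true).
      exists (delta_mx (enum_rank k) 0); split=> //.
      by have := dotp_delta (1%:M : OpMx R N) (enum_rank k) (enum_rank k); rewrite mul1mx mxE eqxx.
    have [_ ] := smu c; rewrite mxtrace_entry big1 => [|k _]; last by have := N0 k.
    by move/eqP; rewrite eq_sym oner_eq0.
  have [x [q tq]] : exists x q, entry (slice (f x) (om c)) q q != 0.
    apply/not_existsP => h; have [_] := som c.
    rewrite -mxtrace_ptrace2 -(slice_complete _ cf) raddf_sum big1 => [|x _].
      by move/eqP; rewrite eq_sym oner_eq0.
    rewrite /= mxtrace_entry big1 // => q _; apply/eqP/negPn/negP => tq.
    by apply: (h x); exists q.
  set t := entry _ q q in tq; pose r := (p c)%:C * t.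
  have rE k k' : kent (b x) (c, k, q) * Num.conj (kent (b x) (c, k', q)) = r * entry (mu c) k k'.
    by rewrite sliceE eqxx mul1r /r -/t; ring.
  have rnz : r != 0 by rewrite mulf_neq0 // -[0]/(0%:C) (inj_eq (@complexI R)).
  have r0 : 0 <= r.
    have -> : r = \sum_k r * entry (mu c) k k.
      by rewrite -mulr_sumr -mxtrace_entry; case: (smu c) => _ ->; rewrite mulr1.
    by apply: sumr_ge0 => k _; rewrite -rE -normCK exprn_ge0.
  pose n : KetMx R N := mkket (fun k => (sqrtC r)^-1 * kent (b x) (c, k, q)).
  have nE : mu c = n *m n^t*.
    apply: entryP => k k'; rewrite entry_outer !kent_mkket rmorphM fmorphV /=.
    have -> : Num.conj (sqrtC r) = sqrtC r by apply/CrealP/ger0_real; rewrite sqrtC_ge0.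
    apply: (mulfI rnz); rewrite -rE -{1}[r]sqrtCK.
    by field; rewrite sqrtC_eq0.
  by exists n; split=> //; rewrite -mxtrace_outer -nE; case: (smu c).
have [n nP] := choice pure.
(* [V] appends the pure state [n c], controlled by [c]. It is an isometry from [CQ] to [CNQ] taking
   the [CQ] marginal to the whole state, so the two have the same entropy. *)
pose V : LinMx R (Cl * Q) (Cl * N * Q) := mkhom (fun x y =>
  (x.1.1 == y.1)%:R * kent (n x.1.1) x.1.2 * (x.2 == y.2)%:R).
have Vent (Y : finType) (M : LinMx R Y (Cl * Q)) c k q y :
    entry (V *m M) (c, k, q) y = kent (n c) k * entry M (c, q) y.
  rewrite entry_mul sum_pair (bigD1 c) //= (bigD1 q) //= entry_mkhom /= !eqxx mul1r mulr1.
  rewrite !big1 ?addr0 // => [d /negbTE dc|d /negbTE dc].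
    by rewrite big1 // => l _; rewrite entry_mkhom /= eq_sym dc !mul0r.
  by rewrite entry_mkhom /= [q == d]eq_sym dc mulr0 mul0r.
have Ve c k q y : entry V (c, k, q) y = kent (n c) k * ((c, q) == y)%:R.
  by rewrite -[V]mulmx1 Vent entry1.
have VV : V^t* *m V = 1%:M.
  apply: entryP => -[c q] y; rewrite entry_mul sum_triple entry1.
  transitivity (\sum_c' \sum_q' ((c', q') == (c, q))%:R * ((c, q) == y)%:R : C).
    apply: eq_bigr => c' _; rewrite exchange_big; apply: eq_bigr => q' _ /=.
    under eq_bigr do rewrite entry_adj !Ve.
    case: eqP => [[-> ->]|_]; last first.
      by rewrite mul0r big1 // => k _; rewrite mulr0 rmorph0 mul0r.
    under eq_bigr do rewrite mulr1.
    rewrite mul1r -[RHS]mul1r -[X in _ = X * _](nP c).1 dotp_kent mulr_suml.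
    by apply: eq_bigr => k _; rewrite mulrA.
  rewrite -(sum_pair (fun x => (x == (c, q))%:R * ((c, q) == y)%:R)).
  rewrite (bigD1 (c, q)) //= eqxx mul1r big1 ?addr0 // => x /negbTE ->; exact: mul0r.
have h2 : V *m marginal_CQ (KI_state p mu om) *m V^t* = UKI *m ptrace2 rho *m UKI^t*.
  have Vent' (Y : finType) (M : LinMx R (Cl * Q) Y) c k q y :
      entry (M *m V^t*) y (c, k, q) = entry M y (c, q) * Num.conj (kent (n c) k).
    have -> : M *m V^t* = (V *m (M^t* : LinMx R Y (Cl * Q)))^t* by rewrite adjM trmxCK.
    by rewrite entry_adj Vent rmorphM /= entry_adj conjCK mulrC.
  rewrite -ptrace2_conj KIE; apply: entryP => -[[c k] q] [[c' k'] q'].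
  rewrite Vent' Vent !entry_mkhom /=.
  case: (eqVneq c c') => [<-|cc]; last first.
    under eq_bigr do under eq_bigr do rewrite entry_mkhom (negbTE cc) !mul0r.
    rewrite !big1 ?mulr0 ?mul0r // => r _; by rewrite entry_mkhom (negbTE cc) !mul0r.
  under [RHS]eq_bigr do rewrite entry_mkhom eqxx mul1r.
  under eq_bigr do under eq_bigr do rewrite entry_mkhom eqxx mul1r.
  case: (eqVneq (p c) 0) => [->|/(nP c).2 muE].
    rewrite !big1 ?mulr0 ?mul0r // => k0 _; first by rewrite !mul0r.
    by rewrite big1 // => r _; rewrite !mul0r.
  rewrite -!mulr_sumr.
  have -> : \sum_i \sum_i0 (p c)%:C * entry (mu c) i i * entry (om c) (q, i0) (q', i0)
     = (p c)%:C * \sum_i0 entry (om c) (q, i0) (q', i0).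
    rewrite -[X in _ = X * _]mulr1 -[X in _ = _ * X * _](smu c).2 mxtrace_entry.
    rewrite [X in _ = X * _]mulr_sumr mulr_suml; apply: eq_bigr => i _.
    by rewrite mulr_sumr.
  by rewrite muE entry_outer; ring.
have hr : (ptrace2 rho)^t* = ptrace2 rho by rewrite ptrace2_adj hrho.
have hm : (marginal_CQ (KI_state p mu om))^t* = marginal_CQ (KI_state p mu om).
  have -> : marginal_CQ (KI_state p mu om) = V^t* *m (UKI *m ptrace2 rho *m UKI^t*) *m V.
    by rewrite -h2 !mulmxA VV mul1mx -mulmxA VV mulmx1.
  by rewrite !adjM !trmxCK hr !mulmxA.
by rewrite -(entropy_isometry VV hm) h2 entropy_isometry.
Qed.

(** The decomposition behind [xget] is unknown, but all of them give this entropy by [KI_entropy].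
    The one in the hypothesis only rules out the default value. *)
Lemma entropy_CQ_pure_slices (A' Rf Cl N Q X : finType) (rho : OpMx R (A' * Rf))
    (UKI : LinMx R A' (Cl * N * Q)) (p : Cl -> R) (mu : Cl -> OpMx R N)
    (om : Cl -> OpMx R (Q * Rf)) (f : X -> KetMx R Rf) (a : X -> KetMx R A') :
  is_KI rho UKI p mu om -> rho^t* = rho ->
  \sum_x f x *m (f x)^t* = 1%:M ->
  (forall x, slice (f x) rho = a x *m (a x)^t*) ->
  entropy_CQ rho = entropy (ptrace2 rho).
Proof.
move=> KI hrho cf fa; rewrite /entropy_CQ; case: xgetP => [s _|noKI].
  move=> [Cl' [N' [Q' [U' [p' [mu' [om' [KI' ->]]]]]]]].
  exact: KI_entropy KI' hrho cf fa.
by case: (noKI (entropy (marginal_CQ (KI_state p mu om)))); do 7?eexists; split; first exact: KI.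
Qed.

End KIEntropy.

(** * Explicit decompositions of pure and of classical states *)

Section Stinespring.
Variable R : realType.
Local Notation C := R[i].

Definition env_kraus (S T E : finType) (U : LinMx R S (T * E)) (e : E) : LinMx R S T :=
  mkhom (fun t s => entry U (t, e) s).

Lemma ptrace2_stinespring (S T E : finType) (U : LinMx R S (T * E)) X :
  ptrace2 (U *m X *m U^t*) = kraus (env_kraus U) X.
Proof.
apply: entryP => t t'; rewrite entry_mkhom entry_sum; apply: eq_bigr => e _.
rewrite !entry_mul; apply: eq_bigr => s _; rewrite !entry_adj entry_mkhom.
by congr (_ * _); rewrite !entry_mul; apply: eq_bigr => s' _; rewrite entry_mkhom.
Qed.

(** Pure states are extreme: compression to the orthogonal complement of [a] turns the left-hand
    side into a vanishing sum of positive operators, so no [v i] has a component there. *)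
Lemma sum_outer_eq_outer (I : finType) n (v : I -> 'cV[C]_n) (a : 'cV[C]_n) :
  dotp a a = 1 -> \sum_i v i *m (v i)^t* = a *m a^t* ->
  (forall i, v i = dotp a (v i) *: a) /\ \sum_i `|dotp a (v i)| ^+ 2 = 1.
Proof.
move=> a1 h; split=> [i|].
  pose P : 'M[C]_n := 1%:M - a *m a^t*.
  have Pa : P *m a = 0 by rewrite mulmxBl mul1mx outer_mul a1 scale1r subrr.
  have : \sum_i (P *m v i) *m (P *m v i)^t* = 0.
    under eq_bigr => j _ do rewrite adjM mulmxA -[P *m v j *m _]mulmxA.
    by rewrite -mulmx_suml -mulmx_sumr h mulmxA Pa !mul0mx.
  move/(congr1 mxtrace); rewrite raddf_sum mxtrace0 => /eqP.
  rewrite psumr_eq0 => [/allP /(_ i (mem_index_enum _))|j _] /=; last first.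
    by rewrite mxtrace_outer dotpp_ge0.
  rewrite mxtrace_outer => /eqP /dotpp_eq0 /eqP.
  by rewrite mulmxBl mul1mx outer_mul subr_eq0 => /eqP.
transitivity (dotp a ((\sum_i v i *m (v i)^t*) *m a)); last by rewrite h outer_mul a1 scale1r.
rewrite mulmx_suml dotp_sumr; apply: eq_bigr => i _.
by rewrite outer_mul dotpZr (dotp_conj (v i)) -normCKC.
Qed.

Lemma mul_ptrace2 (S E : finType) (K : OpMx R S) (X : OpMx R (S * E)) :
  K *m ptrace2 X = ptrace2 (tens K (1%:M : OpMx R E) *m X).
Proof.
apply: entryP => s s'; rewrite entry_mul entry_mkhom.
under [RHS]eq_bigr do rewrite entry_tens1_mul.
rewrite exchange_big; apply: eq_bigr => t _ /=.
by rewrite entry_mkhom mulr_sumr.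
Qed.

End Stinespring.

Section KIexistence.
Variable R : realType.
Local Notation C := R[i].

Lemma sum_unit (V : nmodType) (F : unit -> V) : \sum_x F x = F tt.
Proof. by rewrite (bigD1 tt) //= big1 ?addr0 // => -[]. Qed.

Section UnitN.
Variables (A' Cl Q E : finType) (al : Cl -> E -> C).
Hypothesis al1 : forall c, \sum_e `|al c e| ^+ 2 = 1.

(** For one-dimensional [N] the isometry [U_c] is just a unit vector of the environment. *)
Definition env_iso (c : Cl) : LinMx R unit (unit * E) := mkhom (fun ke _ => al c ke.2).

Lemma env_iso_isometric c : isometric (env_iso c).
Proof.
apply: entryP => -[] []; rewrite entry_mul sum_pair entry1 eqxx.
rewrite sum_unit -[RHS](al1 c).
by apply: eq_bigr => e _; rewrite entry_adj entry_mkhom normCKC.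
Qed.

Lemma env_iso_ptrace c : ptrace2 (env_iso c *m 1%:M *m (env_iso c)^t*) = 1%:M.
Proof.
apply: entryP => -[] []; rewrite mulmx1 entry_mkhom entry1 eqxx -[RHS](al1 c).
apply: eq_bigr => e _; by rewrite entry_mul sum_unit entry_adj !entry_mkhom normCK.
Qed.

Lemma entry_KI_block (Y : finType) (M : LinMx R Y (Cl * unit * Q)) c k q e y :
  entry (KI_block Q env_iso *m M) (c, k, q, e) y = al c e * entry M (c, k, q) y.
Proof.
case: k; rewrite entry_mul sum_triple (bigD1 c) //= sum_unit (bigD1 q) //=.
rewrite !entry_mkhom !eqxx mul1r mulr1 !big1 ?addr0 // => [d /negbTE dc|d /negbTE dq].
  by rewrite sum_unit big1 // => q' _; rewrite entry_mkhom eq_sym dc !mul0r.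
by rewrite entry_mkhom [q == d]eq_sym dq mulr0 mul0r.
Qed.

(** The required form of [U], read at one environment label [e]: on the support of [rho], the Kraus
    operator [env_kraus U e] multiplies block [c] by the scalar [al c e]. *)
Lemma KI_block_form (U : LinMx R A' (A' * E)) (UKI : LinMx R A' (Cl * unit * Q)) (rho : OpMx R A') :
  (forall e t s, entry (env_kraus U e *m rho) t s =
     \sum_c \sum_q Num.conj (entry UKI (c, tt, q) t) * al c e * entry (UKI *m rho) (c, tt, q) s) ->
  U *m rho = (tens UKI (1%:M : OpMx R E))^t* *m KI_block Q env_iso *m UKI *m rho.
Proof.
move=> h; apply: entryP => -[t e] s.
transitivity (entry (env_kraus U e *m rho) t s).
  by rewrite !entry_mul; apply: eq_bigr => s' _; rewrite entry_mkhom.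
rewrite h tens_adj adj1 -!mulmxA entry_tens1_mul sum_triple; apply: eq_bigr => c _.
by rewrite sum_unit; apply: eq_bigr => q _; rewrite entry_KI_block entry_adj mulrA.
Qed.

End UnitN.

Lemma is_state_unit : is_state (1%:M : OpMx R unit).
Proof. by split; [exact: psd1 | rewrite mxtrace1 card_unit]. Qed.

Lemma is_state_ket_proj n (u : 'cV[C]_n) : dotp u u = 1 -> is_state (ket_proj u).
Proof. by move=> u1; split; [exact: psd_outer | rewrite mxtrace_outer]. Qed.

Definition KI_pure_iso (A' : finType) : LinMx R A' (unit * unit * A') :=
  mkhom (fun y x => (y.2 == x)%:R).

(** A pure state is all [Q]. By extremality each [K e (x) 1] multiplies [u] by a scalar, and taking
    the partial trace against [u] shows that [K e] is this scalar on the support of the reduced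
    state. *)
Lemma KI_pure (A' Rf : finType) (u : KetMx R (A' * Rf)) : dotp u u = 1 ->
  is_KI (ket_proj u) (KI_pure_iso A') (fun _ : unit => 1 : R) (fun _ => 1%:M)
    (fun _ => ket_proj u).
Proof.
move=> u1; have isoM (Y : finType) (M : LinMx R Y A') c k q y :
    entry (KI_pure_iso A' *m M) (c, k, q) y = entry M q y.
  rewrite entry_mul (bigD1 q) //= entry_mkhom eqxx mul1r big1 ?addr0 //.
  by move=> q' /negbTE qq; rewrite entry_mkhom eq_sym qq mul0r.
split.
- apply: entryP => s t; rewrite entry_mul sum_triple !sum_unit.
  under eq_bigr do rewrite entry_adj !entry_mkhom conjC_nat /=.
  rewrite (bigD1 s) //= eqxx mul1r big1 ?addr0 ?entry1 // => q /negbTE ->; exact: mul0r.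
- split=> [|_|_]; [split=> [_|] | exact: is_state_unit | exact: is_state_ket_proj].
    exact: ler01.
  by rewrite sum_unit.
- set M := tens _ _; have ME (Y : finType) (X : LinMx R Y (A' * Rf)) c k q r y :
      entry (M *m X) (c, k, q, r) y = entry X (q, r) y.
    rewrite entry_tens1_mul (bigD1 q) //= entry_mkhom eqxx mul1r big1 ?addr0 //.
    by move=> q' /negbTE qq; rewrite entry_mkhom /= eq_sym qq mul0r.
  have ME' (Y : finType) (X : LinMx R (A' * Rf) Y) c k q r y :
      entry (X *m M^t*) y (c, k, q, r) = entry X y (q, r).
    have -> : X *m M^t* = (M *m (X^t* : LinMx R Y (A' * Rf)))^t* by rewrite adjM trmxCK.
    by rewrite entry_adj ME entry_adj conjCK.
  apply: entryP => -[[[[] []] q] r] [[[[] []] q'] r'].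
  by rewrite ME' ME entry_mkhom entry1 !mul1r.
- move=> L cL Lrho E U isoU LU; set K := env_kraus U.
  have PK : L =1 kraus K by move=> X; rewrite LU ptrace2_stinespring.
  pose v e := tens (K e) (1%:M : OpMx R Rf) *m u.
  have vv : \sum_e v e *m (v e)^t* = u *m u^t*.
    rewrite -[RHS]Lrho (ext_id_kraus _ PK); apply: eq_bigr => e _.
    by rewrite /v /ket_proj adjM !mulmxA.
  have [vE al1] := sum_outer_eq_outer u1 vv.
  pose al (_ : unit) e := dotp u (v e).
  exists (env_iso al); split=> [c|].
    by split; [exact: env_iso_isometric | exact: env_iso_ptrace].
  apply: KI_block_form => e t s; rewrite sum_unit.
  rewrite mul_ptrace2 mulmxA -/(v e) vE -scalemxAl.
  rewrite [RHS](bigD1 t) //= [X in Num.conj X]entry_mkhom eqxx conjC_nat mul1r isoM big1 ?addr0.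
    rewrite !entry_mkhom mulr_sumr; apply: eq_bigr => r _; exact: entryZ.
  by move=> q /negbTE qt; rewrite entry_mkhom qt conjC_nat !mul0r.
Qed.

Definition KI_classical_iso (X A' : finType) (e : X -> KetMx R A') : LinMx R A' (X * unit * unit) :=
  mkhom (fun y t => Num.conj (kent (e y.1.1) t)).

(** A classical state is all [C]. A channel fixing it fixes each [e x] of positive weight, because
    the reference reveals [x]; by extremality its Kraus operators act on [e x] as scalars. *)
Lemma KI_classical (X A' Rf : finType) (p : X -> R) (e : X -> KetMx R A') (f : X -> KetMx R Rf) :
  is_distr p -> orthonormal e -> \sum_x e x *m (e x)^t* = 1%:M -> orthonormal f ->
  is_KI (classical_state p e f) (KI_classical_iso e) p (fun _ => 1%:M)
    (fun x => ket_proj (mkket (fun a : unit * Rf => kent (f x) a.2))).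
Proof.
move=> dp oe ce onf.
have isoe x : KI_classical_iso e *m e x = mkket (fun y => (y.1.1 == x)%:R).
  apply: ketP => -[[y z] w]; rewrite kent_mul kent_mkket /= -oe dotp_kent.
  by apply: eq_bigr => t _; rewrite entry_mkhom.
split.
- rewrite /isometric -[LHS]mulmx1 -ce mulmx_sumr; apply: eq_bigr => x _.
  rewrite -mulmxA [KI_classical_iso e *m _]mulmxA isoe mulmxA; congr (_ *m _).
  apply: ketP => t; rewrite kent_mul sum_triple (bigD1 x) //= !sum_unit.
  rewrite kent_mkket entry_adj entry_mkhom conjCK eqxx mulr1 big1 ?addr0 // => y /negbTE yx.
  by rewrite !sum_unit kent_mkket /= yx mulr0.
- split=> // x; first exact: is_state_unit.
  apply: is_state_ket_proj; rewrite dotp_kent sum_pair sum_unit.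
  by under eq_bigr do rewrite kent_mkket /=; rewrite -dotp_kent onf eqxx.
- set M := tens _ _.
  rewrite /classical_state mulmx_sumr mulmx_suml.
  have step x : M *m tens (ket_proj (e x)) (ket_proj (f x)) *m M^t* =
      ket_proj (tens_ket (mkket (fun y : X * unit * unit => (y.1.1 == x)%:R)) (f x)).
    rewrite /ket_proj tens_outer mulmxA tens_mul_ket isoe mul1mx -mulmxA -adjM.
    by rewrite tens_mul_ket isoe mul1mx.
  apply: entryP => -[[[x []] []] r] [[[y []] []] r'].
  rewrite entry_sum (bigD1 x) //= -scalemxAr -scalemxAl step entryZ entry_outer !kent_tens_ket.
  rewrite !kent_mkket /= eqxx big1 ?addr0 => [|z /negbTE zx]; last first.
    rewrite -scalemxAr -scalemxAl step entryZ entry_outer !kent_tens_ket !kent_mkket /=.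
    by rewrite eq_sym zx !mul0r mulr0.
  rewrite [RHS]entry_mkhom entry1 [in RHS]entry_outer !kent_mkket /= rmorphM /= conjC_nat.
  by rewrite [y == x]eq_sym; ring.
- move=> L cL Lrho E U isoU LU; set K := env_kraus U.
  have PK : L =1 kraus K by move=> Z; rewrite LU ptrace2_stinespring.
  have fixe x : p x != 0 -> kraus K (e x *m (e x)^t*) = e x *m (e x)^t*.
    move=> px; have pxC : (p x)%:C != 0 by rewrite -[0]/(0%:C) (inj_eq (@complexI R)).
    apply: (scalerI pxC); rewrite -linearZ /=.
    have := congr1 (slice (f x)) Lrho.
    by rewrite (ext_id_kraus _ PK) !classical_stateE kraus_blocks !slice_blocks.
  have alx x : exists al : E -> C, \sum_i `|al i| ^+ 2 = 1 /\
      (p x != 0 -> forall i, K i *m e x = al i *: e x).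
    have H y : p y != 0 -> exists al : E -> C, \sum_i `|al i| ^+ 2 = 1 /\
        forall i, K i *m e y = al i *: e y.
      move=> py; have ey : dotp (e y) (e y) = 1 by rewrite oe eqxx.
      have vv : \sum_i (K i *m e y) *m (K i *m e y)^t* = e y *m (e y)^t*.
        rewrite -[RHS]fixe //; apply: eq_bigr => i _; by rewrite adjM !mulmxA.
      have [vE al1] := sum_outer_eq_outer ey vv.
      by exists (fun i => dotp (e y) (K i *m e y)).
    (* On a label of weight 0 the channel is arbitrary, but a unit vector of the environment must
       still be supplied; that of any label in the support will do. *)
    case: (eqVneq (p x) 0) => [px|/H [al [al1 alE]]]; last by exists al.
    have [y py] : exists y, p y != 0.
      apply/not_existsP => p0; case: dp => _ /eqP; rewrite big1 ?[0 == _]eq_sym ?oner_eq0 //.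
      by move=> y _; apply/eqP/negPn/negP/p0.
    by have [al [al1 _]] := H y py; exists al.
  have [al alP] := choice alx.
  have al1 x : \sum_i `|al x i| ^+ 2 = 1 by case: (alP x).
  exists (env_iso al); split=> [c|].
    by split; [exact: env_iso_isometric | exact: env_iso_ptrace].
  have rhoE : ptrace2 (classical_state p e f) = \sum_x (p x)%:C *: ket_proj (e x).
    by rewrite classical_stateE ptrace2_blocks.
  apply: KI_block_form => i t s; rewrite rhoE !mulmx_sumr !entry_sum.
  have isoent x y : entry (KI_classical_iso e *m ((p y)%:C *: ket_proj (e y))) (x, tt, tt) s =
     (x == y)%:R * ((p y)%:C * Num.conj (kent (e y) s)).
    by rewrite -scalemxAr mulmxA isoe entryZ entry_outer kent_mkket /=; ring.
  apply: eq_bigr => x _; rewrite sum_unit entry_sum.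
  under eq_bigr do rewrite isoent.
  rewrite (bigD1 x) //= [X in _ + X]big1 => [|y /negbTE yx]; last by rewrite eq_sym yx mul0r.
  rewrite eqxx entry_mkhom conjCK addr0 mul1r -scalemxAr mulmxA.
  case: (eqVneq (p x) 0) => [->|/(alP x).2 ->].
    by rewrite scale0r entry0 mul0r mulr0.
  by rewrite -scalemxAl !entryZ entry_outer; ring.
Qed.

Lemma entropy_CQ_pure (A' Rf : finType) (u : KetMx R (A' * Rf)) : dotp u u = 1 ->
  entropy_CQ (ket_proj u) = entropy (ptrace2 (ket_proj u)).
Proof.
move=> u1; apply: (entropy_CQ_pure_slices (KI_pure u1) _ (std_ket_complete R Rf)
  (a := fun r => mkket (fun s => kent u (s, r)))).
  by apply: psd_herm; exact: psd_outer.
move=> r; apply: entryP => s s'.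
by rewrite slice_std !entry_outer !kent_mkket.
Qed.

Lemma entropy_CQ_classical (X A' Rf : finType) (p : X -> R) (e : X -> KetMx R A')
    (f : X -> KetMx R Rf) :
  is_distr p -> orthonormal e -> \sum_x e x *m (e x)^t* = 1%:M ->
  orthonormal f -> \sum_x f x *m (f x)^t* = 1%:M ->
  entropy_CQ (classical_state p e f) = - \sum_x p x * log2 (p x).
Proof.
move=> dp oe ce onf cf; have p0 := dp.1.
rewrite (entropy_CQ_pure_slices (KI_classical dp oe ce onf) _ cf
  (a := fun x => (Num.sqrt (p x))%:C *: e x)).
- by rewrite classical_stateE ptrace2_blocks // -(entropy_sum_outer _ oe).
- rewrite classical_stateE blocks_adj; congr blocks; apply: funext => x.
  by rewrite adjZ conj_real /ket_proj adjM trmxCK.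
- move=> x; rewrite classical_stateE slice_blocks // adjZ conj_real.
  by rewrite -scalemxAr -scalemxAl scalerA -rmorphM /= -expr2 sqr_sqrtr.
Qed.

End KIexistence.

(** * Rates and typical sequences *)

Section EReal.
Variable R : realType.
Local Open Scope ereal_scope.

Lemma lee_real_dense (x y : \bar R) :
  (forall r : R, r%:E < x -> r%:E <= y) -> x <= y.
Proof.
move=> h; rewrite leNgt; apply/negP => yx.
suff [r [ry rx]] : exists r : R, y < r%:E /\ r%:E < x.
  by have := h r rx; rewrite leNgt ry.
case: y x {h} yx => [y| |] [x| |] //= yx.
- rewrite lte_fin in yx; exists ((x + y) / 2)%R; rewrite !lte_fin; split; lra.
- by exists (y + 1)%R; rewrite lte_fin ltry ltrDl.
- by exists (x - 1)%R; rewrite lte_fin ltNyr ltrBlDr ltrDl.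
- by exists 0%R; rewrite ltNyr ltry.
Qed.

Lemma limn_einf_ge (f : nat -> \bar R) (c : \bar R) (n0 : nat) :
  (forall n, (n0 <= n)%N -> c <= f n) -> c <= limn_einf f.
Proof.
move=> h; rewrite limn_einf_lim (cvg_lim _ (@cvg_einfs_sup _ f)) //.
apply: le_ereal_sup_tmp; exists (einfs f n0); first by exists n0.
by apply: le_ereal_inf_tmp => _ [n /= n0n <-]; exact: h.
Qed.

Lemma lt_limn_einf (f : nat -> \bar R) (c : \bar R) :
  c < limn_einf f -> exists n0, forall n, (n0 <= n)%N -> c < f n.
Proof.
rewrite limn_einf_lim (cvg_lim _ (@cvg_einfs_sup _ f)) // => /ereal_sup_gt [_ [n0 _ <-]] h.
exists n0 => n n0n; apply: lt_le_trans h _.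
by apply: ereal_inf_lbound; exists n.
Qed.

End EReal.

(** * Comparison of code rates and transmission rates *)

Section Rate.
Variable R : realType.

Lemma le_log2 (x y : R) : 0 < x -> (y <= log2 x) = (2 `^ y <= x).
Proof.
move=> x0; have l2 : 0 < ln 2 :> R by rewrite ln_gt0 // ltr1n.
rewrite /log2 ler_pdivlMr // /powR pnatr_eq0 /=.
by rewrite -{2}(lnK x0) ler_expR.
Qed.

Lemma powR2_log2 (x : R) : 0 < x -> 2 `^ (log2 x) = x.
Proof.
move=> x0; have l2 : 0 < ln 2 :> R by rewrite ln_gt0 // ltr1n.
by rewrite /log2 /powR pnatr_eq0 /= divfK ?gt_eqF // lnK.
Qed.

Lemma large_nat (x : R) : exists n : nat, forall m : nat, (n <= m)%N -> x <= m%:R.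
Proof.
exists (Num.truncn `|x|).+1 => m nm; apply: (le_trans (ler_norm x)).
have /andP[_ /ltW h] := truncn_itv (normr_ge0 x).
by apply: le_trans h _; rewrite ler_nat.
Qed.

Variables (code tr : nat -> R -> nat -> Prop) (H : R).
Hypothesis H0 : 0 < H.
Hypothesis code_tr : forall del eps : R, 0 < del -> 0 < eps ->
  exists eps' m0, 0 < eps' /\ forall n m M, (m0 <= m)%N -> (0 < M)%N ->
    2 `^ (m%:R * (H + del)) <= M%:R -> code n eps' M -> tr n eps m.
Hypothesis tr_code : forall del eps : R, 0 < del -> 0 < eps ->
  exists eps' m0, 0 < eps' /\ forall n m, (m0 <= m)%N -> tr n eps' m ->
    exists M, [/\ (0 < M)%N, 2 `^ (m%:R * (H - del)) <= M%:R & code n eps M].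
Hypothesis tr0 : forall n eps, 0 < eps -> tr n eps 0.
Hypothesis code1 : forall n eps, 0 < eps -> code n eps 1.

Let rate n eps : \bar R := ereal_sup [set (m%:R * H / n%:R)%:E | m in [set m : nat | tr n eps m]].

Lemma rate_ge n eps m : tr n eps m -> ((m%:R * H / n%:R)%:E <= rate n eps)%E.
Proof. by move=> h; apply: ereal_sup_ubound; exists m. Qed.

Lemma rate_ge0 n eps : 0 < eps -> (0 <= rate n eps)%E.
Proof. by move=> e0; have := rate_ge (tr0 n e0); rewrite !mul0r. Qed.

Lemma achievable_rate r eps : achievable code r -> 0 < eps ->
  (r%:E <= limn_einf (fun n => rate n eps))%E.
Proof.
move=> ach e0; have [r0|r0] := leP r 0.
  apply: (@limn_einf_ge _ _ _ 0) => n _; apply: le_trans (rate_ge0 n e0).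
  by rewrite lee_fin.
apply/lee_real_dense => r' r'r; rewrite lte_fin in r'r.
(* [r'] may be negative; the maximum keeps the target rate positive and below [r]. *)
pose r1 := Num.max r' (r / 2).
have r10 : 0 < r1 by rewrite lt_max divr_gt0 ?orbT.
have r1r : r1 < r by rewrite gt_max r'r /=; lra.
apply: (@le_trans _ _ r1%:E); first by rewrite lee_fin le_max lexx.
pose r2 := (r1 + r) / 2.
have r12 : r1 < r2 by rewrite /r2; lra.
have r2r : r2 < r by rewrite /r2; lra.
have r20 : 0 < r2 by lra.
(* A code of size [2 ^ (n * r)] carries about [n * r / (H + del)] copies. This [del] makes
   [r * H / (H + del)] equal to [r2], and the gap [r2 - r1] pays for rounding the number of copies
   down. *)
pose del := H * (r / r2 - 1).
have d0 : 0 < del by rewrite mulr_gt0 // subr_gt0 ltr_pdivlMr // mul1r.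
have HdE : H + del = H * r / r2 by rewrite /del; field; rewrite gt_eqF.
have Hd0 : 0 < H + del by rewrite addr_gt0.
have [eps' [m0 [e'0 ct]]] := code_tr d0 e0.
have [n0 achn] := ach _ e'0.
have [n1 n1P] := large_nat (H / (r2 - r1)).
have [n2 n2P] := large_nat (m0%:R * (H + del) / r).
apply: (@limn_einf_ge _ _ _ (maxn n0 (maxn n1 n2.+1))) => n.
rewrite !geq_max => /and3P[nn0 nn1 nn2].
have [M [M0 Mr cM]] := achn n nn0.
have n_gt0 : 0 < n%:R :> R by rewrite ltr0n (leq_trans _ nn2).
pose x := n%:R * r / (H + del).
have x0 : 0 <= x by rewrite divr_ge0 ?mulr_ge0 // ltW.
pose m := Num.truncn x.
have /andP[mx xm] := truncn_itv x0.
have m0m : (m0 <= m)%N.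
  rewrite /m truncn_ge_nat // /x ler_pdivlMr //.
  have := n2P n (ltnW nn2); rewrite ler_pdivrMr //.
have trm : tr n eps m.
  apply: (ct n m M) => //; rewrite le_log2 ?ltr0n // in Mr.
  apply: le_trans Mr; apply: ler_powR; first by rewrite ler1n.
  by move: mx; rewrite -/m /x ler_pdivlMr.
apply: le_trans (rate_ge trm); rewrite lee_fin ler_pdivlMr //.
have h1 := n1P n nn1; rewrite ler_pdivrMr ?subr_gt0 // in h1.
have h2 : x * H = n%:R * r2.
  by rewrite /x HdE; field; rewrite ?gt_eqF.
move: xm; rewrite -/m -natr1 => xm.
have h3 : x * H < (m%:R + 1) * H by rewrite ltr_pM2r.
have -> : r1 * n%:R = n%:R * r2 - n%:R * (r2 - r1) by ring.
by rewrite -h2; lra.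
Qed.

Lemma rate_achievable r r' : 0 < r' -> r' < r ->
  (forall eps, 0 < eps -> (r%:E < limn_einf (fun n => rate n eps))%E) -> achievable code r'.
Proof.
move=> r'0 r'r h eps e0; have r0 : 0 < r by lra.
(* Then [H - del = H * r' / r], so that [m * H > n * r] becomes [m * (H - del) > n * r']. *)
pose del := H * (1 - r' / r).
have d0 : 0 < del by rewrite mulr_gt0 // subr_gt0 ltr_pdivrMr // mul1r.
have [eps' [m0 [e'0 tc]]] := tr_code d0 e0.
have [n0 n0P] := lt_limn_einf (h _ e'0).
have [n1 n1P] := large_nat (m0%:R * H / r).
exists (maxn n0 n1.+1) => n; rewrite geq_max => /andP[nn0 nn1].
have /ereal_sup_gt [_ [m trm <-]] := n0P n nn0.
have n_gt0 : 0 < n%:R :> R by rewrite ltr0n (leq_trans _ nn1).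
rewrite lte_fin ltr_pdivlMr // => rm.
have m0m : (m0 <= m)%N.
  have := n1P n (ltnW nn1); rewrite ler_pdivrMr // => h1.
  rewrite -(ler_nat R) -(ler_pM2r H0); lra.
have [M [M0 Mm cM]] := tc n m m0m trm.
exists M; split=> //; rewrite le_log2 ?ltr0n //; apply: le_trans Mm.
apply: ler_powR; first by rewrite ler1n.
have -> : m%:R * (H - del) = (m%:R * H) * (r' / r) by rewrite /del; ring.
have -> : n%:R * r' = (r * n%:R) * (r' / r) by field; rewrite gt_eqF.
by rewrite ler_pM2r ?divr_gt0 // ltW.
Qed.

Lemma capacity_rate :
  capacity code = ereal_inf [set limn_einf (fun n => rate n eps) | eps in [set eps : R | 0 < eps]].
Proof.
apply/eqP; rewrite eq_le; apply/andP; split.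
  apply: ge_ereal_sup => _ [r ach <-]; apply: le_ereal_inf_tmp => _ [eps e0 <-].
  exact: achievable_rate.
have cap0 : (0 <= capacity code)%E.
  apply: ereal_sup_ubound; exists 0 => // eps e0; exists 0%N => n _.
  by exists 1%N; split=> //; [rewrite mulr0 /log2 ln1 mul0r | exact: code1].
apply: lee_real_dense => r rlt; have [r0|r0] := leP r 0.
  by apply: le_trans cap0; rewrite lee_fin.
(* The first approximation makes the bound on the lower limits strict; the second, [r' < r], makes
   room for a positive [del]. *)
apply: lee_real_dense => r' r'r; rewrite lte_fin in r'r.
have [r'0|r'0] := leP r' 0; first by apply: le_trans cap0; rewrite lee_fin.
apply: ereal_sup_ubound; exists r' => //; apply: (rate_achievable r'0 r'r) => eps e0.
by apply: lt_le_trans rlt _; apply: ereal_inf_lbound; exists eps.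
Qed.

End Rate.

(** * Typical sequences *)

Section Typical.
Variable R : realType.
Variables (X : finType) (p : X -> R).
Hypothesis dp : is_distr p.

Lemma sum_prod_distr m (g : 'I_m -> X -> R) :
  \sum_(x : {ffun 'I_m -> X}) prod_distr p x * \prod_i g i (x i) =
  \prod_i \sum_y p y * g i y.
Proof. by rewrite bigA_distr_bigA; apply: eq_bigr => x _; rewrite -big_split. Qed.

(** Independence: every cross term of the square factorizes and contains the vanishing mean of
    [L]. *)
Lemma variance_prod m (L : X -> R) : \sum_y p y * L y = 0 ->
  \sum_(x : {ffun 'I_m -> X}) prod_distr p x * (\sum_i L (x i)) ^+ 2 =
  m%:R * \sum_y p y * L y ^+ 2.
Proof.
move=> L0; have p1 := dp.2.
under eq_bigr => x _ do rewrite expr2 mulr_suml mulr_sumr.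
rewrite exchange_big /= -[m in m%:R]card_ord mulr_natl -sumr_const; apply: eq_bigr => i _.
under eq_bigr => x _ do rewrite mulr_sumr mulr_sumr.
rewrite exchange_big (bigD1 i) //= [X in _ + X]big1 ?addr0 => [|j ji].
  transitivity (\sum_(x : {ffun 'I_m -> X}) prod_distr p x *
      \prod_k (if k == i then L (x k) ^+ 2 else 1)).
    apply: eq_bigr => x _; congr (_ * _).
    by rewrite (bigD1 i) //= eqxx big1 ?mulr1 ?expr2 // => k /negbTE ->.
  rewrite (sum_prod_distr (fun k y => if k == i then L y ^+ 2 else 1)).
  rewrite (bigD1 i) //= eqxx [X in _ * X]big1 ?mulr1 // => k /negbTE ->.
  by under eq_bigr do rewrite mulr1.
transitivity (\sum_(x : {ffun 'I_m -> X}) prod_distr p x *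
    \prod_k (if (k == i) || (k == j) then L (x k) else 1)).
  apply: eq_bigr => x _; congr (_ * _).
  rewrite (bigD1 i) //= eqxx (bigD1 j) //= eqxx orbT big1 ?mulr1 // => k /andP[/negbTE -> /negbTE ->] //.
rewrite (sum_prod_distr (fun k y => if (k == i) || (k == j) then L y else 1)).
by rewrite (bigD1 i) //= eqxx L0 mul0r.
Qed.

Let H := - \sum_x p x * log2 (p x).

Lemma typical_set (del eta : R) : 0 < del -> 0 < eta ->
  exists m0 : nat, forall m, (m0 <= m)%N ->
  exists T : {set {ffun 'I_m -> X}},
    1 - eta <= \sum_(x in T) prod_distr p x /\
    forall x, x \in T ->
      2 `^ (- (m%:R * (H + del))) <= prod_distr p x <= 2 `^ (- (m%:R * (H - del))).
Proof.
move=> d0 e0; have [p0 p1] := dp.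
pose L y := - log2 (p y) - H; pose V := \sum_y p y * L y ^+ 2.
have L0 : \sum_y p y * L y = 0.
  rewrite /L; under eq_bigr do rewrite mulrBr mulrN.
  by rewrite sumrB -mulr_suml p1 mul1r sumrN subrr.
have V0 : 0 <= V by apply: sumr_ge0 => y _; rewrite mulr_ge0 // sqr_ge0.
have [m0 m0P] := large_nat (V / (del ^+ 2 * eta)).
exists m0.+1 => m mm0; have m_gt0 : 0 < m%:R :> R by rewrite ltr0n (leq_trans _ mm0).
pose S (x : {ffun 'I_m -> X}) := \sum_i L (x i).
(* Positivity is imposed separately: since [ln 0 = 0], a sequence of probability 0 could have small
   [S x] and violate the lower bound. *)
pose T := [set x : {ffun 'I_m -> X} | (0 < prod_distr p x) && (`|S x| <= m%:R * del)].
have P0 (x : {ffun 'I_m -> X}) : 0 <= prod_distr p x by exact: prodr_ge0.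
exists T; split.
  have h1 : \sum_(x : {ffun 'I_m -> X}) prod_distr p x = 1 by case: (prod_distr_is_distr m dp).
  rewrite (bigID (mem T)) /= in h1.
  suff : \sum_(x | x \notin T) prod_distr p x <= eta by lra.
  have md : 0 < (m%:R * del) ^+ 2 by rewrite exprn_gt0 // mulr_gt0.
  rewrite -(ler_pM2r md); apply: (@le_trans _ _ (m%:R * V)); last first.
    have := m0P m (ltnW mm0); rewrite ler_pdivrMr ?mulr_gt0 ?exprn_gt0 // => h.
    have -> : eta * (m%:R * del) ^+ 2 = m%:R * (m%:R * (del ^+ 2 * eta)) by ring.
    by rewrite ler_pM2l.
  rewrite -(variance_prod m L0) mulr_suml [X in _ <= X](bigID (mem T)) /=.
  apply: ler_wpDl; first by apply: sumr_ge0 => x _; rewrite mulr_ge0 // sqr_ge0.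
  apply: ler_sum => x; rewrite inE negb_and -leNgt -ltNge => /orP[Px|Sx].
    by have -> : prod_distr p x = 0; [apply/eqP; rewrite eq_le Px P0 | rewrite !mul0r].
  apply: ler_wpM2l => //; rewrite -[X in _ <= X]real_normK ?num_real //.
  by apply: lerXn2r (ltW Sx); rewrite nnegrE ?normr_ge0 // mulr_ge0 // ltW.
move=> x; rewrite inE => /andP[Px Sx].
have pxi i : 0 < p (x i).
  rewrite lt_def p0 andbT; apply: contraTneq Px => pi0.
  by rewrite /prod_distr (bigD1 i) //= pi0 mul0r ltxx.
have PE : prod_distr p x = 2 `^ (- (S x + m%:R * H)).
  have -> : - (S x + m%:R * H) = \sum_i log2 (p (x i)).
    rewrite /S /L big_split /= sumrN sumr_const card_ord -mulr_natl; ring.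
  rewrite /prod_distr; elim/big_rec2: _ => [|i y z _ ->]; first by rewrite powRr0.
  by rewrite powRD ?pnatr_eq0 ?implybT // powR2_log2.
rewrite ler_norml in Sx; case/andP: Sx => S1 S2.
by rewrite PE !ler_powR ?ler1n //; lra.
Qed.

Lemma card_typical m (T : {set {ffun 'I_m -> X}}) (b : R) :
  (forall x, x \in T -> 2 `^ (- b) <= prod_distr p x) -> #|T|%:R <= 2 `^ b.
Proof.
move=> h; have [P0 P1] := prod_distr_is_distr m dp.
have : \sum_(x in T) 2 `^ (- b) <= 1.
  rewrite -[X in _ <= X]P1 [X in _ <= X](bigID (mem T)) /=.
  apply: ler_wpDr; first by apply: sumr_ge0 => x _; exact: P0.
  exact: ler_sum.
by rewrite sumr_const -[X in X <= _ -> _]mulr_natl powRN ler_pdivrMr ?powR_gt0 // mul1r.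
Qed.

End Typical.

(** * Reduction of the capacity formula to one-shot bounds *)

Section Cores.
Variable R : realType.
Variables (X : finType) (p : X -> R).
Hypothesis dp : is_distr p.
Hypothesis p_lt1 : forall x, p x < 1.

Let H := - \sum_x p x * log2 (p x).

Lemma distr_entropy_gt0 : 0 < H.
Proof.
have [p0 p1] := dp.
have l2 : 0 < ln 2 :> R by rewrite ln_gt0 // ltr1n.
have t0 x : 0 <= - (p x * log2 (p x)).
  case: (eqVneq (p x) 0) => [->|px]; first by rewrite mul0r oppr0.
  rewrite -mulrN mulr_ge0 // oppr_ge0 /log2 pmulr_lle0 ?invr_gt0 //.
  by rewrite ln_le0 // ltW.
have [x px] : exists x, p x != 0.
  apply/not_existsP => h; have := oner_neq0 R; rewrite -p1 big1 ?eqxx // => x _.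
  by apply/eqP/negPn/negP/h.
have px0 : 0 < p x by rewrite lt_def px p0.
rewrite /H -sumrN (bigD1 x) //=; apply: ltr_pwDl; last exact: sumr_ge0.
rewrite -mulrN mulr_gt0 // oppr_gt0 /log2 pmulr_llt0 ?invr_gt0 //.
by rewrite ln_lt0 // px0 p_lt1.
Qed.

Variables (code tr : nat -> R -> nat -> Prop) (c : R).
Hypothesis c0 : 0 < c.
Hypothesis code1 : forall n eps, 0 < eps -> code n eps 1.
Hypothesis direct : forall n m eps eta M (T : {set {ffun 'I_m -> X}}),
  0 < eps -> 0 <= eta -> (0 < M)%N -> (#|T| <= M)%N -> 1 - eta <= \sum_(x in T) prod_distr p x ->
  code n eps M -> tr n (c * (eps + eta)) m.
Hypothesis converse : forall eps, 0 < eps -> exists eps' eta,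
  [/\ 0 < eps', 0 < eta & forall n m (T : {set {ffun 'I_m -> X}}) b,
    0 < b -> (forall x, x \in T -> prod_distr p x <= b) ->
    1 - eta <= \sum_(x in T) prod_distr p x -> tr n eps' m ->
    exists M, [/\ (0 < M)%N, 1 / 4 <= M%:R * b & code n eps M]].

(** A typical set has at most [2 ^ (m * (H + del))] elements, which is the code size asked for by
    [direct]; its probabilities are at most [2 ^ (- (m * (H - del)))], so [converse] yields about
    [2 ^ (m * (H - del))] messages. The factor [c] is the loss of error in the direct part: 1 for
    messages, 4 for entanglement. *)
Lemma capacity_from_cores :
  capacity code = ereal_inf [set limn_einf (fun n =>
     ereal_sup [set (m%:R * H / n%:R)%:E | m in [set m : nat | tr n eps m]])
   | eps in [set eps : R | 0 < eps]].
Proof.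
apply: capacity_rate => //; first exact: distr_entropy_gt0.
- move=> del eps d0 e0; pose e := eps / c / 2.
  have e'0 : 0 < e by rewrite !divr_gt0.
  have [m0 m0P] := typical_set dp d0 e'0.
  exists e, m0; split=> // n m M m0m M0 hM cM.
  have [T [T1 T2]] := m0P m m0m.
  have -> : eps = c * (e + e) by rewrite /e; field; rewrite gt_eqF.
  apply: (direct (T := T) (M := M)) => //; first exact: ltW.
  rewrite -(ler_nat R); apply: le_trans hM.
  by apply: (card_typical dp) => x /T2 /andP[].
- move=> del eps d0 e0.
  have [eps' [eta [e'0 eta0 conv]]] := converse e0.
  have d20 : 0 < del / 2 by rewrite divr_gt0.
  have [m0 m0P] := typical_set dp d20 eta0.
  (* Typicality uses [del / 2]; the other half absorbs the factor [1 / 4] of [converse], since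
     [m * del / 2 >= 2] from here on. *)
  have [m1 m1P] := large_nat (4 / del).
  exists eps', (maxn m0 m1); split=> // n m; rewrite geq_max => /andP[m0m m1m] trm.
  have [T [T1 T2]] := m0P m m0m.
  have [||M [M0 Mb cM]] := conv n m T (2 `^ (- (m%:R * (H - del / 2)))) _ _ T1 trm.
  + exact: powR_gt0.
  + by move=> x /T2 /andP[].
  exists M; split=> //.
  rewrite powRN ler_pdivlMr ?powR_gt0 // in Mb.
  have -> : m%:R * (H - del) = m%:R * (H - del / 2) + - (m%:R * del / 2) by field.
  rewrite powRD ?pnatr_eq0 ?implybT // mulrC powRN.
  apply: le_trans Mb; apply: ler_wpM2r; first exact: powR_ge0.
  rewrite div1r lef_pV2 ?posrE ?powR_gt0 //.
  have -> : 4 = 2 `^ 2%:R :> R by rewrite powR_mulrn // expr2; ring.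
  apply: ler_powR; first by rewrite ler1n.
  by have := m1P m m1m; rewrite ler_pdivrMr // => h; lra.
- move=> n eps e0; pose e := eps / c.
  have -> : eps = c * (e + 0) by rewrite /e; field; rewrite gt_eqF.
  have e'0 : 0 < e by rewrite divr_gt0.
  (* For [m = 0] the only sequence is the empty one, of probability 1, and a one-element code
     suffices with [eta = 0]. *)
  apply: (direct (T := [set: {ffun 'I_0 -> X}]) (M := 1)) => //.
  + by rewrite cardsT card_ffun card_ord expn0.
  + rewrite subr0; under eq_bigl do rewrite inE.
    by case: (prod_distr_is_distr 0 dp) => _ ->.
  + exact: code1.
Qed.

End Cores.

(** * Classical messages *)

Section MeasurePrepare.
Variable R : realType.
Local Notation C := R[i].

(** [delta_mx j k] moves the entry [Y k k] to place [j]; the sum over [k] builds the trace and that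
    over [j] the identity. The matrix units thus discard a state and put an unnormalized mixed one
    in its place. *)
Lemma sum_delta_sandwich m n (Y : 'M[C]_n) :
  \sum_(j < m) \sum_(k < n) delta_mx j k *m Y *m (delta_mx j k)^t* = \tr Y *: 1%:M.
Proof.
have E j k : (delta_mx j k : 'M[C]_(m, n)) *m Y *m (delta_mx j k)^t* = Y k k *: delta_mx j j.
  rewrite -[delta_mx j k](mul_delta_mx (0 : 'I_1)) adjM.
  have -> : (delta_mx 0 k : 'rV[C]_n)^t* = delta_mx k 0.
    by apply/matrixP=> a b; rewrite !mxE andbC; case: (_ && _); rewrite ?rmorph1 ?rmorph0.
  have -> : (delta_mx j 0 : 'cV[C]_m)^t* = delta_mx 0 j.
    by apply/matrixP=> a b; rewrite !mxE andbC; case: (_ && _); rewrite ?rmorph1 ?rmorph0.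
  have Ykk : delta_mx 0 k *m (Y *m delta_mx k 0) = (Y k k)%:M :> 'M[C]_1.
    by rewrite -colE -rowE; apply/matrixP=> a b; rewrite !ord1 !mxE eqxx mulr1n.
  rewrite -!mulmxA [Y *m (_ *m _)]mulmxA [delta_mx 0 k *m (_ *m _)]mulmxA Ykk.
  by rewrite mul_scalar_mx -scalemxAr mul_delta_mx.
under eq_bigr do under eq_bigr do rewrite E.
under eq_bigr do rewrite -scaler_suml.
rewrite -scaler_sumr; congr (_ *: _); apply/matrixP=> a b; rewrite summxE mxE.
rewrite (bigD1 a) //= mxE eqxx /= big1 ?addr0 1?eq_sym // => i /negbTE ia.
by rewrite mxE eq_sym ia.
Qed.

Lemma psd_root n (A : 'M[C]_n) : psd A -> exists B : 'M[C]_n, B^t* = B /\ B *m B = A.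
Proof. by move=> pA; exists (sqrtmx A); split; [exact: sqrtmx_herm | exact: sqrtmx_sqr]. Qed.

Lemma adj_delta a b (x : 'I_a) (y : 'I_b) : (delta_mx x y : 'M[C]_(a, b))^t* = delta_mx y x.
Proof.
by apply/matrixP=> u v; rewrite !mxE andbC; case: (_ && _); rewrite ?rmorph1 ?rmorph0.
Qed.

(** The matrix units are placed between the square roots of [sig i] and [Lam i]: the right root
    measures, the units discard what is left, the left root prepares. *)
Lemma measure_prepare (I : finType) m n (Lam : I -> 'M[C]_n) (sig : I -> 'M[C]_m) :
  (forall i, psd (Lam i)) -> \sum_i Lam i = 1%:M -> (forall i, is_state (sig i)) ->
  exists (J : finType) (K : J -> 'M[C]_(m, n)),
    kraus_tp K /\ forall Z, kraus K Z = \sum_i \tr (Lam i *m Z) *: sig i.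
Proof.
move=> pL sL ss.
have [L LP] := choice (fun i => psd_root (pL i)).
have [S SP] := choice (fun i => psd_root (ss i).1).
exists (I * ('I_m * 'I_n))%type, (fun x => S x.1 *m delta_mx x.2.1 x.2.2 *m L x.1); split.
  rewrite /kraus_tp -sL sum_pair; apply: eq_bigr => i _.
  transitivity (L i *m (\sum_(k < n) \sum_(j < m) delta_mx k j *m sig i *m (delta_mx k j)^t*) *m L i).
    rewrite exchange_big /= sum_pair mulmx_sumr mulmx_suml; apply: eq_bigr => j _.
    rewrite mulmx_sumr mulmx_suml; apply: eq_bigr => k _.
    by rewrite !adjM (LP i).1 (SP i).1 -(SP i).2 !adj_delta !mulmxA.
  by rewrite sum_delta_sandwich (ss i).2 scale1r mulmx1 (LP i).2.
move=> Z; rewrite /kraus sum_pair; apply: eq_bigr => i _.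
transitivity (S i *m (\sum_j \sum_k delta_mx j k *m (L i *m Z *m L i) *m (delta_mx j k)^t*) *m S i).
  rewrite sum_pair mulmx_sumr mulmx_suml; apply: eq_bigr => j _.
  rewrite mulmx_sumr mulmx_suml; apply: eq_bigr => k _.
  by rewrite /= !adjM (LP i).1 (SP i).1 !mulmxA.
rewrite sum_delta_sandwich -scalemxAr -scalemxAl mulmx1 (SP i).2.
by rewrite mxtrace_mulC mulmxA (LP i).2.
Qed.

End MeasurePrepare.

Section ChannelFacts.
Variable R : realType.
Local Notation C := R[i].

Lemma psd_trace_mul n (A B : 'M[C]_n) : psd A -> psd B -> 0 <= \tr (A *m B).
Proof.
move=> /psd_root [D [hD <-]] pB; rewrite -mulmxA mxtrace_mulC.
have := psd_conj D pB; rewrite hD; move: (_ *m _ *m _) => E /psdE pE.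
by rewrite /mxtrace; apply: sumr_ge0 => i _; rewrite -dotp_delta; exact: pE.
Qed.

Lemma comp_channel_kraus (A B S : finType) (N : {linear OpMx R A -> OpMx R B}) n
    (Enc : {linear OpMx R S -> OpMx R {ffun 'I_n -> A}})
    (Dec : {linear OpMx R {ffun 'I_n -> B} -> OpMx R S}) :
  is_channel N -> is_channel Enc -> is_channel Dec ->
  exists (J : finType) (K : J -> OpMx R S),
    (Dec \o @channel_pow R A B N n \o Enc) =1 kraus K /\ kraus_tp K.
Proof.
move=> /channel_kraus [I1 [K1 [E1 T1]]] /channel_kraus [I2 [K2 [E2 T2]]].
move=> /channel_kraus [I3 [K3 [E3 T3]]].
have T13 := kraus_tp_comp T3 (bigtens_tp n T1).
eexists; eexists; split; last exact: (kraus_tp_comp T13 T2).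
by move=> Z /=; rewrite E2 (channel_pow_kraus E1) E3 !kraus_comp.
Qed.

Lemma channel_pow_psd (A B : finType) (N : {linear OpMx R A -> OpMx R B}) n Z :
  is_channel N -> psd Z -> psd (@channel_pow R A B N n Z).
Proof.
by move=> /channel_kraus [I [K [E T]]] pZ; rewrite (channel_pow_kraus E); exact: kraus_psd.
Qed.

Lemma channel_pow_trace (A B : finType) (N : {linear OpMx R A -> OpMx R B}) n Z :
  is_channel N -> \tr (@channel_pow R A B N n Z) = \tr Z.
Proof.
move=> /channel_kraus [I [K [E T]]]; rewrite (channel_pow_kraus E) kraus_trace.
by have := bigtens_tp n T; rewrite /kraus_tp => ->; rewrite mul1mx.
Qed.

Lemma index_injection (Y : finType) (T : {set Y}) M : (0 < M)%N -> (#|T| <= M)%N ->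
  exists g : Y -> 'I_M, {in T &, injective g}.
Proof.
case: M => // M _ TM; exists (fun y => inord (index y (enum T))) => y z yT zT.
move/(congr1 val); have lt w : w \in T -> (index w (enum T) < M.+1)%N.
  by move=> wT; apply: leq_trans TM; rewrite cardE index_mem mem_enum.
rewrite /= !inordK ?lt // => /(congr1 (nth y (enum T))).
by rewrite !nth_index ?mem_enum.
Qed.

End ChannelFacts.

Section Classical.
Variable R : realType.
Local Notation C := R[i].
Variables (A B : finType) (N : {linear OpMx R A -> OpMx R B}).
Hypothesis hN : is_channel N.

Lemma classical_code1 n eps : (0 < #|A|)%N -> 0 < eps -> classical_code N n eps 1.
Proof.
move=> /card_gt0P [a0 _] e0.
pose a : KetMx R {ffun 'I_n -> A} := std_ket R [ffun=> a0].
have a1 : dotp a a = 1 by rewrite std_ket_on eqxx.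
have sa : is_state (ket_proj a) by split; [exact: psd_outer | rewrite mxtrace_outer].
exists (fun _ => ket_proj a), (fun _ => 1%:M); split=> // [w||w].
- exact: psd1.
- by rewrite big_ord1.
- by rewrite mul1mx channel_pow_trace // sa.2 /= gerBl ltW.
Qed.

Lemma sqrt_ge_id (q : R) : q <= 1 -> q <= Num.sqrt q.
Proof.
move=> q1; have [q0|q0] := leP 0 q; last by apply: le_trans (ltW q0) (sqrtr_ge0 _).
by rewrite -{1}(sqr_sqrtr q0) expr2 ler_piMr ?sqrtr_ge0 // -sqrtr1 ler_sqrt.
Qed.

Variables (Y S E : finType) (P : Y -> R) (e : Y -> KetMx R S) (f : Y -> KetMx R E).
Hypotheses (dP : is_distr P) (oe : orthonormal e) (ce : \sum_y e y *m (e y)^t* = 1%:M)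
  (onf : orthonormal f).

(** [transmits] for an arbitrary classical ensemble. A power of a classical state is again one, over
    sequences, so the one-shot bounds need no powers of the source. *)
Definition transmission n eps := exists (Enc : {linear OpMx R S -> OpMx R {ffun 'I_n -> A}})
    (Dec : {linear OpMx R {ffun 'I_n -> B} -> OpMx R S}),
  [/\ is_channel Enc, is_channel Dec & 1 - eps <=
    fidelity (classical_state P e f)
      (ext_id (Dec \o @channel_pow R A B N n \o Enc) (classical_state P e f))].

(** The encoder measures the basis [e] and sends the codeword of [g y]; the decoder measures the
    POVM and prepares [e (h w)], where [h] inverts [g] on [T]. Labels outside [T] cost at most their
    mass [eta]. *)
Lemma classical_direct n eps eta M (T : {set Y}) :
  0 < eps -> 0 <= eta -> (0 < M)%N -> (#|T| <= M)%N -> 1 - eta <= \sum_(y in T) P y ->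
  classical_code N n eps M -> transmission n (eps + eta).
Proof.
move=> e0 eta0 M0 TM PT [enc [dec [senc pdec sdec good]]].
have [P0 P1] := dP.
have [g gT] := index_injection M0 TM.
have [y0 _] : exists y, P y != 0.
  apply/not_existsP => h; have := oner_neq0 R; rewrite -P1 big1 ?eqxx // => x _.
  by apply/eqP/negPn/negP/h.
pose h w := odflt y0 [pick y in T | g y == w].
have hg y : y \in T -> h (g y) = y.
  move=> yT; rewrite /h; case: pickP => [z /andP[zT /eqP gz]|/(_ y)].
    by apply: gT.
  by rewrite yT eqxx.
have ee y : psd (ket_proj (e y)) by exact: psd_outer.
have se y : is_state (ket_proj (e y)).
  by split; [exact: ee | rewrite mxtrace_outer oe eqxx].
have [J1 [K1 [T1 E1]]] := measure_prepare ee ce (fun y => senc (g y)).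
have [J2 [K2 [T2 E2]]] := measure_prepare pdec sdec (fun w => se (h w)).
have cE : is_channel (kraus K1) by exact: kraus_is_channel T1.
have cD : is_channel (kraus K2) by exact: kraus_is_channel T2.
exists (kraus K1), (kraus K2); split=> //.
have [J [K [EK TK]]] := comp_channel_kraus hN cE cD.
rewrite (fidelity_classical_kraus P0 oe onf EK).
have Ency y : kraus K1 (ket_proj (e y)) = enc (g y).
  rewrite E1 (bigD1 y) //= big1 ?addr0 => [|z zy].
    by rewrite /ket_proj mulmxA outer_mul oe eqxx scale1r mxtrace_outer oe eqxx scale1r.
  by rewrite /ket_proj mulmxA outer_mul oe (negbTE zy) scale0r mul0mx mxtrace0 scale0r.
pose Z y := channel_pow N (enc (g y)).
have pZ y : psd (Z y) by apply: channel_pow_psd => //; case: (senc (g y)).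
pose q y : C := dotp (e y) ((kraus K2 \o @channel_pow R A B N n \o kraus K1) (ket_proj (e y)) *m e y).
have qE y : q y = \sum_w (h w == y)%:R * \tr (dec w *m Z y).
  rewrite /q /= Ency E2 mulmx_suml dotp_sumr; apply: eq_bigr => w _.
  rewrite -scalemxAl outer_mul !dotpZr oe oe [y == _]eq_sym mulrC -mulrA.
  by case: eqP => _; rewrite ?mulr1 ?mul1r // !mul0r.
have t0 y w : 0 <= \tr (dec w *m Z y) by apply: psd_trace_mul.
have q0 y : 0 <= q y.
  by rewrite qE; apply: sumr_ge0 => w _; rewrite mulr_ge0 ?ler0n.
have qg y : y \in T -> 1 - eps <= complex.Re (q y).
  move=> yT; apply: le_trans (good (g y)) _.
  rewrite -/(Z y) -lecR !ge0_RRe // qE (bigD1 (g y)) //= hg // eqxx mul1r lerDl.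
  by apply: sumr_ge0 => w _; rewrite mulr_ge0 ?ler0n.
have F0 : 0 <= \sum_y P y * Num.sqrt (complex.Re (q y)).
  by apply: sumr_ge0 => y _; rewrite mulr_ge0 ?sqrtr_ge0.
(* The bound [(1 - eta) * (1 - eps)] below needs [1 - eps >= 0]; otherwise nonnegativity of the
   fidelity is enough. *)
have [small|big] := leP (1 - (eps + eta)) 0; first exact: le_trans small F0.
rewrite (bigID (mem T)) /=; apply: ler_wpDr.
  by apply: sumr_ge0 => y _; rewrite mulr_ge0 ?sqrtr_ge0.
apply: (@le_trans _ _ (\sum_(y in T) P y * (1 - eps))).
  rewrite -mulr_suml; apply: (@le_trans _ _ ((1 - eta) * (1 - eps))).
    by have := mulr_ge0 eta0 (ltW e0); lra.
  by apply: ler_wpM2r => //; lra.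
apply: ler_sum => y yT; apply: ler_wpM2l => //.
apply: le_trans (sqrt_ge_id _) _; first lra.
by apply: ler_wsqrtr; exact: qg.
Qed.

Lemma classical_converse n eps gam eta b (T : {set Y}) :
  0 < gam -> 0 < b -> (forall y, y \in T -> P y <= b) -> 1 - eta <= \sum_(y in T) P y ->
  2 * eps / gam + eta < 1 -> transmission n eps ->
  exists M, [/\ (0 < M)%N, 1 - (2 * eps / gam + eta) <= M%:R * b & classical_code N n gam M].
Proof.
move=> g0 b0 Tb PT lt1 [Enc [Dec [cE cD]]].
have [P0 P1] := dP.
have [J [K [EK TK]]] := comp_channel_kraus hN cE cD.
rewrite (fidelity_classical_kraus P0 oe onf EK).
have [J2 [K2 [E2 T2]]] := channel_kraus cD.
have ee y : psd (ket_proj (e y)) by exact: psd_outer.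
have se y : is_state (ket_proj (e y)).
  by split; [exact: ee | rewrite mxtrace_outer oe eqxx].
pose Z y := channel_pow N (Enc (ket_proj (e y))).
have sEnc y : is_state (Enc (ket_proj (e y))).
  have [J1 [K1 [E1 T1]]] := channel_kraus cE; split; last by rewrite cE.2 (se y).2.
  by rewrite E1; exact: kraus_psd.
have pZ y : psd (Z y) by apply: channel_pow_psd => //; case: (sEnc y).
(* The projector on [e y] pulled back through the decoder, in the Heisenberg picture; these effects
   form a POVM since the basis is complete. *)
pose D y : OpMx R {ffun 'I_n -> B} := \sum_i (K2 i)^t* *m ket_proj (e y) *m K2 i.
have pD y : psd (D y).
  by apply: psd_sum => i _; have := psd_conj ((K2 i)^t*) (ee y); rewrite trmxCK.
have sD : \sum_y D y = 1%:M.
  rewrite exchange_big -T2; apply: eq_bigr => i _ /=.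
  by rewrite -mulmx_suml -mulmx_sumr ce mulmx1.
pose q y := \tr (D y *m Z y).
have q0 y : 0 <= q y by exact: psd_trace_mul.
have qE y : dotp (e y) ((Dec \o @channel_pow R A B N n \o Enc) (ket_proj (e y)) *m e y) = q y.
  rewrite /= -/(Z y) E2 /q -mxtrace_outer -mulmxA mxtrace_mulC -/(ket_proj _) /kraus /D mulmx_suml mulmx_sumr !raddf_sum; apply: eq_bigr => i _ /=.
  by rewrite -!mulmxA [RHS]mxtrace_mulC -!mulmxA.
under eq_bigr do rewrite qE.
move=> Fge; pose r y := complex.Re (q y).
have q1 y : r y <= 1.
  have h : \sum_z \tr (D z *m Z y) = 1.
    transitivity (\tr ((\sum_z D z) *m Z y)); first by rewrite mulmx_suml raddf_sum.
    by rewrite sD mul1mx channel_pow_trace // (sEnc y).2.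
  rewrite -lecR /r ge0_RRe // [X in _ <= X]rmorph1 -h (bigD1 y) //= lerDl.
  by apply: sumr_ge0 => z _; apply: psd_trace_mul.
(* [2 * sqrt r - 1 <= r] turns the fidelity into an average success probability, doubling the
   error. *)
have Pr : 1 - 2 * eps <= \sum_y P y * r y.
  have : \sum_y P y * (2 * Num.sqrt (r y) - 1) <= \sum_y P y * r y.
    apply: ler_sum => y _; apply: ler_wpM2l => //.
    have r0 : 0 <= r y by exact: Re_ge0.
    have := sqr_ge0 (Num.sqrt (r y) - 1).
    by rewrite sqrrB1 sqr_sqrtr // => h; lra.
  under eq_bigr do rewrite mulrBr mulr1 mulrCA.
  by rewrite sumrB P1 -mulr_sumr => h; move: Fge; rewrite -/r; lra.
pose G := [set y in T | 1 - gam <= r y].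
have PG : 1 - (2 * eps / gam + eta) <= \sum_(y in G) P y.
  have h1 : \sum_(y | ~~ (1 - gam <= r y)) P y <= 2 * eps / gam.
    rewrite ler_pdivlMr // mulr_suml.
    apply: (@le_trans _ _ (\sum_y P y * (1 - r y))); last first.
      under eq_bigr do rewrite mulrBr mulr1.
      by rewrite sumrB P1; lra.
    rewrite [X in _ <= X](bigID (fun y => ~~ (1 - gam <= r y))) /=.
    apply: ler_wpDr; first by apply: sumr_ge0 => y _; rewrite mulr_ge0 ?subr_ge0.
    by apply: ler_sum => y; rewrite -ltNge => h; apply: ler_wpM2l => //; lra.
  have h2 : \sum_(y in T) P y <= \sum_(y in G) P y + \sum_(y | ~~ (1 - gam <= r y)) P y.
    rewrite (bigID (fun y => 1 - gam <= r y)) /=; apply: lerD.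
      by rewrite le_eqVlt; apply/orP; left; apply/eqP; apply: eq_bigl => y; rewrite inE.
    rewrite [X in _ <= X](bigID (mem T)) /=; apply: ler_wpDr; first exact: sumr_ge0.
    by rewrite le_eqVlt; apply/orP; left; apply/eqP; apply: eq_bigl => y; rewrite andbC.
  by lra.
have GM : 1 - (2 * eps / gam + eta) <= #|G|%:R * b.
  apply: le_trans PG _; rewrite mulr_natl -sumr_const; apply: ler_sum => y.
  by rewrite inE => /andP[yT _]; exact: Tb.
have G0 : (0 < #|G|)%N.
  rewrite lt0n; apply/eqP => G00; move: GM; rewrite G00 mul0r; lra.
exists #|G|; split=> //.
have [y0 y0G] := card_gt0P G0.
(* Labels outside [G] go to a default message, so that the effects still sum to the identity; an
   added effect can only raise a success probability. *)
pose k (y : Y) : 'I_#|G| := enum_rank_in y0G y.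
exists (fun w => Enc (ket_proj (e (enum_val w)))), (fun w => \sum_(y | k y == w) D y).
split=> [w|w||w].
- exact: sEnc.
- exact: psd_sum.
- rewrite -sD (partition_big k xpredT) //=.
- have wG : enum_val w \in G by exact: enum_valP.
  have := wG; rewrite inE => /andP[_ h]; apply: le_trans h _.
  rewrite -/(Z _) (bigD1 (enum_val w)) /=; last by rewrite /k enum_valK_in.
  rewrite mulmxDl mxtraceD ReD; apply: ler_wpDr; last exact: lexx.
  by apply: Re_ge0; apply: psd_trace_mul => //; exact: psd_sum.
Qed.

End Classical.

Section ClassicalTheorem.
Variable R : realType.
Variables (A B : finType) (N : {linear OpMx R A -> OpMx R B}).
Hypotheses (hA : (0 < #|A|)%N) (hN : is_channel N).
Variables (X A' Rf : finType) (p : X -> R) (e : X -> KetMx R A') (f : X -> KetMx R Rf).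
Hypotheses (dp : is_distr p) (p1 : forall x, p x < 1).
Hypotheses (oe : orthonormal e) (ce : \sum_y e y *m (e y)^t* = 1%:M) (onf : orthonormal f).

Lemma CC_rate : CC N = ereal_inf [set limn_einf (fun n =>
     ereal_sup [set (m%:R * (- \sum_x p x * log2 (p x)) / n%:R)%:E | m in
       [set m : nat | transmits N (classical_state p e f) n eps m]])
   | eps in [set eps : R | 0 < eps]].
Proof.
have trE n eps m : transmits N (classical_state p e f) n eps m <->
    transmission N (prod_distr (m := m) p) (fun x : {ffun 'I_m -> X} => bigket (fun i => e (x i)))
      (fun x => bigket (fun i => f (x i))) n eps.
  by rewrite /transmits state_pow_classical.
apply: (capacity_from_cores dp p1 (c := 1)) => //.
- by move=> n eps; apply: classical_code1.
- move=> n m eps eta M T e0 eta0 M0 TM PT cM; apply/trE; rewrite mul1r.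
  apply: (classical_direct hN (prod_distr_is_distr m dp) _ _ _ e0 eta0 M0 TM PT cM).
  + exact: bigket_orthonormal.
  + exact: bigket_complete.
  + exact: bigket_orthonormal.
(* With [gam = eps] the lost mass is [2 * (eps / 8) / eps + 1 / 4 = 1 / 2], which leaves more than
   the [1 / 4] required. *)
- move=> eps e0; exists (eps / 8), (1 / 4); split; [by rewrite divr_gt0|by rewrite divr_gt0|].
  move=> n m T b b0 Tb PT /trE tr.
  have eE : 2 * (eps / 8) / eps = 1 / 4 by field; rewrite gt_eqF.
  have [||||M [M0 Mb cM]] := classical_converse hN (prod_distr_is_distr m dp) _ _ _ e0 b0 Tb PT _ tr.
  + exact: bigket_orthonormal.
  + exact: bigket_complete.
  + exact: bigket_orthonormal.
  + by rewrite eE; lra.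
  by exists M; split=> //; move: Mb; rewrite eE; lra.
Qed.

End ClassicalTheorem.

(** * Entanglement transmission *)

Section QuadraticForms.
Variable R : realType.

Definition qform (Y : finType) (u : Y -> Y -> R) (l : Y -> R) : R :=
  \sum_a \sum_b l a * l b * u a b.

(** Transitivity of the symmetric group: the sum over permutations is the same at every position. *)
Lemma sum_perm_diag K (u : 'I_K -> 'I_K -> R) (a : 'I_K) :
  K%:R * \sum_(s : 'S_K) u (s a) (s a) = #|{: 'S_K}|%:R * \sum_b u b b.
Proof.
have E b : \sum_(s : 'S_K) u (s b) (s b) = \sum_(s : 'S_K) u (s a) (s a).
  rewrite (reindex_inj (mulgI (tperm a b))) /=; apply: eq_bigr => s _.
  by rewrite permM tpermR.
transitivity (\sum_b \sum_(s : 'S_K) u (s b) (s b)).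
  rewrite [RHS](eq_bigr (fun=> \sum_(s : 'S_K) u (s a) (s a))) => [|b _]; last exact: E.
  by rewrite sumr_const card_ord mulr_natl.
rewrite exchange_big /= mulr_natl -sumr_const; apply: eq_bigr => s _ /=.
by rewrite [RHS](reindex_inj (@perm_inj _ s)).
Qed.

(** Double transitivity: a product [t] of two transpositions takes [(a, b)] to any pair [(c, d)] of
    distinct indices, and there are [K * (K - 1)] such pairs. *)
Lemma sum_perm_offdiag K (u : 'I_K -> 'I_K -> R) (a b : 'I_K) : a != b ->
  K%:R * (K%:R - 1) * \sum_(s : 'S_K) u (s a) (s b) =
  #|{: 'S_K}|%:R * \sum_c \sum_(d | d != c) u c d.
Proof.
move=> ab; have E c d : d != c -> \sum_(s : 'S_K) u (s c) (s d) = \sum_(s : 'S_K) u (s a) (s b).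
  move=> dc; pose g := tperm a c; pose t := (g * tperm (g b) d)%g.
  have ta : t a = c.
    rewrite /t permM tpermL tpermD //.
    by rewrite -{1}(tpermL a c) (inj_eq perm_inj) eq_sym.
  have tb : t b = d by rewrite /t permM tpermL.
  clearbody t; rewrite [RHS](reindex_inj (mulgI t)) /=; apply: eq_bigr => s _.
  by rewrite !permM ta tb.
transitivity (\sum_c \sum_(d | d != c) \sum_(s : 'S_K) u (s c) (s d)).
  set S := \sum_(s : 'S_K) u (s a) (s b); transitivity (\sum_(c : 'I_K) \sum_(d | d != c) S); last first.
    by apply: eq_bigr => c _; apply: eq_bigr => d dc; rewrite (E _ _ dc).
  have cc (c : 'I_K) : #|[pred d | d != c]| = K.-1 by rewrite cardC1 card_ord.
  under [RHS]eq_bigr => c _ do rewrite sumr_const cc.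
  have K0 : (0 < K)%N by exact: leq_ltn_trans (ltn_ord a).
  have kk : K%:R - 1 = K.-1%:R :> R by rewrite -[in LHS](prednK K0) -natr1 addrK.
  by rewrite kk sumr_const card_ord -mulrnA -[RHS]mulr_natl natrM [K%:R * _]mulrC.
under eq_bigr do rewrite exchange_big /=.
rewrite exchange_big /= mulr_natl -sumr_const; apply: eq_bigr => s _ /=.
rewrite [RHS](reindex_inj (@perm_inj _ s)); apply: eq_bigr => c _ /=.
by rewrite [RHS](reindex_inj (@perm_inj _ s)); apply: eq_bigl => d; rewrite (inj_eq perm_inj).
Qed.

(* Averaging over the permutations of the basis; the diagonal of a positive
   form dominates its off-diagonal part on average. *)
Lemma qform_perm K (u : 'I_K -> 'I_K -> R) (l : 'I_K -> R) (eta : R) :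
  0 <= eta -> (forall a, u a a <= 1) -> (forall a b, 2 * u a b <= u a a + u b b) ->
  K%:R ^+ 2 * (1 - eta) <= \sum_a \sum_b u a b ->
  (forall a, 0 <= l a) ->
  exists s : 'S_K, (\sum_a l a) ^+ 2 * (1 - 2 * eta) <=
    \sum_a \sum_b l a * l b * u (s a) (s b).
Proof.
move=> eta0 u1 ucs tot l0; set q := \sum_a l a.
pose P := #|{: 'S_K}|%:R : R.
have P0 : 0 < P by rewrite ltr0n; apply/card_gt0P; exists 1%g.
apply/not_existsP => h.
have lt : \sum_(s : 'S_K) \sum_a \sum_b l a * l b * u (s a) (s b) < P * (q ^+ 2 * (1 - 2 * eta)).
  rewrite /P mulr_natl -sumr_const; apply: ltr_sum => [|s _]; last first.
    by rewrite ltNge; apply/negP; apply: h.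
  by apply/hasP; exists 1%g; rewrite // mem_index_enum.
move: lt; rewrite ltNge => /negP; apply.
rewrite exchange_big /=; under [X in _ <= X]eq_bigr do rewrite exchange_big /=.
under [X in _ <= X]eq_bigr => a _ do under eq_bigr => b _ do rewrite -mulr_sumr.
pose D := \sum_a u a a; pose O := \sum_c \sum_(d | d != c) u c d.
have totE : \sum_a \sum_b u a b = D + O.
  by rewrite -big_split; apply: eq_bigr => a _; rewrite (bigD1 a).
have KD : D + O <= K%:R * D.
  rewrite -totE.
  have : \sum_a \sum_b 2 * u a b <= \sum_a \sum_b (u a a + u b b) by apply: ler_sum => a _; apply: ler_sum.
  under [X in _ <= X -> _]eq_bigr do rewrite big_split /= sumr_const card_ord.
  rewrite big_split /= sumr_const card_ord -mulr_natl -/D.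
  under [X in _ <= X + _ -> _]eq_bigr do rewrite -mulr_natl.
  rewrite -mulr_sumr -/D.
  under eq_bigr do rewrite -mulr_sumr.
  rewrite -mulr_sumr; lra.
have DK : D <= K%:R by rewrite -[K in K%:R]card_ord -sumr_const; apply: ler_sum.
have q2 : q ^+ 2 = \sum_a \sum_b l a * l b.
  by rewrite expr2 mulr_suml; apply: eq_bigr => a _; rewrite mulr_sumr.
rewrite totE in tot.
have [K0|K0] := posnP K.
  have noord (a : 'I_K) : False by case: a => a; rewrite K0.
  have -> : q = 0 by apply: big1 => a; case: (noord a).
  rewrite expr0n mul0r mulr0; apply: sumr_ge0 => a; by case: (noord a).
have KR : 0 < K%:R :> R by rewrite ltr0n.
(* Origin of [1 - 2 * eta]: the diagonal average [D / K] is at least [1 - eta]. As [D <= K], the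
   off-diagonal average is at least [(K^2 (1 - eta) - K) / (K (K - 1))], which is at least
   [1 - 2 eta] once [K >= 2]. *)
have key a b : P * (1 - 2 * eta) <= \sum_(s : 'S_K) u (s a) (s b).
  case: (eqVneq a b) => [<-|ab].
    have := sum_perm_diag u a; rewrite -/D -/P => hD.
    have h1 : K%:R * (1 - eta) <= D.
      by rewrite -(ler_pM2l KR); apply: le_trans KD; apply: le_trans tot; rewrite expr2 mulrA.
    rewrite -(ler_pM2l KR) hD mulrCA ler_pM2l //; apply: le_trans h1.
    by rewrite ler_pM2l //; lra.
  have := sum_perm_offdiag u ab; rewrite -/O -/P => hO.
  have K1 : 1 <= K%:R - 1 :> R.
    rewrite lerBrDl -[1 + 1]/(2%:R) ler_nat ltnNge; apply: contra ab => K1.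
    have z (c : 'I_K) : c = 0%N :> nat.
      by apply/eqP; rewrite -leqn0 -ltnS (leq_trans (ltn_ord c)).
    by apply/eqP/val_inj; rewrite /= !z.
  have KK : 0 < K%:R * (K%:R - 1) :> R by rewrite mulr_gt0 //; lra.
  rewrite -(ler_pM2l KK) hO mulrCA ler_pM2l //.
  have : K%:R * eta <= K%:R * eta * (K%:R - 1).
    by rewrite ler_peMr // mulr_ge0 // ltW.
  move: tot DK; rewrite expr2.
  move=> h1 h2 h3; rewrite -subr_ge0.
  have -> : O - K%:R * (K%:R - 1) * (1 - 2 * eta) =
    (D + O - K%:R * K%:R * (1 - eta)) + (K%:R - D) +
    (K%:R * eta * (K%:R - 1) - K%:R * eta) by ring.
  by apply: addr_ge0; [apply: addr_ge0|]; rewrite subr_ge0.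
rewrite mulrCA q2 mulr_suml; apply: ler_sum => a _; rewrite mulr_suml; apply: ler_sum => b _.
by apply: ler_wpM2l (key a b); exact: mulr_ge0.
Qed.

Definition bform (Y : finType) (u : Y -> Y -> R) (l m : Y -> R) : R :=
  \sum_a \sum_b l a * m b * u a b.

Lemma qform_line (Y : finType) (u : Y -> Y -> R) (l d : Y -> R) t :
  (forall a b, u a b = u b a) ->
  qform u (fun a => l a + t * d a) = qform u l + 2 * t * bform u d l + t ^+ 2 * qform u d.
Proof.
move=> us; have sym : bform u d l = bform u l d.
  rewrite /bform exchange_big; apply: eq_bigr => a _; apply: eq_bigr => b _.
  by rewrite us [l a * _]mulrC.
have -> : 2 * t * bform u d l = t * bform u d l + t * bform u l d by rewrite -sym; ring.
rewrite /qform /bform !mulr_sumr -!big_split; apply: eq_bigr => a _ /=.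
rewrite !mulr_sumr -!big_split; apply: eq_bigr => b _ /=; ring.
Qed.

(* A convex function on the polytope [0 <= l <= 1/K, sum l = 1] is maximized at
   a vertex: mass is moved between two fractional coordinates. *)
Lemma qform_vertex (Y : finType) (u : Y -> Y -> R) K (l : Y -> R) :
  (0 < K)%N -> (forall a b, u a b = u b a) -> (forall d, 0 <= qform u d) ->
  (forall a, 0 <= l a <= K%:R^-1) -> \sum_a l a = 1 ->
  exists U : {set Y}, #|U| = K /\ qform u l <= K%:R^-1 ^+ 2 * \sum_(a in U) \sum_(b in U) u a b.
Proof.
move=> K0 us up; have KR : 0 < K%:R :> R by rewrite ltr0n.
set k := K%:R^-1; have k0 : 0 < k by rewrite invr_gt0.
pose frac (l : Y -> R) := [set a | 0 < l a < k].
(* Induction on the number of coordinates strictly between the bounds [0] and [k]. *)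
have [n] := ubnP #|frac l|; elim: n l => // n IH l; rewrite ltnS => ln lb l1.
have [F1|] := leqP #|frac l| 1.
  have Fint a : a \notin frac l -> l a = 0 \/ l a = k.
    rewrite inE negb_and -!leNgt => /orP[h|h]; [left|right]; apply/eqP;
      by case/andP: (lb a) => h1 h2; rewrite eq_le h ?h1 ?h2.
  pose U := [set a | l a == k].
  (* A single fractional coordinate is impossible: it would be [1 - #|U| / K], a multiple of [1 / K]
     strictly between [0] and [1 / K]. *)
  have F0 : frac l = finset.set0.
    apply/eqP/finset.set0Pn => -[x xF].
    have Fx a : a != x -> a \notin frac l.
      move=> ax; apply: contra ax => aF; apply/eqP.
      by move/card_le1_eqP: F1; apply.
    have : l x + #|U|%:R * k = 1.
      rewrite -[RHS]l1 (bigD1 x) //=; congr (_ + _).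
      rewrite (bigID (mem U)) /= [X in _ = _ + X]big1 => [|a /andP[ax aU]]; last first.
        by case: (Fint a (Fx a ax)) => // /eqP ak; move: aU; rewrite inE ak.
      rewrite addr0 mulr_natl -sumr_const; apply: eq_big => [a|a]; rewrite inE.
        case: (eqVneq a x) => [->|_]; rewrite ?andbT //=.
        by move: xF; rewrite inE => /andP[_ /lt_eqF ->].
      by move/eqP.
    move: xF; rewrite inE => /andP[x0 xk] h.
    have h2 : l x * K%:R = K%:R - #|U|%:R.
      have -> : l x = 1 - #|U|%:R * k by apply/esym/eqP; rewrite subr_eq h.
      by rewrite /k; field; rewrite gt_eqF.
    have a1 : 0 < K%:R - #|U|%:R :> R by rewrite -h2 mulr_gt0.
    have a2 : K%:R - #|U|%:R < 1 :> R by rewrite -h2 -ltr_pdivlMr // div1r.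
    rewrite subr_gt0 ltr_nat in a1.
    by move: a2; rewrite ltrBlDr -[1]/(1%:R) -natrD ltr_nat add1n ltnS leqNgt a1.
  have lE a : l a = (a \in U)%:R * k.
    have := Fint a; rewrite F0 inE => /(_ isT) [la|la]; rewrite inE la.
      by rewrite eq_sym gt_eqF // mul0r.
    by rewrite eqxx mul1r.
  exists U; split.
    apply/eqP; rewrite -(eqr_nat R); apply/eqP.
    have : #|U|%:R * k = 1.
      rewrite -[RHS]l1 mulr_natl -sumr_const big_mkcond; apply: eq_bigr => a _.
      by rewrite lE; case: (a \in U); rewrite ?mul1r ?mul0r.
    by move/(congr1 ( *%R^~ K%:R)); rewrite mulfVK ?gt_eqF // mul1r.
  rewrite /qform mulr_sumr [X in _ <= X]big_mkcond; apply: ler_sum => a _.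
  rewrite lE; case: (a \in U); last first.
    by under eq_bigr do rewrite !mul0r; rewrite big1.
  rewrite mulr_sumr [X in _ <= X]big_mkcond; apply: ler_sum => b _.
  by rewrite lE; case: (b \in U); rewrite !(mul0r, mulr0, mul1r) // expr2.
move=> /card_gt1P [x0 [y0 [x0F y0F xy0]]].
pose d (x y a : Y) : R := (a == x)%:R - (a == y)%:R.
(* The two coordinates are ordered so that the derivative along [d x y] is nonnegative; as the
   second-order term is nonnegative too, the form does not decrease. *)
have [x [y [xF yF xy B0]]] : exists x y, [/\ x \in frac l, y \in frac l, x != y &
    0 <= bform u (d x y) l].
  have [B0|B0] := leP 0 (bform u (d x0 y0) l); first by exists x0, y0.
  exists y0, x0; split; rewrite // 1?eq_sym //.
  have -> : bform u (d y0 x0) l = - bform u (d x0 y0) l.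
    rewrite /bform -sumrN; apply: eq_bigr => a _; rewrite -sumrN; apply: eq_bigr => b _.
    by rewrite /d; ring.
  by rewrite oppr_ge0 ltW.
move: (xF) (yF); rewrite !inE => /andP[lx0 lxk] /andP[ly0 lyk].
(* The largest admissible step: at its end [x] has reached [k] or [y] has reached [0], so one
   fractional coordinate is gone. *)
pose t := Num.min (k - l x) (l y).
have t0 : 0 < t by rewrite lt_min subr_gt0 lxk ly0.
have t1 : t <= k - l x by rewrite ge_min lexx.
have t2 : t <= l y by rewrite ge_min lexx orbT.
pose l' a := l a + t * d x y a.
have l'x : l' x = l x + t by rewrite /l' /d eqxx (negbTE xy) subr0 mulr1.
have l'y : l' y = l y - t by rewrite /l' /d eqxx eq_sym (negbTE xy) sub0r mulrN mulr1.
have l'o a : a != x -> a != y -> l' a = l a.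
  by move=> /negbTE ax /negbTE ay; rewrite /l' /d ax ay subrr mulr0 addr0.
have le : qform u l <= qform u l'.
  rewrite qform_line // -addrA lerDl addr_ge0 // mulr_ge0 ?sqr_ge0 //.
  by rewrite mulr_ge0 // ltW.
have fl : (#|frac l'| < n)%N.
  apply: leq_trans ln; apply: proper_card; apply/properP; split.
    apply/fintype.subsetP => a; rewrite !inE.
    case: (eqVneq a x) => [-> _|ax]; first by rewrite lx0.
    case: (eqVneq a y) => [-> _|ay]; first by rewrite ly0.
    by rewrite l'o.
  have [h|h] := leP (k - l x) (l y).
    exists x => //; rewrite inE l'x /t; have -> : Num.min (k - l x) (l y) = k - l x by apply/min_idPl.
    by rewrite addrC subrK ltxx andbF.
  exists y => //; rewrite inE l'y /t; have -> : Num.min (k - l x) (l y) = l y by apply/min_idPr/ltW.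
  by rewrite subrr ltxx.
have [||U [UK UG]] := IH l' fl.
- move=> a; case: (eqVneq a x) => [->|ax]; first by rewrite l'x; apply/andP; split; lra.
  case: (eqVneq a y) => [->|ay]; first by rewrite l'y; apply/andP; split; lra.
  by rewrite l'o.
- rewrite /l' big_split /= l1 -mulr_sumr /d sumrB.
  have one z : \sum_a (a == z)%:R = 1 :> R.
    by rewrite (bigD1 z) //= eqxx big1 ?addr0 // => a /negbTE ->.
  by rewrite !one subrr mulr0 addr0.
by exists U; split=> //; apply: le_trans le UG.
Qed.

(** The lost weights [l a * l b - lt a * lt b] are nonnegative and multiply entries at most 1. Their
    total is [1 - q^2 <= 2 * (1 - q) <= 2 * eta]. *)
Lemma qform_restrict (Y : finType) (u : Y -> Y -> R) (l : Y -> R) (T : {set Y}) eta :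
  (forall a b, u a b <= 1) -> (forall a, 0 <= l a) -> \sum_a l a = 1 ->
  1 - eta <= \sum_(a in T) l a ->
  qform u l - 2 * eta <= qform u (fun a => if a \in T then l a else 0).
Proof.
move=> u1 l0 l1 lT; pose lt a := if a \in T then l a else 0.
set q := \sum_(a in T) l a in lT.
have q0 : 0 <= q by exact: sumr_ge0.
have qE : \sum_a lt a = q by rewrite -big_mkcond.
have q1 : q <= 1.
  by rewrite -l1 -qE; apply: ler_sum => a _; rewrite /lt; case: ifP.
have h : \sum_a \sum_b (l a * l b - lt a * lt b) * u a b <= \sum_a \sum_b (l a * l b - lt a * lt b).
  apply: ler_sum => a _; apply: ler_sum => b _; apply: ler_piMr => //.
  by rewrite subr_ge0 /lt; case: (a \in T); case: (b \in T); rewrite ?mul0r ?mulr0 ?mulr_ge0.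
have h2 : \sum_a \sum_b (l a * l b - lt a * lt b) = 1 - q ^+ 2.
  under eq_bigr do rewrite sumrB -!mulr_sumr l1 qE mulr1.
  by rewrite sumrB l1 -mulr_suml qE expr2.
have h3 : \sum_a \sum_b (l a * l b - lt a * lt b) * u a b = qform u l - qform u lt.
  rewrite /qform -sumrB; apply: eq_bigr => a _; rewrite -sumrB; apply: eq_bigr => b _.
  by rewrite mulrBl.
have : 0 <= (1 - q) ^+ 2 by exact: sqr_ge0.
rewrite h2 h3 in h; rewrite expr2 => h4; rewrite expr2 in h; lra.
Qed.

End QuadraticForms.

(** * The entanglement fidelity as a Gram form *)

Section Gram.
Variable R : realType.
Local Notation C := R[i].

(** The real part suffices because the form is evaluated at real weights only. *)
Definition gram (J Y : finType) (c : J -> Y -> C) (a b : Y) : R :=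
  complex.Re (\sum_k c k a * Num.conj (c k b)).

Lemma Re_conj (z : C) : complex.Re (Num.conj z) = complex.Re z.
Proof. by case: z. Qed.

Lemma gram_sym (J Y : finType) (c : J -> Y -> C) a b : gram c a b = gram c b a.
Proof.
rewrite /gram -Re_conj rmorph_sum; congr (complex.Re _); apply: eq_bigr => k _.
by rewrite rmorphM /= conjCK mulrC.
Qed.

Lemma gram_qform (J Y : finType) (c : J -> Y -> C) (l : Y -> R) :
  qform (gram c) l = complex.Re (\sum_k `|\sum_a (l a)%:C * c k a| ^+ 2).
Proof.
have E k : `|\sum_a (l a)%:C * c k a| ^+ 2 =
    \sum_a \sum_b (l a * l b)%:C * (c k a * Num.conj (c k b)).
  rewrite normCK mulr_suml; apply: eq_bigr => a _.
  rewrite rmorph_sum mulr_sumr; apply: eq_bigr => b _.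
  by rewrite rmorphM /= conj_real rmorphM /=; ring.
under [in RHS]eq_bigr do rewrite E.
rewrite exchange_big /= Re_sum; apply: eq_bigr => a _.
rewrite exchange_big /= Re_sum; apply: eq_bigr => b _.
by rewrite -mulr_sumr ReZ.
Qed.

Lemma gram_qform_ge0 (J Y : finType) (c : J -> Y -> C) (l : Y -> R) : 0 <= qform (gram c) l.
Proof.
by rewrite gram_qform; apply: Re_ge0; apply: sumr_ge0 => k _; rewrite exprn_ge0.
Qed.

Lemma gram_cs (J Y : finType) (c : J -> Y -> C) a b :
  2 * gram c a b <= gram c a a + gram c b b.
Proof.
have : 0 <= complex.Re (\sum_k `|c k a - c k b| ^+ 2).
  by apply: Re_ge0; apply: sumr_ge0 => k _; rewrite exprn_ge0.
have -> : \sum_k `|c k a - c k b| ^+ 2 =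
    \sum_k c k a * Num.conj (c k a) + \sum_k c k b * Num.conj (c k b)
    - \sum_k c k a * Num.conj (c k b) - \sum_k c k b * Num.conj (c k a).
  rewrite -!sumrN -!big_split; apply: eq_bigr => k _ /=.
  by rewrite normCK rmorphB /=; ring.
have ReN (z : C) : complex.Re (- z) = - complex.Re z by case: z.
rewrite !ReD !ReN -/(gram c a a) -/(gram c b b) -/(gram c a b) -/(gram c b a).
by rewrite (gram_sym c b a) => h; lra.
Qed.

Lemma dotp_le n (w v : 'cV[C]_n) : dotp w w = 1 -> `|dotp w v| ^+ 2 <= dotp v v.
Proof.
move=> w1; have := dotpp_ge0 (v + (- dotp w v) *: w).
rewrite dotpDl !dotpDr !dotpZl !dotpZr w1 (dotp_conj v w) normCK rmorphN => h.
by rewrite -subr_ge0; move: h; congr (0 <= _); ring.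
Qed.

Definition diag_amp (J Y : finType) n (K : J -> 'M[C]_n) (w : Y -> 'cV[C]_n) (k : J) (y : Y) : C :=
  dotp (w y) (K k *m w y).

Lemma gram_diag_le1 (J Y : finType) n (K : J -> 'M[C]_n) (w : Y -> 'cV[C]_n) a :
  kraus_tp K -> orthonormal w -> gram (diag_amp K w) a a <= 1.
Proof.
move=> tK ow; have wa : dotp (w a) (w a) = 1 by rewrite ow eqxx.
rewrite /gram; under eq_bigr do rewrite -normCK.
have h : \sum_k `|diag_amp K w k a| ^+ 2 <= 1.
  rewrite -wa -[X in dotp _ X]mul1mx -tK mulmx_suml dotp_sumr; apply: ler_sum => k _.
  by apply: le_trans (dotp_le _ wa) _; rewrite -mulmxA -{1}(trmxCK (K k)) -dotp_mulr.
rewrite -lecR ge0_RRe //; apply: sumr_ge0 => k _; exact: exprn_ge0.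
Qed.

Lemma gram_le1 (J Y : finType) n (K : J -> 'M[C]_n) (w : Y -> 'cV[C]_n) a b :
  kraus_tp K -> orthonormal w -> gram (diag_amp K w) a b <= 1.
Proof.
move=> tK ow; have := gram_cs (diag_amp K w) a b.
have := gram_diag_le1 a tK ow; have := gram_diag_le1 b tK ow.
move: (gram _ a a) (gram _ b b) (gram _ a b) => x y z; lra.
Qed.

Lemma mxtrace_sum_outer (Y : finType) n (K : 'M[C]_n) (d : Y -> C) (w : Y -> 'cV[C]_n) :
  \tr (K *m \sum_y d y *: (w y *m (w y)^t*)) = \sum_y d y * dotp (w y) (K *m w y).
Proof.
rewrite mulmx_sumr raddf_sum; apply: eq_bigr => y _ /=.
by rewrite -scalemxAr mxtraceZ mulmxA mxtrace_outer.
Qed.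

Lemma fidelity_gram (S E J Y : finType) (psi : KetMx R (S * E)) (P : Y -> R) (w : Y -> KetMx R S)
    (Phi : OpMx R S -> OpMx R S) (K : J -> OpMx R S) :
  dotp psi psi = 1 -> ptrace2 (ket_proj psi) = \sum_y (P y)%:C *: (w y *m (w y)^t*) ->
  Phi =1 kraus K ->
  fidelity (ket_proj psi) (ext_id Phi (ket_proj psi)) = Num.sqrt (qform (gram (diag_amp K w)) P).
Proof.
move=> psi1 rhoE PK; rewrite (fidelity_pure_kraus psi1 PK) gram_qform rhoE.
by under eq_bigr do rewrite mxtrace_sum_outer.
Qed.

End Gram.

(** * Coherent relabelling between bases *)

Section Relabel.
Variable R : realType.
Local Notation C := R[i].

(** For orthonormal families and [g] injective on [T], the partial isometry taking [v y] to
    [u (g y)] for [y] in [T]. *)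
Definition relabel (Y Y' S S' : finType) (v : Y -> KetMx R S) (u : Y' -> KetMx R S')
    (T : {set Y}) (g : Y -> Y') : LinMx R S S' :=
  \sum_(y in T) u (g y) *m (v y)^t*.

(** The partial isometry is completed to a channel by resetting each [v y] outside [T] to [u a0]. *)
Lemma relabel_kraus (Y Y' S S' : finType) (v : Y -> KetMx R S) (u : Y' -> KetMx R S')
    (T : {set Y}) (g : Y -> Y') (a0 : Y') :
  \sum_y v y *m (v y)^t* = 1%:M -> orthonormal u -> {in T &, injective g} ->
  exists K : unit + Y -> LinMx R S S', kraus_tp K /\ K (inl tt) = relabel v u T g.
Proof.
move=> cv ou gT.
exists (fun o => if o is inr y then (y \notin T)%:R *: (u a0 *m (v y)^t*) else relabel v u T g).
split=> //; rewrite /kraus_tp big_sumType sum_unit /= -cv [RHS](bigID (mem T)) /=; congr (_ + _).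
  rewrite adj_sum mulmx_suml; apply: eq_bigr => y yT.
  rewrite mulmx_sumr (bigD1 y) //= big1 ?addr0 => [|z /andP[zT zy]].
    by rewrite adjM trmxCK mulmxA outer_mul ou eqxx scale1r.
  rewrite adjM trmxCK mulmxA outer_mul ou (inj_in_eq gT) // eq_sym (negbTE zy).
  by rewrite scale0r mul0mx.
rewrite [RHS]big_mkcond; apply: eq_bigr => y _.
case: (y \in T) => /=; first by rewrite scale0r mulmx0.
by rewrite scale1r adjM trmxCK mulmxA outer_mul ou eqxx scale1r.
Qed.

Lemma relabel_adj (Y Y' S S' : finType) (v : Y -> KetMx R S) (u : Y' -> KetMx R S')
    (T : {set Y}) (g : Y -> Y') (h : Y' -> Y) :
  {in T, cancel g h} -> relabel u v (g @: T)%SET h = (relabel v u T g)^t*.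
Proof.
move=> gh; rewrite /relabel adj_sum big_imset => [|y z yT zT e]; last first.
  by rewrite -(gh y yT) e gh.
by apply: eq_bigr => y yT; rewrite gh // adjM trmxCK.
Qed.

Lemma relabel_mul (Y Y' S S' : finType) (v : Y -> KetMx R S) (u : Y' -> KetMx R S')
    (T : {set Y}) (g : Y -> Y') y :
  orthonormal v -> relabel v u T g *m v y = (y \in T)%:R *: u (g y).
Proof.
move=> ov; rewrite mulmx_suml; case: (boolP (y \in T)) => yT.
  rewrite (bigD1 y) //= big1 ?addr0 ?scale1r ?outer_mul ?ov ?eqxx ?scale1r // => z /andP[_ zy].
  by rewrite outer_mul ov (negbTE zy) scale0r.
rewrite scale0r big1 // => z zT; rewrite outer_mul ov.
by case: eqP => [zy|]; [rewrite -zy zT in yT | rewrite scale0r].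
Qed.

End Relabel.

Section EntTransmission.
Variable R : realType.
Local Notation C := R[i].
Variables (A B : finType) (N : {linear OpMx R A -> OpMx R B}).
Hypothesis hN : is_channel N.

(** [transmits] for an arbitrary pure state; it covers both the maximally entangled state and the
    powers of [psi]. *)
Definition ent_transmission (S E : finType) (psi : KetMx R (S * E)) n eps :=
  exists (Enc : {linear OpMx R S -> OpMx R {ffun 'I_n -> A}})
    (Dec : {linear OpMx R {ffun 'I_n -> B} -> OpMx R S}),
  [/\ is_channel Enc, is_channel Dec & 1 - eps <=
    fidelity (ket_proj psi)
      (ext_id (Dec \o @channel_pow R A B N n \o Enc) (ket_proj psi))].

Variables (S1 S2 E2 Y1 Y2 : finType) (w1 : Y1 -> KetMx R S1) (w2 : Y2 -> KetMx R S2)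
  (psi2 : KetMx R (S2 * E2)) (P2 : Y2 -> R).
Hypotheses (o1 : orthonormal w1) (c1 : \sum_y w1 y *m (w1 y)^t* = 1%:M)
  (o2 : orthonormal w2) (c2 : \sum_y w2 y *m (w2 y)^t* = 1%:M)
  (psi2_1 : dotp psi2 psi2 = 1)
  (rho2 : ptrace2 (ket_proj psi2) = \sum_y (P2 y)%:C *: (w2 y *m (w2 y)^t*)).

(** Both directions convert a given scheme in this way: the encoder relabels [T] into the basis [w1]
    and the decoder relabels back. In the squared fidelity only the terms where both relabelling
    channels act by their partial isometry are kept; the others are nonnegative. *)
Lemma ent_transmission_relabel n eps (J : finType) (L : J -> OpMx R S1)
    (Enc : {linear OpMx R S1 -> OpMx R {ffun 'I_n -> A}})
    (Dec : {linear OpMx R {ffun 'I_n -> B} -> OpMx R S1}) (T : {set Y2}) (g : Y2 -> Y1) :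
  is_channel Enc -> is_channel Dec ->
  (Dec \o @channel_pow R A B N n \o Enc) =1 kraus L ->
  {in T &, injective g} -> (0 < #|Y1|)%N -> (0 < #|Y2|)%N ->
  1 - eps <= Num.sqrt (\sum_(a in T) \sum_(b in T) P2 a * P2 b * gram (diag_amp L w1) (g a) (g b)) ->
  ent_transmission psi2 n eps.
Proof.
move=> cE cD EL gT /card_gt0P [a0 _] /card_gt0P [y0 _] ineq.
pose h a := odflt y0 [pick y in T | g y == a].
have gh : {in T, cancel g h}.
  move=> y yT; rewrite /h; case: pickP => [z /andP[zT /eqP gz]|/(_ y)].
    by apply: gT.
  by rewrite yT eqxx.
have hT : {in (g @: T)%SET &, injective h}.
  move=> a b /imsetP [y yT ->] /imsetP [z zT ->]; by rewrite !gh // => ->.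
have [KE [tE KE0]] := relabel_kraus a0 c2 o1 gT.
have [KD [tD KD0]] := relabel_kraus y0 c1 o2 hT.
have [JE [KE' [EE' tE']]] := channel_kraus cE.
have [JD [KD' [ED' tD']]] := channel_kraus cD.
exists (Enc \o kraus KE), (kraus KD \o Dec).
have cE2 : is_channel (Enc \o kraus KE).
  apply: (kraus_is_channel _ (kraus_tp_comp tE' tE)) => Z /=.
  by rewrite EE' kraus_comp.
have cD2 : is_channel (kraus KD \o Dec).
  apply: (kraus_is_channel _ (kraus_tp_comp tD tD')) => Z /=.
  by rewrite ED' kraus_comp.
split=> //; apply: le_trans ineq _.
have EK : ((kraus KD \o Dec) \o @channel_pow R A B N n \o (Enc \o kraus KE)) =1
    kraus (fun x => KD x.1.1 *m L x.1.2 *m KE x.2).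
  move=> Z; have := EL (kraus KE Z) => /= ELZ.
  rewrite /= ELZ kraus_comp kraus_comp.
  by [].
rewrite (fidelity_pure_kraus psi2_1 EK); apply: ler_wsqrtr.
pose lT y := if y \in T then P2 y else 0.
have -> : \sum_(a in T) \sum_(b in T) P2 a * P2 b * gram (diag_amp L w1) (g a) (g b) =
    qform (gram (fun k y => diag_amp L w1 k (g y))) lT.
  rewrite /qform big_mkcond; apply: eq_bigr => a _; rewrite /lT; case: (a \in T); last first.
    by under eq_bigr do rewrite !mul0r; rewrite big1.
  rewrite big_mkcond; apply: eq_bigr => b _; case: (b \in T) => //.
  by rewrite mulr0 mul0r.
rewrite gram_qform -lecR !ge0_RRe; [|by apply: sumr_ge0 => *; rewrite exprn_ge0..].
(* The decoder relabelling is the adjoint of the encoder one, so cyclicity of the trace conjugates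
   the reduced state by [KE (inl tt)]. *)
have trE k : \tr (KD (inl tt) *m L k *m KE (inl tt) *m ptrace2 (ket_proj psi2)) =
    \sum_a (lT a)%:C * diag_amp L w1 k (g a).
  rewrite KD0 (relabel_adj _ _ gh) -KE0 -!mulmxA mxtrace_mulC -!mulmxA.
  rewrite [KE (inl tt) *m _]mulmxA rho2 conj_sum_outer mxtrace_sum_outer KE0.
  apply: eq_bigr => y _; rewrite !(relabel_mul _ _ _ _ o2) /lT -scalemxAr dotpZl dotpZr conjC_nat.
  by case: (y \in T); rewrite ?mul1r // !(mul0r, mulr0).
rewrite sum_pair [X in _ <= X]exchange_big (bigD1 (inl tt)) //=.
apply: ler_wpDr.
  by apply: sumr_ge0 => *; apply: sumr_ge0 => *; rewrite exprn_ge0.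
rewrite sum_pair (bigD1 (inl tt)) //=; apply: ler_wpDr.
  by apply: sumr_ge0 => *; apply: sumr_ge0 => *; rewrite exprn_ge0.
by under [X in _ <= X]eq_bigr do rewrite trE.
Qed.

End EntTransmission.

(** * One-shot bounds for entanglement transmission *)

Section MaxEntangled.
Variable R : realType.
Local Notation C := R[i].

Definition max_ket (K : nat) : KetMx R ('I_K * 'I_K) :=
  mkket (fun x => (x.1 == x.2)%:R * sqrtC (K%:R^-1)).

Lemma max_entangledE K : max_entangled R K = ket_proj (max_ket K).
Proof.
apply: entryP => x y; rewrite entry_mkhom entry_outer !kent_mkket rmorphM /= conjC_nat.
have -> : Num.conj (sqrtC (K%:R^-1 : C)) = sqrtC (K%:R^-1).
  by apply/CrealP/ger0_real; rewrite sqrtC_ge0 invr_ge0 ler0n.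
by rewrite mulrACA -natrM -expr2 sqrtCK.
Qed.

Lemma max_ket_ptrace K : ptrace2 (ket_proj (max_ket K)) =
  \sum_(a : 'I_K) (K%:R^-1)%:C *: (std_ket R a *m (std_ket R a)^t*).
Proof.
rewrite -scaler_sumr std_ket_complete -max_entangledE; apply: entryP => a b.
rewrite entryZ entry1 !entry_mkhom fmorphV rmorph_nat mulrC.
under eq_bigr do rewrite entry_mkhom /=.
rewrite (bigD1 a) //= eqxx mul1r eq_sym big1 ?addr0 ?[b == a]eq_sym // => i /negbTE ia.
by rewrite [a == i]eq_sym ia !mul0r.
Qed.

Lemma max_ket_unit K : (0 < K)%N -> dotp (max_ket K) (max_ket K) = 1.
Proof.
move=> K0; rewrite -mxtrace_outer -/(ket_proj _) -mxtrace_ptrace2 max_ket_ptrace.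
rewrite -scaler_sumr std_ket_complete mxtraceZ mxtrace1 card_ord fmorphV rmorph_nat.
by rewrite mulVf // pnatr_eq0 -lt0n.
Qed.

Lemma le_sqrt_of_le (x y : R) : y <= 1 -> y <= x -> y <= Num.sqrt x.
Proof. by move=> y1 yx; apply: le_trans (sqrt_ge_id y1) (ler_wsqrtr yx). Qed.

Lemma sqrt_ge_sqr (x eps : R) : 0 <= x -> 1 - eps <= Num.sqrt x -> 1 - 2 * eps <= x.
Proof.
move=> x0 h; have := sqr_ge0 (Num.sqrt x - 1).
by rewrite sqrrB1 sqr_sqrtr // => h2; lra.
Qed.

Variables (A B : finType) (N : {linear OpMx R A -> OpMx R B}).
Hypothesis hN : is_channel N.

Lemma entanglement_codeE n eps K :
  entanglement_code N n eps K <-> ent_transmission N (max_ket K) n eps.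
Proof. by rewrite /entanglement_code /ent_transmission max_entangledE. Qed.

Lemma entanglement_code1 n eps : (0 < #|A|)%N -> 0 < eps -> entanglement_code N n eps 1.
Proof.
move=> /card_gt0P [a0 _] e0; apply/entanglement_codeE.
pose a : KetMx R {ffun 'I_n -> A} := std_ket R [ffun=> a0].
have sa : is_state (ket_proj a).
  by split; [exact: psd_outer | rewrite mxtrace_outer std_ket_on eqxx].
have s1 : is_state (ket_proj (std_ket R (0 : 'I_1))).
  by split; [exact: psd_outer | rewrite mxtrace_outer std_ket_on eqxx].
have p1 m (_ : 'I_1) : psd (1%:M : 'M[C]_m) by exact: psd1.
have sum1 m : \sum_(i < 1) (1%:M : 'M[C]_m) = 1%:M.
  by rewrite big_ord1.
have [J1 [K1 [T1 E1]]] := measure_prepare (p1 #|{: 'I_1}|) (sum1 _) (fun=> sa).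
have [J2 [K2 [T2 E2]]] := measure_prepare (p1 #|{: {ffun 'I_n -> B}}|) (sum1 _) (fun=> s1).
have cE : is_channel (kraus K1) by exact: kraus_is_channel T1.
have cD : is_channel (kraus K2) by exact: kraus_is_channel T2.
exists (kraus K1), (kraus K2); split=> //.
have [J [K [EK TK]]] := comp_channel_kraus hN cE cD.
rewrite (fidelity_gram (max_ket_unit (ltn0Sn 0)) (max_ket_ptrace 1) EK).
apply: le_sqrt_of_le; first by rewrite gerBl ltW.
rewrite /qform big_ord1 big_ord1 invr1 !mul1r /gram.
pose d := std_ket R (0 : 'I_1).
have dd : d *m d^t* = 1%:M by rewrite -(std_ket_complete R 'I_1) big_ord1.
(* In dimension one every Kraus operator is a scalar, and trace preservation makes the squared
   moduli sum to 1. *)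
have -> : \sum_k diag_amp K (std_ket R (T := 'I_1)) k 0 * Num.conj (diag_amp K (std_ket R (T := 'I_1)) k 0) = 1.
  transitivity (dotp d ((\sum_k (K k)^t* *m K k) *m d)).
    rewrite mulmx_suml dotp_sumr; apply: eq_bigr => k _.
    rewrite -mulmxA dotp_mulr trmxCK.
    have -> : K k *m d = diag_amp K (std_ket R (T := 'I_1)) k 0 *: d.
      by rewrite -[LHS]mul1mx -dd outer_mul.
    by rewrite dotpZl dotpZr std_ket_on eqxx mulr1 mulrC.
  by rewrite TK mul1mx std_ket_on eqxx.
by rewrite /= gerBl ltW.
Qed.

Variables (S E Y : finType) (psi : KetMx R (S * E)) (P : Y -> R) (w : Y -> KetMx R S).
Hypotheses (dP : is_distr P) (ow : orthonormal w) (cw : \sum_y w y *m (w y)^t* = 1%:M)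
  (psi1 : dotp psi psi = 1)
  (rho : ptrace2 (ket_proj psi) = \sum_y (P y)%:C *: (w y *m (w y)^t*)).

Lemma distr_card_gt0 : (0 < #|Y|)%N.
Proof.
rewrite lt0n; apply/eqP => Y0; have := oner_neq0 R; rewrite -dP.2 big1 ?eqxx // => y _.
by have := fintype0 y Y0.
Qed.

(** The labels of [T] are embedded by [g0] and then shuffled by the permutation from [qform_perm],
    which the encoder can apply. Errors: [2 * eps] for squaring the fidelity, doubled by the
    averaging, and [2 * eta] for the squared mass of [T]; together at most [4 * (eps + eta)]. *)
Lemma ent_direct n eps eta K (T : {set Y}) :
  0 < eps -> 0 <= eta -> (0 < K)%N -> (#|T| <= K)%N -> 1 - eta <= \sum_(y in T) P y ->
  entanglement_code N n eps K -> ent_transmission N psi n (4 * (eps + eta)).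
Proof.
move=> e0 eta0 K0 TK PT /entanglement_codeE [Enc [Dec [cE cD F]]].
have [P0 P1] := dP.
have [J [L [EL TL]]] := comp_channel_kraus hN cE cD.
rewrite (fidelity_gram (max_ket_unit K0) (max_ket_ptrace K) EL) in F.
move/(sqrt_ge_sqr (gram_qform_ge0 _ _)): F.
set u := gram _ => F.
have KR : 0 < K%:R :> R by rewrite ltr0n.
have tot : K%:R ^+ 2 * (1 - 2 * eps) <= \sum_a \sum_b u a b.
  rewrite mulrC -ler_pdivlMr ?exprn_gt0 //; apply: le_trans F _.
  rewrite /qform mulr_suml le_eqVlt; apply/orP; left; apply/eqP.
  apply: eq_bigr => a _; rewrite mulr_suml; apply: eq_bigr => b _.
  by rewrite mulrC expr2 invfM.
have [g0 g0T] := index_injection K0 TK.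
(* The spectrum on [T] carried to the [K] basis labels. *)
pose l a := \sum_(y in T | g0 y == a) P y.
have l0 a : 0 <= l a by exact: sumr_ge0.
have lq : \sum_a l a = \sum_(y in T) P y by rewrite [RHS](partition_big g0 xpredT).
have [|||s sP] := qform_perm (u := u) (l := l) (eta := 2 * eps) _ _ _ tot l0.
- by rewrite mulr_ge0 // ltW.
- by move=> a; apply: gram_diag_le1 => //; exact: std_ket_on.
- by move=> a b; exact: gram_cs.
apply: (ent_transmission_relabel (w1 := std_ket R (T := 'I_K)) (w2 := w) _ _ ow cw psi1 rho cE cD EL
  (T := T) (g := fun y => s (g0 y))).
- exact: std_ket_on.
- exact: std_ket_complete.
- by move=> y z yT zT /perm_inj; exact: g0T.
- by rewrite card_ord.
- exact: distr_card_gt0.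
have [small|big] := leP (1 - 4 * (eps + eta)) 0.
  exact: le_trans small (sqrtr_ge0 _).
apply: le_sqrt_of_le; first by rewrite gerBl mulr_ge0 // addr_ge0 // ltW.
have -> : \sum_(a in T) \sum_(b in T) P a * P b * gram (diag_amp L (std_ket R (T:='I_K))) (s (g0 a)) (s (g0 b))
   = \sum_a \sum_b l a * l b * u (s a) (s b).
  rewrite (partition_big g0 xpredT) //=; apply: eq_bigr => a _.
  transitivity (\sum_(y in T | g0 y == a) \sum_b P y * (l b * u (s a) (s b))); last first.
    rewrite exchange_big; apply: eq_bigr => b _ /=.
    by rewrite -mulr_suml -/(l a) mulrA.
  apply: eq_bigr => y /andP[yT /eqP ya].
  rewrite (partition_big g0 xpredT) //=; apply: eq_bigr => b _.
  rewrite /l mulr_suml mulr_sumr; apply: eq_bigr => z /andP[zT /eqP zb].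
  by rewrite ya zb -/u mulrA.
apply: le_trans sP; rewrite lq.
set q := \sum_(y in T) P y in PT *.
have q0 : 0 <= q by exact: sumr_ge0.
have h1 : 1 - 2 * eta <= q ^+ 2.
  have := sqr_ge0 (q - 1); rewrite sqrrB1; lra.
have e4 : 0 <= 1 - 2 * (2 * eps) by lra.
apply: (@le_trans _ _ ((1 - 2 * eta) * (1 - 2 * (2 * eps)))); last exact: ler_wpM2r.
have := mulr_ge0 eta0 (ltW e0); lra.
Qed.

Lemma ent_converse n eps gam eta b (T : {set Y}) : (0 < #|A|)%N ->
  0 < gam -> 0 <= eta -> eta <= 1 / 2 -> 2 * eps + 2 * eta <= gam ->
  0 < b -> (forall y, y \in T -> P y <= b) -> 1 - eta <= \sum_(y in T) P y ->
  ent_transmission N psi n eps ->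
  exists M, [/\ (0 < M)%N, 1 / 4 <= M%:R * b & entanglement_code N n gam M].
Proof.
move=> hA g0 eta0 eta2 small b0 Tb PT [Enc [Dec [cE cD F]]].
have [P0 P1] := dP.
have [J [L [EL TL]]] := comp_channel_kraus hN cE cD.
rewrite (fidelity_gram psi1 rho EL) in F.
move/(sqrt_ge_sqr (gram_qform_ge0 _ _)): F.
set u := gram _ => F.
have u1 a c : u a c <= 1 by exact: gram_le1.
have FT := qform_restrict u1 P0 P1 PT.
set PTf := (fun a => _) in FT; set q := \sum_(y in T) P y in PT.
have q2 : 1 / 2 <= q by lra.
have q0 : 0 < q by lra.
have q1 : q <= 1 by rewrite -P1 [X in _ <= X](bigID (mem T)) /= lerDl sumr_ge0.
have := @truncn_itv R (q / b) (divr_ge0 (ltW q0) (ltW b0)).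
(* The dimension is [K = floor (q / b)], the largest for which the normalized weights, at most
   [b / q], are bounded by [1 / K]. If it is 0, then [b > q >= 1 / 2] and a one-dimensional code is
   large enough. *)
case: (Num.truncn (q / b)) => [|k] /andP[].
  rewrite ltr_pdivrMr // mul1r => _ qb; exists 1%N; split=> //; first lra.
  exact: entanglement_code1.
move: k.+1 (ltn0Sn k) => K K0; rewrite ler_pdivlMr // ltr_pdivrMr // => Kb qK.
have KR : 0 < K%:R :> R by rewrite ltr0n.
have K1 : 1 <= K%:R :> R by rewrite ler1n.
pose l y := PTf y / q.
have PT0 y : 0 <= PTf y by rewrite /PTf; case: ifP.
have [||||U [UK UG]] := qform_vertex (u := u) (l := l) K0.
- exact: gram_sym.
- exact: gram_qform_ge0.
- move=> y; rewrite divr_ge0 ?(ltW q0) //= /l ler_pdivrMr // mulrC ler_pdivlMr //.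
  rewrite /PTf; case: ifP => yT; last by rewrite mul0r ltW.
  by apply: le_trans Kb; rewrite mulrC ler_pM2l // Tb.
- by rewrite -mulr_suml -big_mkcond divff // gt_eqF.
(* Normalization divides the form by [q^2 <= 1], and the form is nonnegative. *)
have lG : qform u PTf <= qform u l.
  have -> : qform u l = qform u PTf * (q^-1 ^+ 2).
    rewrite /qform mulr_suml; apply: eq_bigr => a _; rewrite mulr_suml; apply: eq_bigr => c _.
    by rewrite /l expr2; ring.
  apply: ler_peMr; first exact: gram_qform_ge0.
  by rewrite exprn_ege1 // invf_ge1.
exists #|U|; split; first by rewrite UK.
  (* From [(K + 1) * b > q >= 1 / 2] and [b <= K * b] one gets [K * b > 1 / 4]. *)
  rewrite UK; move: qK; rewrite -natr1 mulrDl mul1r => qK.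
  have : b <= K%:R * b by rewrite ler_peMl // ltW.
  lra.
apply/entanglement_codeE.
have U0 : (0 < #|U|)%N by rewrite UK.
apply: (ent_transmission_relabel (w1 := w) (w2 := std_ket R (T := 'I_#|U|)) ow cw _ _ (max_ket_unit U0)
  (max_ket_ptrace _) cE cD EL (T := [set: 'I_#|U|]) (g := enum_val)).
- exact: std_ket_on.
- exact: std_ket_complete.
- by move=> a c _ _; exact: enum_val_inj.
- exact: distr_card_gt0.
- by rewrite card_ord.
apply: le_sqrt_of_le; first by rewrite gerBl ltW.
have -> : \sum_(a in [set: 'I_#|U|]) \sum_(c in [set: 'I_#|U|])
    #|U|%:R^-1 * #|U|%:R^-1 * gram (diag_amp L w) (enum_val a) (enum_val c) =
    K%:R^-1 ^+ 2 * \sum_(a in U) \sum_(c in U) u a c.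
  under eq_bigl do rewrite inE.
  have -> : #|U|%:R = K%:R :> R by rewrite UK.
  rewrite -expr2 mulr_sumr [RHS]big_enum_val /=; apply: eq_bigr => a _.
  under eq_bigl do rewrite inE.
  by rewrite mulr_sumr [RHS]big_enum_val.
by apply: le_trans UG; apply: le_trans lG; lra.
Qed.

End MaxEntangled.

Section QuantumTheorem.
Variable R : realType.
Local Notation C := R[i].
Variables (A B : finType) (N : {linear OpMx R A -> OpMx R B}).
Hypotheses (hA : (0 < #|A|)%N) (hN : is_channel N).
Variables (A' Rf : finType) (psi : KetMx R (A' * Rf)).
Hypotheses (psi1 : dotp psi psi = 1) (ent : entangled psi).

Let rho := ptrace2 (ket_proj psi).
Let p (i : 'I_#|{: A'}|) : R := complex.Re (spectral_diag rho 0 i).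
Let w := spectral_vec rho.

Lemma ptrace2_ket_proj_psd (S E : finType) (u : KetMx R (S * E)) : psd (ptrace2 (ket_proj u)).
Proof.
have -> : ptrace2 (ket_proj u) =
    \sum_r ket_proj (mkket (fun s => kent u (s, r)) : KetMx R S).
  apply: entryP => s s'; rewrite entry_sum entry_mkhom; apply: eq_bigr => r _.
  by rewrite !entry_outer !kent_mkket.
by apply: psd_sum => r _; exact: psd_outer.
Qed.

Lemma pure_rhoE : rho = \sum_i (p i)%:C *: (w i *m (w i)^t*).
Proof.
have prho : psd rho by exact: ptrace2_ket_proj_psd.
rewrite {1}(spectral_dec (psd_herm prho)); apply: eq_bigr => i _.
by rewrite ge0_RRe // spectral_diag_ge0.
Qed.

Lemma pure_distr : is_distr p.
Proof.
have prho : psd rho by exact: ptrace2_ket_proj_psd.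
split=> [i|]; first by apply: Re_ge0; exact: spectral_diag_ge0.
apply: (@complexI R); rewrite real_complex_sum rmorph1.
have : \tr rho = 1 by rewrite mxtrace_ptrace2 mxtrace_outer.
rewrite pure_rhoE raddf_sum => <-; apply: eq_bigr => i _ /=.
by rewrite mxtraceZ mxtrace_outer spectral_vec_on eqxx mulr1.
Qed.

(* Otherwise the reduced state is the projector on [w x] and [psi] is the
   product of [w x] with its partial inner product with [psi]. *)
Lemma pure_lt1 x : p x < 1.
Proof.
have [p0 p1] := pure_distr; rewrite ltNge; apply/negP => px; apply: ent.
have py y : y != x -> p y = 0.
  move=> yx; apply/eqP; rewrite eq_le p0 andbT.
  have : p x + p y <= 1.
    rewrite -p1 (bigD1 x) //= (bigD1 y) //= addrA lerDl; exact: sumr_ge0.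
  by lra.
pose b y : KetMx R Rf := mkket (fun r => \sum_s Num.conj (kent (w y) s) * kent psi (s, r)).
have bb y : dotp (b y) (b y) = (p y)%:C.
  transitivity (dotp (w y) (rho *m w y)); last first.
    by rewrite pure_rhoE sum_outer_eigen ?dotpZr ?spectral_vec_on ?eqxx ?mulr1 //; exact: spectral_vec_on.
  rewrite !dotp_kent; under [RHS]eq_bigr do rewrite kent_mul mulr_sumr.
  under [RHS]eq_bigr => s _ do under eq_bigr => s' _ do rewrite entry_mkhom mulr_suml mulr_sumr.
  under [RHS]eq_bigr do rewrite exchange_big /=.
  rewrite [RHS]exchange_big; apply: eq_bigr => r _ /=.
  rewrite !kent_mkket rmorph_sum mulr_suml exchange_big /=; apply: eq_bigr => s _.
  rewrite mulr_sumr; apply: eq_bigr => s' _; rewrite entry_outer rmorphM /= conjCK.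
  by ring.
exists (w x), (b x); apply: ketP => -[s r]; rewrite kent_tens_ket /=.
have b0 y : y != x -> b y = 0.
  by move=> /py h; apply: dotpp_eq0; rewrite bb h.
(* Completeness of [w] expands [psi] as the sum of the products [w y (x) b y], a Schmidt
   decomposition; only the term of [x] survives. *)
have : \sum_y kent (w y) s * kent (b y) r = kent psi (s, r).
  under eq_bigr do rewrite kent_mkket mulr_sumr.
  rewrite exchange_big (bigD1 s) //= [X in _ + X]big1 ?addr0 => [|s' s's].
    under eq_bigr do rewrite mulrA -entry_outer.
    by rewrite -mulr_suml -entry_sum spectral_vec_complete entry1 eqxx mul1r.
  under eq_bigr do rewrite mulrA -entry_outer.
  by rewrite -mulr_suml -entry_sum spectral_vec_complete entry1 eq_sym (negbTE s's) mul0r.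
move=> <-; rewrite (bigD1 x) //= [X in _ + X]big1 ?addr0 // => y /b0 ->.
by have -> : kent (0 : KetMx R Rf) r = 0; [rewrite /kent mxE | rewrite mulr0].
Qed.

Lemma CQ_rate : CQ N = ereal_inf [set limn_einf (fun n =>
     ereal_sup [set (m%:R * (- \sum_x p x * log2 (p x)) / n%:R)%:E | m in
       [set m : nat | transmits N (ket_proj psi) n eps m]])
   | eps in [set eps : R | 0 < eps]].
Proof.
have trE n eps m : transmits N (ket_proj psi) n eps m <-> ent_transmission N (ket_pow m psi) n eps.
  by rewrite /transmits state_pow_ket_proj.
have rhom m : ptrace2 (ket_proj (ket_pow m psi)) =
    \sum_(x : {ffun 'I_m -> 'I_#|{: A'}|}) (prod_distr p x)%:C *:
      (bigket (fun i => w (x i)) *m (bigket (fun i => w (x i)))^t*).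
  by rewrite -state_pow_ket_proj ptrace2_state_pow -bigtens_sum_outer -/rho -pure_rhoE.
have dp := pure_distr.
have ow : orthonormal w := @spectral_vec_on _ _ _.
have cw : \sum_y w y *m (w y)^t* = 1%:M by exact: spectral_vec_complete.
apply: (capacity_from_cores dp pure_lt1 (c := 4)) => //.
- by move=> n eps; apply: entanglement_code1.
- move=> n m eps eta M T e0 eta0 M0 TM PT cM; apply/trE.
  apply: (ent_direct hN (prod_distr_is_distr m dp) _ _ (ket_pow_unit m psi1) (rhom m) e0 eta0 M0 TM PT cM).
  + exact: bigket_orthonormal.
  + exact: bigket_complete.
(* Serving as both error and lost mass, [e1] must satisfy [2 * e1 + 2 * e1 <= eps] and
   [e1 <= 1 / 2]. *)
- move=> eps e0; pose e1 := Num.min (eps / 4) (1 / 2).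
  have e10 : 0 < e1 by rewrite lt_min !divr_gt0.
  have e1e : e1 <= eps / 4 by rewrite ge_min lexx.
  have e12 : e1 <= 1 / 2 by rewrite ge_min lexx orbT.
  exists e1, e1; split=> // n m T b b0 Tb PT /trE tr.
  apply: (ent_converse hN (prod_distr_is_distr m dp) _ _ (ket_pow_unit m psi1) (rhom m) hA e0 (ltW e10) e12 _ b0 Tb PT tr).
  + exact: bigket_orthonormal.
  + exact: bigket_complete.
  + by lra.
Qed.

Lemma entropy_CQ_psi : entropy_CQ (ket_proj psi) = - \sum_x p x * log2 (p x).
Proof.
by rewrite entropy_CQ_pure // -/rho {1}pure_rhoE entropy_sum_outer //; exact: spectral_vec_on.
Qed.

End QuantumTheorem.

Theorem corollary8 (R : realType) (A B : finType)
    (N : {linear OpMx R A -> OpMx R B}) (hA : (0 < #|A|)%N) (hN : is_channel N) :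
  (forall (X A' Rf : finType) (p : X -> R)
      (e : X -> KetMx R A') (f : X -> KetMx R Rf),
    is_distr p -> (forall x, p x < 1) ->
    orthonormal_basis e -> orthonormal_basis f ->
    CC N = CG (classical_state p e f) N) /\
  (forall (A' Rf : finType) (psi : KetMx R (A' * Rf)),
    psi ^t* *m psi = 1%:M -> entangled psi ->
    CQ N = CG (ket_proj psi) N).
Proof.
split=> [X A' Rf p e f dp p1 [oe ce] [onf cf]|A' Rf psi psi1 ent].
  have on (Z T : finType) (v : Z -> KetMx R T) :
      (forall x y, (v x)^t* *m v y = ((x == y)%:R)%:M) -> orthonormal v.
    by move=> h x y; rewrite /dotp h mxE mulr1n.
  rewrite /CG /CG_n (entropy_CQ_classical dp (on _ _ _ oe) ce (on _ _ _ onf) cf).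
  exact: (CC_rate hA hN dp p1 (on _ _ _ oe) ce (on _ _ _ onf)).
have psi1' : dotp psi psi = 1 by rewrite /dotp psi1 mxE.
by rewrite /CG /CG_n entropy_CQ_psi //; exact: CQ_rate.
Qed.
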